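(* Let $N\ge3$ and $p\in(p_c,\infty]$. Let $u_0\in L^1(\mathbb{R}^N)\cap L^p_{\rm loc}(\mathbb{R}^N)$ be nonnegative and nontrivial, $u$ the mild solution, and $\mu>0$. Then $$\|t^\alpha u(\cdot,t)-\kappa\Phi\|_{L^p(B_\mu)}\to0\quad\text{as }t\to\infty.$$
   Context: Fix $N\ge1$ and $\alpha\in(0,1)$. Let $\mathbb{E}_\alpha(s)=\sum_{k\ge0}s^k/\Gamma(1+k\alpha)$ be the Mittag-Leffler function. The fundamental solution of the time-fractional heat equation $\partial_t^\alpha u=\Delta u$ (where $\partial_t^\alpha$ is the Caputo derivative $\partial_t^\alpha u(x,t)=\frac{1}{\Gamma(1-\alpha)}\partial_t\int_0^t\frac{u(x,\tau)-u(x,0)}{(t-\tau)^\alpha}\,d\tau$) is the function $Z$ on $\mathbb{R}^N\times(0,\infty)$ whose Fourier transform in $x$ is $\widehat Z(\omega,t)=\mathbb{E}_\alpha(-|\omega|^2t^\alpha)$. It has the self-similar form $Z(x,t)=t^{-\alpha N/2}F(xt^{-\alpha/2})$ with a positive radially symmetric profile $F$, smooth on $\mathbb{R}^N\setminus\{0\}$, $\int F=1$. For nonnegative nontrivial $u_0\in L^1(\mathbb{R}^N)$ the (mild) solution of $\partial_t^\alpha u=\Delta u$ in $\mathbb{R}^N\times(0,\infty)$, $u(\cdot,0)=u_0$, is $u(x,t)=\int_{\mathbb{R}^N}Z(x-y,t)u_0(y)\,dy$. For $N\ge3$: $p_c=N/(N-2)$, $E_N(\xi)=|\xi|^{2-N}$,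 and $\kappa=\kappa(N)>0$ is the constant such that $F(\xi)/E_N(\xi)\to\kappa$ as $\xi\to0$. The Newtonian potential of $u_0$ is $\Phi(x)=\int_{\mathbb{R}^N}\frac{u_0(x-y)}{|y|^{N-2}}\,dy$. $B_r$ is the open ball of radius $r$ centered at the origin. *)

(* Defs.v *)
From HB Require Import structures.
From mathcomp Require Import all_boot all_order all_algebra.
From mathcomp Require Import all_classical all_reals all_analysis.

Set Implicit Arguments.
Unset Strict Implicit.
Unset Printing Implicit Defensive.

Import Order.TTheory GRing.Theory Num.Theory.
Import numFieldNormedType.Exports.
Local Open Scope classical_set_scope.
Local Open Scope ring_scope.

(* Points of R^N are N-tuples of reals (n.-tuple R carries the product     *)
(* Borel sigma-algebra in MathComp-Analysis).                              *)

Section Rn.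
Variable R : realType.

Definition tsub n (x y : n.-tuple R) : n.-tuple R :=
  [tuple tnth x i - tnth y i | i < n].

Definition tscale n (c : R) (x : n.-tuple R) : n.-tuple R :=
  [tuple c * tnth x i | i < n].

Definition tdot n (x y : n.-tuple R) : R := \sum_(i < n) tnth x i * tnth y i.
Definition enorm n (x : n.-tuple R) : R := Num.sqrt (tdot x x).

Definition ballN n (r : R) : set (n.-tuple R) := [set x | enorm x < r].

(* Lebesgue integral over R^n, as the iterated one-dimensional Lebesgue
   integral (Fubini/Tonelli); n-dimensional Lebesgue measure is not in the
   library. *)
Fixpoint iint (n : nat) : (n.-tuple R -> \bar R) -> \bar R :=
  match n return (n.-tuple R -> \bar R) -> \bar R with
  | 0 => fun f => f [tuple]
  | n'.+1 => fun f =>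
      (\int[@lebesgue_measure R]_x iint (fun y : n'.-tuple R => f (cons_tuple x y)))%E
  end.

Definition LpOn n (p : \bar R) (A : set (n.-tuple R)) (f : n.-tuple R -> \bar R)
  : \bar R :=
  match p with
  | r%:E => ((iint (fun x => (\1_A x)%:E * (`| f x | `^ r)%E)) `^ r^-1)%E
  | _ => ereal_inf [set M : \bar R |
           iint (fun x => (\1_(A `&` [set y | (M < `| f y |)%E]) x)%:E) = 0%E]
  end.

Definition Gamma (z : R) : R :=
  Rintegral (@lebesgue_measure R) `]0, +oo[ (fun x => x `^ (z - 1) * expR (- x)).

Definition MittagLeffler (alpha s : R) : R :=
  limn (fun n => \sum_(0 <= k < n) s ^+ k / Gamma (1 + k%:R * alpha)).

Definition Zkernel n (alpha : R) (F : n.-tuple R -> R) (x : n.-tuple R) (t : R) : R :=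
  t `^ (- (alpha * n%:R / 2)) * F (tscale (t `^ (- (alpha / 2))) x).

Definition mild_sol n (alpha : R) (F : n.-tuple R -> R) (u0 : n.-tuple R -> R)
  (x : n.-tuple R) (t : R) : \bar R :=
  iint (fun y => (Zkernel alpha F (tsub x y) t * u0 y)%:E).

Definition newton_pot n (u0 : n.-tuple R -> R) (x : n.-tuple R) : \bar R :=
  iint (fun y => (u0 (tsub x y) / enorm y ^+ (n - 2))%:E).

End Rn.

(* Main.v *)
Require Import Defs.
From HB Require Import structures.
From mathcomp Require Import all_boot all_order all_algebra.
From mathcomp Require Import all_classical all_reals all_analysis.
From mathcomp Require Import measurable_realfun ring lra.

Import Order.TTheory GRing.Theory Num.Theory.
Import numFieldNormedType.Exports.
Local Open Scope classical_set_scope.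
Local Open Scope ring_scope.

(** Split [t^alpha u - kappa Phi] according to whether [|x - y| t^(-alpha/2) < d] or not.
    On the near part the integrand is at most [eps |x - y|^(2-N) u0(y)] by the definition
    of [kappa]; on the far part it is at most [C t^(-alpha(N-2)/2) u0(y)], provided that [F]
    is bounded off every ball around the origin. Hence
    [|t^alpha u - kappa Phi| <= eps Phi + c(t)] with [c(t) -> 0], and it remains to see that
    [Phi] is in [L^p(B_mu)]: the part of the kernel in the unit cube is integrable, so
    Young's inequality applies.

    The bound on [F] comes from its Fourier transform. As [F >= 0], it suffices to bound
    [int exp(-s|w|^2) cos(x.w) E_alpha(-|w|^2) dw] uniformly in [s]. Instead of the complete
    monotonicity of [E_alpha], we use that [E_alpha(-lam)] is the limit of the implicit
    Gruenwald-Letnikov scheme for the fractional relaxation equation: each iterate is a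
    subconvex combination of products of resolvents in [lam], and resolvents are convex
    combinations of the exponentials [exp(-k h lam)], which only shift [s]. Continuity of
    [F] then turns the bound on Gaussian averages into a pointwise bound. *)

Set Implicit Arguments.
Unset Strict Implicit.
Unset Printing Implicit Defensive.

(** * Lebesgue measure on tuples *)

(** The hypotheses on [F] give neither monotonicity nor decay, so a bound away from the origin has
    to be extracted from the transform alone. There [E_alpha(- |w|^2)] decays only like [|w|^(-2)],
    which is not integrable for [N >= 3], so Fourier inversion is not at hand and the oscillation of
    the cosine must be exploited. For a Gaussian this is an exact computation, and an estimate that
    is uniform in the width of the Gaussian survives averaging with nonnegative weights. To make the
    resolvents exact averages of Gaussians, the step of the scheme is [m = 1 - exp(- h lam)], for
    which [1 / (1 + m) = 1 / (2 - exp(- h lam)) = sum_k 2^(-k-1) exp(- k h lam)]. Two features of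
    the definitions shape the rest. [iint] is an iterated integral with no measure behind it, so a
    measure [leb n] is built to have Fubini, dominated convergence and null sets. And [F] is
    arbitrary at the origin while [|z|^(2-N)] is [0] there by the convention on inverses, so the
    origin has to be discarded as a null set. *)

Section Leb.
Variable R : realType.
Local Notation lebR := (@lebesgue_measure R).
Local Notation tup n := (n.-tuple (measurableTypeR R)).

Definition consT n (z : measurableTypeR R * tup n) : tup n.+1 :=
  [tuple of z.1 :: z.2].

Lemma measurable_consT n : measurable_fun [set: measurableTypeR R * tup n] (@consT n).
Proof. exact: measurable_cons. Qed.

Section step.
Variables (n : nat) (m : {sigma_finite_measure set (tup n) -> \bar R}).

(** The product measure is transported along [consT] with the head as outer variable, so that one
    Fubini step produces exactly one unfolding of [iint]. *)
Definition leb_step : set (tup n.+1) -> \bar R := pushforward (lebR \x m)%E (@consT n).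

Let mc A : measurable A -> measurable (@consT n @^-1` A).
Proof. by move=> mA; rewrite -[X in measurable X]setTI; exact: measurable_consT. Qed.

Let leb_step0 : leb_step set0 = 0%E.
Proof. by rewrite /leb_step /pushforward preimage_set0 measure0. Qed.

Let leb_step_ge0 A : (0 <= leb_step A)%E. Proof. by rewrite /leb_step /pushforward. Qed.

Let leb_step_sa : semi_sigma_additive leb_step.
Proof.
move=> F mF tF mUF; rewrite /leb_step /pushforward preimage_bigcup.
apply: measure_semi_sigma_additive.
- by move=> k; exact: mc.
- apply/trivIsetP => /= i j _ _ ij; rewrite -preimage_setI.
  by move/trivIsetP : tF => /(_ _ _ _ _ ij) ->//; rewrite preimage_set0.
- by rewrite -preimage_bigcup; exact: mc.
Qed.

HB.instance Definition _ := isMeasure.Build _ _ _ leb_step leb_step0 leb_step_ge0 leb_step_sa.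

Let leb_step_sf : sigma_finite setT leb_step.
Proof.
have [F [TF ndF Foo]] := (sigma_finiteP _ _).1 (sigma_finiteT lebR).
have [G [TG ndG Goo]] := (sigma_finiteP _ _).1 (sigma_finiteT m).
have cK (z : measurableTypeR R * tup n) : (thead (consT z), [tuple of behead (consT z)]) = z.
  case: z => a b; by congr pair; apply: val_inj.
have mu' : measurable_fun setT (fun x : tup n.+1 => (thead x,
  [tuple of behead x]) : measurableTypeR R * tup n).
  apply/measurable_fun_pairP; split; first exact: measurable_tnth.
  exact: measurable_behead.
exists (fun k => (fun x => (thead x, [tuple of behead x])) @^-1` (F k `*` G k)).
  rewrite -preimage_bigcup; apply/seteqP; split => // x _ /=.
  have [i _ Fi] : (\bigcup_i F i) (thead x) by rewrite -TF.
  have [j _ Gj] : (\bigcup_i G i) [tuple of behead x] by rewrite -TG.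
  (* Both exhaustions are nondecreasing, so one index serves for both. *)
  exists (maxn i j) => //; split => /=.
    by move: Fi; exact/subsetPset/ndF/leq_maxl.
  by move: Gj; exact/subsetPset/ndG/leq_maxr.
move=> k; have [mF Fk] := Foo k; have [mG Gk] := Goo k; split.
  by rewrite -[X in measurable X]setTI; apply: mu' => //; exact: measurableX.
rewrite /leb_step /pushforward -comp_preimage (_ : _ \o _ = id) ?preimage_id.
  by rewrite product_measure1E// lte_mul_pinfty// ge0_fin_numE.
by apply/funext => z /=; rewrite cK.
Qed.

HB.instance Definition _ := Measure_isSigmaFinite.Build _ _ _ leb_step leb_step_sf.

Lemma ge0_integral_leb_step (f : tup n.+1 -> \bar R) : measurable_fun [set: tup n.+1] f ->
  (forall x, 0 <= f x)%E ->
  (\int[leb_step]_x f x = \int[lebR]_x \int[m]_y f (consT (x, y)))%E.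
Proof.
move=> mf f0.
rewrite (@ge0_integral_pushforward _ _ _ _ _ (@consT n) _ _ setT)//; last exact: measurable_consT.
rewrite preimage_setT.
rewrite (fubini_tonelli1 (f \o @consT n))//; last by move=> z /=.
by apply: measurableT_comp => //; exact: measurable_consT.
Qed.

End step.

Lemma leb0_sf : sigma_finite [set: tup 0] (@dirac _ (tup 0) [tuple] R).
Proof.
exists (fun=> setT); first by rewrite bigcup_const.
by move=> _; split => //; rewrite diracT ltry.
Qed.
HB.instance Definition _ := Measure_isSigmaFinite.Build _ _ _ (@dirac _ (tup 0) [tuple] R) leb0_sf.

Fixpoint leb n : {sigma_finite_measure set (tup n) -> \bar R} :=
  match n with
  | 0 => @dirac _ (tup 0) [tuple] R
  | n'.+1 => leb_step (leb n')
  end.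

Lemma measurable_section n (f : tup n.+1 -> \bar R) x : measurable_fun setT f ->
  measurable_fun setT (fun y : tup n => f (cons_tuple (x : measurableTypeR R) y)).
Proof.
move=> mf; apply: measurableT_comp => //.
by apply: (@measurable_cons _ _ _ _ (fun=> x) n id).
Qed.

Lemma ge0_integral_leb n (f : n.-tuple R -> \bar R) : measurable_fun setT f ->
  (forall x, 0 <= f x)%E -> (\int[leb n]_x f x)%E = iint f.
Proof.
elim: n f => [|n IH] f mf f0.
  by rewrite /= integral_dirac// diracT mul1e.
rewrite [LHS]ge0_integral_leb_step//=; apply: eq_integral => x _.
rewrite -IH//; last exact: measurable_section.
Qed.

(** The integral of a signed function is by definition the difference of the integrals of its
    positive and negative parts, and Tonelli gives measurability of each. *)
Lemma measurable_integral2 d (T : measurableType d) (f : T * measurableTypeR R -> \bar R) :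
  measurable_fun setT f ->
  measurable_fun setT (fun x => \int[lebR]_y f (x, y))%E.
Proof.
move=> mf; rewrite (_ : (fun x => _) = (fun x =>
  (\int[lebR]_y (f^\+%E (x, y))) - \int[lebR]_y (f^\-%E (x, y)))%E); last first.
  apply/funext=> x; rewrite [LHS]integralE.
  under eq_integral do rewrite funepos_comp/=.
  by under [X in (_ - X = _)%E]eq_integral do rewrite funeneg_comp/=.
apply: emeasurable_funB.
- apply: (@measurable_fun_fubini_tonelli_F _ _ _ _ _ lebR f^\+%E) => //.
  exact: measurable_funepos.
- apply: (@measurable_fun_fubini_tonelli_F _ _ _ _ _ lebR f^\-%E) => //.
  exact: measurable_funeneg.
Qed.

(** The parameter space is generalized in the induction: the outermost integration variable is moved
    into it. *)
Lemma measurable_iint d (T : measurableType d) n (f : T -> n.-tuple R -> \bar R) :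
  measurable_fun setT (fun z : T * tup n => f z.1 z.2) ->
  measurable_fun setT (fun x => iint (f x)).
Proof.
elim: n d T f => [|n IH] d T f mf /=.
  exact: (measurableT_comp mf (pair2_measurable _)).
apply: (@measurable_integral2 _ _ (fun z => iint (fun y => f z.1 (cons_tuple z.2 y)))).
apply: (IH _ (T * measurableTypeR R)%type (fun z y => f z.1 (cons_tuple z.2 y))) => /=.
pose h (z : (T * measurableTypeR R) * tup n) := (z.1.1, consT (z.1.2, z.2)).
have mh : measurable_fun setT h.
  apply/measurable_fun_pairP; split => /=; first exact: (measurableT_comp measurable_fst
    measurable_fst).
  apply: (@measurable_cons _ _ _ _ (snd \o fst) n snd) => //.
  exact: (measurableT_comp measurable_snd measurable_fst).
have := measurableT_comp mf mh; congr (measurable_fun _ _); apply/funext => z /=.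
Qed.

Lemma integral_consT n (f : n.+1.-tuple R -> \bar R) : (leb n.+1).-integrable setT f ->
  (lebR \x leb n)%E.-integrable setT (f \o @consT n).
Proof.
move=> /integrableP[mf fi]; have mc := @measurable_consT n.
have mfc : measurable_fun setT (f \o @consT n) by exact: measurableT_comp.
apply/integrableP; split => //.
rewrite fubini_tonelli1//; last exact: measurableT_comp.
by move: fi; rewrite ge0_integral_leb_step//; exact: measurableT_comp.
Qed.

Lemma integral_leb_fubini n (f : n.+1.-tuple R -> \bar R) : (leb n.+1).-integrable setT f ->
  (\int[leb n.+1]_x f x = \int[lebR]_x \int[leb n]_y f (consT (x, y)))%E.
Proof.
move=> fi; have fci := integral_consT fi.
rewrite /= (@integral_pushforward _ _ _ _ _ _ (@measurable_consT n))//=.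
  by rewrite preimage_setT; exact: (esym (integral12_prod_meas1 fci)).
exact: measurable_int fi.
Qed.

(** Unlike in the nonnegative case, the sections are integrable only for almost every head, so the
    induction hypothesis gives equality of the inner integrals almost everywhere, and measurability
    of the inner [iint] must come from [measurable_iint]. *)
Lemma integral_leb n (f : n.-tuple R -> \bar R) : (leb n).-integrable setT f ->
  (\int[leb n]_x f x)%E = iint f.
Proof.
elim: n f => [|n IH] f fi.
  by rewrite /= integral_dirac// ?diracT ?mul1e//; exact: measurable_int fi.
have mf := measurable_int _ fi.
rewrite integral_leb_fubini//=; apply: ae_eq_integral => //.
- exact: (measurable_fubini_F (integral_consT fi)).
- apply: (@measurable_iint _ (measurableTypeR R)) => /=.
  have := measurableT_comp mf (@measurable_consT n).
  by congr (measurable_fun _ _); apply/funext => z /=; congr f; apply: val_inj.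
- have := ae_integrable1 (integral_consT fi).
  apply: filterS => x fxi _ /=; rewrite [LHS]IH//.
Qed.

(** Almost every section of a null set is null, so the induction goes through for almost every head.
    As it covers all measurable functions, an integrand can be altered at the origin before its
    integrability is known. *)
Lemma ae_eq_iint n (N : set (tup n)) (f g : n.-tuple R -> \bar R) :
  measurable_fun setT f -> measurable_fun setT g ->
  measurable N -> leb n N = 0%E -> (forall x, ~ N x -> f x = g x) -> iint f = iint g.
Proof.
elim: n N f g => [|n IH] N f g mf mg mN N0 fg.
  rewrite /=; apply: fg => N1; move: N0; rewrite /= diracE mem_set// => /eqP.
  by rewrite onee_eq0.
have mh (h : tup n.+1 -> \bar R) : measurable_fun setT h -> measurable_fun setT
    (fun x : measurableTypeR R => iint (fun y : n.-tuple R => h (cons_tuple x y))).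
  move=> mh; apply: (@measurable_iint _ (measurableTypeR R)) => /=.
  have := measurableT_comp mh (@measurable_consT n).
  by congr (measurable_fun _ _); apply/funext => z /=; congr h; apply: val_inj.
rewrite /=; apply: ae_eq_integral => //; [exact: mh|exact: mh|].
have mNc : measurable (@consT n @^-1` N).
  by rewrite -[X in measurable X]setTI; exact: measurable_consT.
(* The measures of the sections integrate to [leb n.+1 N = 0], hence vanish almost everywhere. *)
have : ae_eq lebR setT (fun x => leb n (xsection (@consT n @^-1` N) x)) (cst 0%E).
  apply/ae_eq_integral_abs => //; first exact: measurable_fun_xsection.
  rewrite -[RHS]N0 /= /leb_step /pushforward /product_measure1.
  by apply: eq_integral => x _; rewrite gee0_abs.
apply: filterS => x /(_ I) Nx _; apply: IH Nx _.
- exact: measurable_section.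
- exact: measurable_section.
- exact: measurable_xsection.
- move=> y Ny; apply: fg => Nxy; apply: Ny; rewrite /xsection/= inE/=.
  by rewrite (_ : consT (x, y) = cons_tuple x y)//; apply: val_inj.
Qed.

End Leb.

(** * Reflection invariance, measurability of the tuple operations, product integrands *)

Section LebInvariance.
Variable R : realType.
Local Notation lebR := (@lebesgue_measure R).
Local Notation tup n := (n.-tuple (measurableTypeR R)).

(** Lebesgue measure is determined by half-open intervals, and the reflected interval has the same
    length up to which end is closed. *)
Lemma lebesgue_reflect (a : R) (A : set R) : measurable A ->
  pushforward lebR (fun y : R => a - y : measurableTypeR R) A = lebR A.
Proof.
move=> mA; apply/esym/lebesgue_measure_unique => //=.
  by apply: measurable_funB.
move=> _ _ [[b c]] _ <-; rewrite /pushforward.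
rewrite (_ : _ @^-1` _ = `[a - c, a - b[%classic); last first.
  apply/seteqP; split => y /=; rewrite !in_itv/= => /andP[h1 h2]; apply/andP; split; lra.
rewrite !lebesgue_measure_itv/= !lte_fin ltrD2l ltrN2.
by case: ifPn => // _; rewrite -!EFinD; congr (_%:E); ring.
Qed.

Lemma ge0_integral_reflect (a : R) (f : R -> \bar R) : measurable_fun setT f ->
  (forall x, 0 <= f x)%E -> (\int[lebR]_y f (a - y)%R = \int[lebR]_y f y)%E.
Proof.
move=> mf f0.
have mr : measurable_fun setT (fun y : measurableTypeR R => a - y : measurableTypeR R).
  by apply: measurable_funB.
have := @ge0_integral_pushforward _ _ _ _ _ _ mr lebR setT f measurableT mf (fun x _ => f0 x).
rewrite preimage_setT => <-.
by apply: eq_measure_integral => A mA _; exact: lebesgue_reflect.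
Qed.

Lemma measurable_tsubl n (x : n.-tuple R) : measurable_fun [set: tup n] (tsub x).
Proof.
apply/measurable_fun_tnthP => i; rewrite (_ : _ \o _ = fun y : tup n => tnth x i - tnth y i).
  by apply: measurable_funB => //; exact: measurable_tnth.
by apply/funext => y /=; rewrite tnth_mktuple.
Qed.

Lemma ge0_integral_tsubl n (x : n.-tuple R) (f : n.-tuple R -> \bar R) : measurable_fun setT f ->
  (forall x, 0 <= f x)%E -> (\int[leb R n]_y f (tsub x y) = \int[leb R n]_y f y)%E.
Proof.
move=> mf f0; rewrite ge0_integral_leb//; last first.
  exact: (measurableT_comp mf (measurable_tsubl x)).
rewrite ge0_integral_leb//.
elim: n x f mf f0 => [|n IH] x f mf f0 /=.
  by congr f; exact: tuple0.
have -> : (\int[lebR]_a iint (fun y : n.-tuple R => f (tsub x (cons_tuple a y))) =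
  \int[lebR]_a iint (fun y : n.-tuple R => f (cons_tuple (thead x - a)%R y)))%E.
  apply: eq_integral => a _.
  rewrite -(IH [tuple of behead x] (fun y => f (cons_tuple (thead x - a)%R y)))//; last first.
    exact: measurable_section.
  congr iint; apply/funext => y; congr f.
  apply: eq_from_tnth => i; rewrite tnth_mktuple.
  have [j ->|->] := unliftP ord0 i.
    rewrite !(tnth_nth 0)/= -(tnth_nth 0 (tsub _ _)) tnth_mktuple.
    rewrite !(tnth_nth 0)/=; congr (_ - _).
    by rewrite nth_behead.
  by rewrite !(tnth_nth 0)/= [in RHS]/thead (tnth_nth 0).
apply: (@ge0_integral_reflect (thead x) (fun a => iint (fun y : n.-tuple R => f (cons_tuple a y)))).
  apply: (@measurable_iint R _ (measurableTypeR R)) => /=.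
  have := measurableT_comp mf (@measurable_consT R n).
  by congr (measurable_fun _ _); apply/funext => z /=; congr f; apply: val_inj.
move=> a; rewrite -ge0_integral_leb//; first exact: integral_ge0.
exact: measurable_section.
Qed.

Lemma measurable_tsub n : measurable_fun setT (fun z : tup n * tup n => tsub z.1 z.2 : tup n).
Proof.
apply/measurable_fun_tnthP => i.
rewrite (_ : _ \o _ = fun z : tup n * tup n => tnth z.1 i - tnth z.2 i); last first.
  by apply/funext => y /=; rewrite tnth_mktuple.
apply: measurable_funB.
  exact: (measurableT_comp (measurable_tnth i) measurable_fst).
exact: (measurableT_comp (measurable_tnth i) measurable_snd).
Qed.

Lemma measurable_tdot n : measurable_fun setT (fun z : tup n * tup n => tdot z.1 z.2).
Proof.
apply: measurable_sum => i; apply: measurable_funM.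
  exact: (measurableT_comp (measurable_tnth i) measurable_fst).
exact: (measurableT_comp (measurable_tnth i) measurable_snd).
Qed.

Lemma measurable_enorm n : measurable_fun setT (fun z : tup n => enorm z).
Proof.
have ms : measurable_fun setT (@Num.sqrt R).
  by apply: continuous_measurable_fun; exact: sqrt_continuous.
apply: (measurableT_comp ms).
apply: measurable_sum => i; apply: measurable_funM; exact: measurable_tnth.
Qed.

Lemma measurable_tscale n c : measurable_fun setT (fun z : tup n => tscale c z : tup n).
Proof.
apply/measurable_fun_tnthP => i.
rewrite (_ : _ \o _ = fun z : tup n => c * tnth z i); last first.
  by apply/funext => y /=; rewrite tnth_mktuple.
by apply: measurable_funM => //; exact: measurable_tnth.
Qed.

Lemma measurable_ballN n (r : R) : measurable (ballN r : set (tup n)).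
Proof.
rewrite /ballN -[X in measurable X]setTI (_ : [set x | _] = (@enorm R n) @^-1` `]-oo, r[%classic).
  by apply: measurable_enorm => //; exact: measurable_itv.
by apply/seteqP; split => x /=; rewrite in_itv.
Qed.

Lemma measurable_prod_tnth n (h : R -> R) : measurable_fun setT h ->
  measurable_fun setT (fun x : tup n => \prod_(i < n) h (tnth x i)).
Proof.
move=> mh; apply: measurable_prod => i _.
exact: (measurableT_comp mh (measurable_tnth i)).
Qed.

(** Applied to Gaussians and to indicators of cubes, this reduces their integrals to dimension
    one. *)
Lemma integral_leb_prod n (h : R -> R) : measurable_fun setT h -> (forall x, 0 <= h x) ->
  (\int[leb R n]_x (\prod_(i < n) h (tnth x i))%:E = (\int[lebR]_x (h x)%:E) ^+ n)%E.
Proof.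
move=> mh h0; rewrite ge0_integral_leb; last 2 first.
- by apply/measurable_EFinP; exact: measurable_prod_tnth.
- by move=> x; rewrite lee_fin prodr_ge0.
elim: n => [|n IH]; first by rewrite /= big_ord0.
have i0 : (0 <= (\int[lebR]_x (h x)%:E) ^+ n)%E.
  by rewrite expe_ge0// integral_ge0// => x _; rewrite lee_fin.
rewrite expeS -ge0_integralZr//; last 2 first.
- exact/measurable_EFinP.
- by move=> x _; rewrite lee_fin.
rewrite [LHS]/=; apply: eq_integral => x _; rewrite -IH.
rewrite (_ : (fun y => _) = (fun y : n.-tuple R =>
    (h x)%:E * (\prod_(i < n) h (tnth y i))%:E)%E); last first.
  apply/funext => y; rewrite -EFinM big_ord_recl !(tnth_nth 0)/=.
  by congr (_ * _)%:E; apply: eq_bigr => i _; rewrite !(tnth_nth 0).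
have mp : measurable_fun setT (fun y : tup n => (\prod_(i < n) h (tnth y i))%:E).
  by apply/measurable_EFinP; exact: measurable_prod_tnth.
have p0 (y : n.-tuple R) : (0 <= (\prod_(i < n) h (tnth y i))%:E)%E.
  by rewrite lee_fin prodr_ge0.
rewrite -!ge0_integral_leb//; last 2 first.
- exact: measurable_funeM.
- by move=> y; rewrite mule_ge0// lee_fin.
by rewrite ge0_integralZl_EFin.
Qed.

End LebInvariance.

(** * Fourier transform of Gaussians *)

Section IntegralDerive.
Variable R : realType.
Local Notation lebR := (@lebesgue_measure R).

Lemma cvg_integral_exhaust d (T : measurableType d) (mu : {measure set T -> \bar R})
    (D : set T) (I : nat -> set T) (f : T -> \bar R) :
  measurable D -> (forall n, measurable (I n)) ->
  (forall x, D x -> \forall n \near \oo, I n x) -> mu.-integrable D f ->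
  (\int[mu]_(x in D `&` I n) f x @[n --> \oo] --> \int[mu]_(x in D) f x)%E.
Proof.
move=> mD mI DI fi; have mf := measurable_int _ fi.
rewrite [X in X @ _ --> _](_ : _ = fun n => \int[mu]_(x in D) (f \_ (I n)) x)%E; last first.
  by apply/funext => n; rewrite integral_mkcondr.
have m1 n : measurable_fun D (f \_ (I n)).
  by apply/(measurable_restrict _ (mI n) mD); apply: measurable_funS mf => // x [].
have c1 : {ae mu, forall x, D x -> (f \_ (I n)) x @[n --> \oo] --> f x}.
  apply: aeW => x /DI Ix; apply: cvg_near_cst; move: Ix; apply: filterS => n Ix.
  by rewrite /restrict mem_set.
have b1 : {ae mu, forall x n, D x -> (`|(f \_ (I n)) x| <= (abse \o f) x)%E}.
  apply: aeW => x n Dx /=; rewrite /restrict; case: ifP => // _.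
  by rewrite abse0.
by have [] := dominated_convergence mD m1 mf c1 (integrable_abse fi) b1.
Qed.

(** The fundamental theorem of calculus on compact intervals exhausting [D], with integrability of
    [f] giving the passage to the limit. It serves for the integrations by parts in the Gaussian and
    in the Gamma integral. *)
Lemma integral_derive (D : set R) (a b : nat -> R) (f F : R -> R) (la lb : R) :
  measurable D -> lebR.-integrable D (EFin \o f) ->
  (forall x, D x -> is_derive x 1 F (f x)) ->
  (forall x, D x -> {for x, continuous f}) ->
  (forall n, a n < b n) -> (forall n, `[a n, b n]%classic `<=` D) ->
  (forall x, D x -> \forall n \near \oo, a n <= x <= b n) ->
  F (a n) @[n --> \oo] --> la -> F (b n) @[n --> \oo] --> lb ->
  (\int[lebR]_(x in D) (f x)%:E)%E = (lb - la)%:E.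
Proof.
move=> mD fi dF cf ab abD Dab Fa Fb.
have h := @cvg_integral_exhaust _ _ lebR D (fun n => `[a n, b n]%classic) (EFin \o f) mD
  (fun n => measurable_itv _) _ fi.
have {}h : (\int[lebR]_(x in D `&` `[a n, b n]) (f x)%:E @[n --> \oo] -->
  \int[lebR]_(x in D) (f x)%:E)%E.
  by apply: h => x /Dab; apply: filterS => n; rewrite /= in_itv.
apply: (cvg_unique _ h) => //.
rewrite (_ : (fun n => _) = (fun n => (F (b n) - F (a n))%:E)).
  by apply: cvg_EFin; [exact: nearW|exact: cvgB].
apply/funext => n; rewrite setIidr//.
have Fc x : D x -> {for x, continuous F}.
  move=> /dF xF; apply: differentiable_continuous; exact/derivable1_diffP.
have Da : D (a n) by apply: (abD n) => /=; rewrite in_itv/= lexx ltW.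
have Db : D (b n) by apply: (abD n) => /=; rewrite in_itv/= lexx ltW.
rewrite (continuous_FTC2 (ab n) (F := F))//.
- apply: continuous_in_subspaceT => x; rewrite inE => xab; exact/cf/(abD n).
- split.
  + move=> x xab; have Dx : D x by apply: (abD n); exact: subset_itv_oo_cc xab.
    exact: @ex_derive _ _ _ _ _ _ _ (dF x Dx).
  + exact: cvg_at_right_filter (Fc _ Da).
  + exact: cvg_at_left_filter (Fc _ Db).
- move=> x xab; have Dx : D x by apply: (abD n); exact: subset_itv_oo_cc xab.
  by rewrite derive1E; have dx := dF x Dx; rewrite derive_val.
Qed.

End IntegralDerive.

Section Gauss1.
Variable R : realType.
Local Notation lebR := (@lebesgue_measure R).

Lemma integral_gauss_scale (s : R) : 0 < s ->
  (\int[lebR]_x (expR (- (s * x ^+ 2)))%:E = (Num.sqrt (pi / s))%:E)%E.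
Proof.
(* With this standard deviation the normal density is proportional to the integrand. *)
move=> s0; pose sig := Num.sqrt (2 * s)^-1.
have sig0 : sig != 0 by rewrite gt_eqF// sqrtr_gt0 invr_gt0 mulr_gt0.
have sg2 : sig ^+ 2 = (2 * s)^-1 by rewrite sqr_sqrtr// ltW// invr_gt0 mulr_gt0.
have pk0 := normal_peak_gt0 sig0.
have := integral_normal_pdf 0 sig; rewrite normal_pdfE//.
have fE x : expR (- (s * x ^+ 2)) = normal_fun 0 sig x.
  rewrite /normal_fun subr0 sg2; congr expR; field; lra.
have mg : measurable_fun setT (fun x : R => expR (- (s * x ^+ 2))).
  rewrite (_ : (fun x => _) = normal_fun 0 sig); first exact: measurable_normal_fun.
  by apply/funext => x.
under eq_integral do rewrite -fE EFinM.
rewrite ge0_integralZl_EFin//; last 2 first.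
- exact/measurable_EFinP.
- exact: ltW.
move=> h; have -> : Num.sqrt (pi / s) = (normal_peak sig)^-1.
  rewrite /normal_peak invrK sg2; congr Num.sqrt; field; lra.
rewrite -[LHS]mul1e -[in LHS](mulVf (lt0r_neq0 pk0)) EFinM -muleA h mule1.
by [].
Qed.

Lemma integrable_gauss_scale (s : R) : 0 < s ->
  lebR.-integrable setT (fun x => (expR (- (s * x ^+ 2)))%:E).
Proof.
move=> s0; apply/integrableP; split.
  apply/measurable_EFinP; apply: measurableT_comp => //.
  by apply: measurable_funN; apply: measurable_funM => //; exact: measurable_funX.
under eq_integral do rewrite gee0_abs ?lee_fin ?expR_ge0//.
by rewrite integral_gauss_scale// ltry.
Qed.

Section fourier.
Variables (s th : R).
Hypothesis s0 : 0 < s.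
(** The phase [th] replaces complex exponentials: in the induction on the dimension the other
    coordinates enter as a phase. [f'] is the derivative of [f] in [z], and [G] an integrable
    majorant of it for all [z]. *)
Let f z w := expR (- (s * w ^+ 2)) * cos (z * w + th).
Let f' z w := - (w * expR (- (s * w ^+ 2)) * sin (z * w + th)).
Let G w := (1 + 2 / s) * expR (- (s / 2 * w ^+ 2)).

Let absw_le w : `|w| * expR (- (s * w ^+ 2)) <= G w.
Proof.
(* Half of the exponent is spent on absorbing [|w| <= 1 + w ^+ 2]. *)
rewrite /G (_ : - (s * w ^+ 2) = s / 2 * w ^+ 2 *- 1 - s / 2 * w ^+ 2); last by field.
rewrite expRD mulrA ler_pM2r ?expR_gt0//.
rewrite expRN ler_pdivrMr ?expR_gt0//.
have h0 : 0 <= s / 2 * w ^+ 2 by rewrite mulr_ge0 ?sqr_ge0// divr_ge0// ltW.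
have h1 : s / 2 * w ^+ 2 <= expR (s / 2 * w ^+ 2).
  by have := expR_ge1Dx (s / 2 * w ^+ 2); lra.
have h2 : 1 <= expR (s / 2 * w ^+ 2).
  by have := expR_ge1Dx (s / 2 * w ^+ 2); lra.
have h3 : `|w| <= 1 + w ^+ 2.
  rewrite -(real_normK (num_real w)); have := normr_ge0 w.
  by have := sqr_ge0 (`|w| - 1); rewrite sqrrB; lra.
apply: (le_trans h3); rewrite mulrDl lerD ?mul1r//.
have : 2 / s * (s / 2 * w ^+ 2) <= 2 / s * expR (s / 2 * w ^+ 2).
  by rewrite ler_pM2l// divr_gt0.
have -> : 2 / s * (s / 2 * w ^+ 2) = w ^+ 2 by field; exact: lt0r_neq0.
by [].
Qed.

Let intG : lebR.-integrable setT (EFin \o G).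
Proof.
rewrite (_ : EFin \o G = fun w => ((1 + 2 / s)%:E * (expR (- (s / 2 * w ^+ 2)))%:E)%E).
  by apply: integrableZl => //; apply: integrable_gauss_scale; rewrite divr_gt0.
by apply/funext => w /=; rewrite EFinM.
Qed.

Let is_derive_gauss (w : R) : is_derive w 1 (fun w : R => expR (- (s * w ^+ 2)))
  (- (2 * s * w) * expR (- (s * w ^+ 2))).
Proof.
have hi : is_derive w 1 (fun w : R => - (s * w ^+ 2)) (- (2 * s * w)).
  rewrite (_ : (fun w : R => _) = - (s *: (id ^+ 2 : R -> R))); last by apply/funext.
  by apply: is_derive_eq; rewrite /GRing.scale/=; ring.
by have := @is_derive1_comp R expR (fun w : R => - (s * w ^+ 2)) w _ _ (is_derive_expR _) hi;
  rewrite mulrC.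
Qed.

Let is_derive_lin (z w c : R) : is_derive w 1 (fun w : R => z * w + c) z.
Proof.
rewrite (_ : (fun w : R => _) = (z *: (id : R -> R) + cst c)); last by apply/funext.
by apply: is_derive_eq; rewrite /GRing.scale/= addr0 mulr1.
Qed.

Let is_derive_cosl (z w : R) : is_derive w 1 (fun w : R =>
  cos (z * w + th)) (- z * sin (z * w + th)).
Proof.
have := @is_derive1_comp R cos (fun w : R => z *
  w + th) w _ _ (is_derive_cos _) (is_derive_lin z w th).
by rewrite mulrC mulrN mulNr.
Qed.

Let is_derive_sinl (z w : R) : is_derive w 1 (fun w : R => sin (z * w + th)) (z * cos (z * w + th)).
Proof.
have := @is_derive1_comp R sin (fun w : R => z *
  w + th) w _ _ (is_derive_sin _) (is_derive_lin z w th).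
by rewrite mulrC.
Qed.

Let cont_f z : continuous (f z).
Proof.
move=> w; apply: differentiable_continuous; apply/derivable1_diffP.
rewrite /f; have h := is_derive_gauss w; have h1 := is_derive_cosl z w.
by apply: derivableM; exact: ex_derive.
Qed.

Let cont_f' z : continuous (f' z).
Proof.
move=> w; apply: differentiable_continuous; apply/derivable1_diffP.
rewrite /f'; have h := is_derive_gauss w; have h1 := is_derive_sinl z w.
by apply: derivableN; apply: derivableM; [apply: derivableM|]; exact: ex_derive.
Qed.

Let int_f z : lebR.-integrable setT (EFin \o f z).
Proof.
apply: le_integrable (integrable_gauss_scale s0) => //.
  by apply/measurable_EFinP; apply: continuous_measurable_fun; exact: cont_f.
move=> w _ /=; rewrite lee_fin /f normrM ler_piMr//.
by rewrite ler_norml cos_geN1 cos_le1.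
Qed.

Let int_f' z : lebR.-integrable setT (EFin \o f' z).
Proof.
apply: le_integrable intG => //.
  by apply/measurable_EFinP; apply: continuous_measurable_fun; exact: cont_f'.
move=> w _; have G0 : 0 <= G w.
  by rewrite /G mulr_ge0 ?expR_ge0// addr_ge0// divr_ge0// ltW.
rewrite (_ : (EFin \o G) w = (G w)%:E)// (gee0_abs (x := (G w)%:E))//.
rewrite lee_fin /f' normrN !normrM (ger0_norm (expR_ge0 _)).
apply: le_trans (absw_le w); rewrite ler_piMr// ?mulr_ge0 ?expR_ge0//.
by rewrite ler_norml sin_geN1 sin_le1.
Qed.

Let I z := (\int[lebR]_w f z w)%R.

(** Integration by parts: [H] is an antiderivative in [w] of [f' z + z / (2 * s) * f z] and vanishes
    at both ends of the line. *)
Let int_f'E (z : R) : (\int[lebR]_w f' z w)%R = - (z / (2 * s)) * I z.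
Proof.
pose H w := expR (- (s * w ^+ 2)) * sin (z * w + th) / (2 * s).
pose h w := f' z w + z / (2 * s) * f z w.
have dH (w : R) : is_derive w 1 H (h w).
  have d1 := is_derive_gauss w; have d2 := is_derive_sinl z w.
  rewrite /H (_ : (fun w => _) = (2 * s)^-1 *: ((fun w : R =>
    expR (- (s * w ^+ 2))) * (fun w : R => sin (z * w + th)))); last first.
    by apply/funext => x; rewrite mulrC.
  apply: is_derive_eq; rewrite /h /f /f' /GRing.scale/=.
  by field; exact: lt0r_neq0.
have ih : lebR.-integrable setT (EFin \o h).
  rewrite (_ : EFin \o h = (EFin \o f' z) \+ (fun w => (z / (2 * s))%:E * (EFin \o f z) w))%E.
    by apply: integrableD => //; exact: integrableZl.
  by apply/funext.
have ch : continuous h.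
  move=> w; apply: cvgD; first exact: cont_f'.
  by apply: cvgM; [exact: cvg_cst|exact: cont_f].
have Hle w : `|H w| <= (2 * s)^-1 * expR (- (s * w ^+ 2)).
  rewrite /H mulrC !normrM ger0_norm ?invr_ge0; last by rewrite mulr_ge0// ltW.
  rewrite ler_wpM2l ?invr_ge0//; first by rewrite mulr_ge0// ltW.
  by rewrite (ger0_norm (expR_ge0 _)) ler_piMr ?expR_ge0// ler_norml sin_geN1 sin_le1.
(* The sign [sg] treats both ends at once; [exp(-y) <= 1 / y] bounds [H] by a multiple of the
   harmonic sequence. *)
have cvgH (sg : R) : `|sg| = 1 -> H (sg * n.+1%:R) @[n --> \oo] --> (0:R).
  move=> sg1; apply: norm_cvg0.
  have c0 : (2 * s)^-1 * (s^-1 * n.+1%:R^-1) @[n --> \oo] --> (0 : R).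
    rewrite -[0 in X in _ --> X](mulr0 (2 * s)^-1); apply: cvgMl_tmp.
    rewrite -[0 in X in _ --> X](mulr0 s^-1); apply: cvgMl_tmp.
    exact: cvg_harmonic.
  apply: (@squeeze_cvgr _ _ _ _ (cst 0) _ _ _ _ _ c0); last exact: cvg_cst.
  apply: nearW => n; rewrite normr_ge0/=; apply: (le_trans (Hle _)).
  rewrite ler_pM2l ?invr_gt0 ?mulr_gt0//.
  rewrite exprMn -(real_normK (num_real sg)) sg1 expr1n mul1r expRN -invfM lef_pV2 ?posrE
    ?expR_gt0 ?mulr_gt0//.
  have := expR_ge1Dx (s * n.+1%:R ^+ 2); apply: le_trans.
  have : s * n.+1%:R <= s * n.+1%:R ^+ 2 by rewrite ler_pM2l// expr2 ler_peMr// ler1n.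
  lra.
have := @integral_derive R setT (fun n => - n.+1%:R) (fun n => n.+1%:R) h H 0 0 measurableT ih
  (fun w _ => dH w) (fun w _ => ch w) _ (fun n => @subsetT _ _) _ _ _.
rewrite subr0 => hint.
have : (\int[lebR]_w h w)%R = 0.
  rewrite /Rintegral hint//.
  - by move=> n; rewrite gtrN.
  - move=> x _; near=> n; rewrite -ler_norml.
    apply: (@le_trans _ _ n%:R); last by rewrite ler_nat.
    by near: n; exact: nbhs_infty_ger.
  - by have := cvgH (-1); under eq_fun do rewrite mulN1r; apply; rewrite normrN normr1.
  - by have := cvgH 1; under eq_fun do rewrite mul1r; apply; rewrite normr1.
have i2 : lebR.-integrable setT (EFin \o (fun w => z / (2 * s) * f z w)).
  exact: (integrableZl measurableT (z / (2 * s)) (int_f z)).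
rewrite /h RintegralD//.
rewrite RintegralZl// -/(I z) => /eqP; rewrite addr_eq0 => /eqP ->.
by rewrite mulNr.
Unshelve. all: end_near. Qed.

Let derI (z : R) : is_derive z 1 I (- (z / (2 * s)) * I z).
Proof.
have zI : `]z - 1, z + 1[%classic z by rewrite /= in_itv/=; lra.
have dfx (x w : R) : is_derive x 1 (f ^~ w) (f' x w).
  have h := @is_derive1_comp R cos (fun z : R => z * w + th) x _ w (is_derive_cos _) _.
  have {}h : is_derive x 1 (fun z : R => cos (z * w + th)) (- sin (x * w + th) * w).
    apply: h; rewrite (_ : (fun z : R => _) = fun z : R => w * z + th).
      exact: is_derive_lin.
    by apply/funext => y; rewrite mulrC.
  rewrite /f (_ : (fun z : R => _) = expR (- (s * w ^+ 2)) *: (fun z : R => cos (z * w + th)))//.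
  by apply: is_derive_eq; rewrite /f' /GRing.scale/=; ring.
have d1f x w : partial1of2 f x w = f' x w.
  by rewrite partial1of2E; have h := dfx x w; rewrite derive_val.
have intf x : `]z - 1, z + 1[%classic x -> lebR.-integrable setT (EFin \o f x) by [].
have df x w : `]z - 1, z + 1[%classic x -> setT w -> derivable (f ^~ w) x 1.
  by move=> _ _; have h := dfx x w; exact: ex_derive.
have G0 w : 0 <= G w.
  by rewrite /G mulr_ge0 ?expR_ge0// addr_ge0// divr_ge0// ltW.
have Gb x w : `]z - 1, z + 1[%classic x -> setT w -> `|partial1of2 f x w| <= G w.
  move=> _ _; rewrite d1f; apply: le_trans (absw_le w).
  rewrite /f' normrN !normrM (ger0_norm (expR_ge0 _)) ler_piMr// ?mulr_ge0 ?expR_ge0//.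
  by rewrite ler_norml sin_geN1 sin_le1.
have dI := @derivable_under_integral _ _ _ lebR f setT measurableT z _ _ zI intf df G G0 intG Gb.
have eI := @differentiation_under_integral _ _ _ lebR f setT measurableT z _ _ zI intf df G G0
  intG Gb.
apply: DeriveDef => //; rewrite -derive1E eI -int_f'E.
by apply: eq_Rintegral => w _; rewrite d1f.
Qed.

Let I0 : I 0 = Num.sqrt (pi / s) * cos th.
Proof.
rewrite /I /f; under eq_Rintegral do rewrite mul0r add0r.
by rewrite RintegralZr//= ?/Rintegral ?integral_gauss_scale//; exact: integrable_gauss_scale.
Qed.

(** Differentiation under the integral and integration by parts give [I' = - (z / (2 * s)) * I], so
    [J] is constant, and its value at [0] is the plain Gaussian integral times [cos th]. *)
Lemma gauss_fourier1 z : (\int[lebR]_w (expR (- (s * w ^+ 2)) * cos (z * w + th)))%R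
  = Num.sqrt (pi / s) * expR (- (z ^+ 2 / (4 * s))) * cos th.
Proof.
pose J z := expR (z ^+ 2 / (4 * s)) * I z.
have dJ (x : R) : is_derive x 1 J 0.
  have hi : is_derive x 1 (fun z : R => z ^+ 2 / (4 * s)) (x / (2 * s)).
    rewrite (_ : (fun w : R => _) = ((4 * s)^-1 *: (id ^+ 2 : R -> R))); last first.
      by apply/funext => y; rewrite mulrC.
    by apply: is_derive_eq; rewrite /GRing.scale/=; field; exact: lt0r_neq0.
  have he := @is_derive1_comp R expR (fun z : R => z ^+ 2 / (4 * s)) x _ _ (is_derive_expR _) hi.
  have dx := derI x.
  rewrite /J (_ : (fun z : R => _) = (expR \o (fun z : R => z ^+ 2 / (4 * s))) * I)//.
  by apply: is_derive_eq; rewrite /GRing.scale/=; ring.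
have := @is_derive_0_is_cst _ J z 0 dJ.
rewrite /J expr0n/= mul0r expR0 mul1r I0 => h.
apply: (mulfI (lt0r_neq0 (expR_gt0 (z ^+ 2 / (4 * s))))).
rewrite [LHS]h expRN; field; exact: lt0r_neq0 (expR_gt0 _).
Qed.
End fourier.
End Gauss1.

Section GaussN.
Variable R : realType.
Local Notation lebR := (@lebesgue_measure R).
Local Notation tup n := (n.-tuple (measurableTypeR R)).

Lemma tdot_cons n (a b : R) (x y : n.-tuple R) :
  tdot (cons_tuple a x) (cons_tuple b y) = a * b + tdot x y.
Proof.
rewrite /tdot big_ord_recl !(tnth_nth 0)/=; congr (_ + _).
by apply: eq_bigr => i _; rewrite !(tnth_nth 0).
Qed.

Lemma tdot_ge0 n (x : n.-tuple R) : 0 <= tdot x x.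
Proof. by apply: sumr_ge0 => i _; rewrite -expr2 sqr_ge0. Qed.

Lemma measurable_tdotr n (x : n.-tuple R) : measurable_fun setT (fun w : tup n => tdot x w).
Proof.
apply: measurable_sum => i; apply: measurable_funM => //; exact: measurable_tnth.
Qed.

Lemma measurable_tdot2 n : measurable_fun setT (fun w : tup n => tdot w w).
Proof.
apply: measurable_sum => i; apply: measurable_funM; exact: measurable_tnth.
Qed.

Lemma measurable_gaussN n (s : R) : measurable_fun setT (fun w : tup n => expR (- (s * tdot w w))).
Proof.
apply: (measurableT_comp (@measurable_expR R)); apply: measurable_funN.
by apply: measurable_funM => //; exact: measurable_tdot2.
Qed.

Lemma measurable_cos : measurable_fun setT (@cos R).
Proof. by apply: continuous_measurable_fun; exact: continuous_cos. Qed.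

Lemma measurable_sin : measurable_fun setT (@sin R).
Proof. by apply: continuous_measurable_fun; exact: continuous_sin. Qed.

Lemma integral_gaussN n (s : R) : 0 < s ->
  (\int[leb R n]_w (expR (- (s * tdot w w)))%:E = (Num.sqrt (pi / s) ^+ n)%:E)%E.
Proof.
move=> s0; have mg : measurable_fun setT (fun x : R => expR (- (s * x ^+ 2))).
  by apply/measurable_EFinP; exact: measurable_int (integrable_gauss_scale s0).
have := integral_leb_prod n mg (fun x => expR_ge0 _).
rewrite integral_gauss_scale// -EFin_expe => <-.
apply: eq_integral => w _; congr (_%:E).
rewrite -expR_sum /tdot mulr_sumr -sumrN; congr expR.
Qed.

Lemma integrable_gaussN n (s : R) : 0 < s ->
  (leb R n).-integrable setT (fun w => (expR (- (s * tdot w w)))%:E).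
Proof.
move=> s0; apply/integrableP; split.
  by apply/measurable_EFinP; exact: measurable_gaussN.
under eq_integral do rewrite gee0_abs ?lee_fin ?expR_ge0//.
by rewrite integral_gaussN// ltry.
Qed.

Lemma integrable_gaussN_mul n (s : R) (h : n.-tuple R -> R) : 0 < s ->
  measurable_fun [set: tup n] h -> (forall w, `|h w| <= 1) ->
  (leb R n).-integrable setT (fun w => (expR (- (s * tdot w w)) * h w)%:E).
Proof.
move=> s0 mh h1; apply: le_integrable (integrable_gaussN n s0) => //.
  by apply/measurable_EFinP/measurable_funM => //; exact: measurable_gaussN.
by move=> w _ /=; rewrite lee_fin normrM ler_piMr.
Qed.

Lemma cos_norm_le1 (x : R) : `|cos x| <= 1.
Proof. by rewrite ler_norml cos_geN1 cos_le1. Qed.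

(** Induction on the dimension for all phases: for a fixed head [x] the tail integral is an instance
    of the hypothesis with phase [a * x + th], and what remains is one-dimensional. *)
Lemma gauss_fourier n (s th : R) (z : n.-tuple R) : 0 < s ->
  (\int[leb R n]_w (expR (- (s * tdot w w)) * cos (tdot z w + th)) =
   Num.sqrt (pi / s) ^+ n * expR (- (tdot z z / (4 * s))) * cos th)%R.
Proof.
move=> s0.
have intc m (x : m.-tuple R) t : (leb R m).-integrable setT (fun w =>
  (expR (- (s * tdot w w)) * cos (tdot x w + t))%:E).
  apply: (@integrable_gaussN_mul m s (fun w => cos (tdot x w + t))) => //.
    apply: (measurableT_comp measurable_cos).
    by apply: measurable_funD => //; exact: measurable_tdotr.
  by move=> w; exact: cos_norm_le1.
elim: n z th => [|n IH] z th.
  rewrite /Rintegral integral_leb ?intc//= /tdot !big_ord0.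
  by rewrite !mulr0 mul0r oppr0 expR0 expr0 !mul1r add0r.
rewrite /Rintegral integral_leb_fubini ?intc//.
set a := thead z; set z' : n.-tuple R := [tuple of behead z].
have zE : z = cons_tuple a z' by rewrite [LHS]tuple_eta; apply: val_inj.
have cE x y : consT (x, y) = cons_tuple x y :> n.+1.-tuple R by apply: val_inj.
pose c := Num.sqrt (pi / s) ^+ n * expR (- (tdot z' z' / (4 * s))).
under eq_integral => x _.
  have -> : (\int[leb R n]_y (expR (- (s * tdot (consT (x, y)) (consT (x, y)))) *
      cos (tdot z (consT (x, y)) + th))%:E)%E =
      (c * (expR (- (s * x ^+ 2)) * cos (a * x + th)))%:E.
    transitivity (\int[leb R n]_y ((expR (- (s * x ^+ 2)))%:E *
        (expR (- (s * tdot y y)) * cos (tdot z' y + (a * x + th)))%:E))%E.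
      apply: eq_integral => y _; rewrite cE zE !tdot_cons -EFinM; congr (_%:E).
      rewrite mulrDr opprD expRD -expr2 -mulrA; congr (_ * (_ * cos _)); ring.
    rewrite integralZl//; have := IH z' (a * x + th); rewrite /Rintegral.
    rewrite -/c => h; rewrite -[X in (_ * X)%E]fineK; last exact: integrable_fin_num (intc _ _ _).
    by rewrite h -EFinM; congr (_%:E); rewrite /c; ring.
  over.
rewrite -/(Rintegral _ _ _) RintegralZl//; last first.
  apply: le_integrable (integrable_gauss_scale s0) => //.
    apply/measurable_EFinP/measurable_funM.
      by apply/measurable_EFinP; exact: measurable_int (integrable_gauss_scale s0).
    apply: (measurableT_comp measurable_cos); apply: measurable_funD => //.
  by move=> w _ /=; rewrite lee_fin normrM ler_piMr// cos_norm_le1.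
rewrite gauss_fourier1// /c zE tdot_cons [_ ^+ n.+1]exprS.
rewrite (_ : - ((a * a + tdot z' z') / (4 * s)) = - (tdot z' z' / (4 * s)) + - (a ^+ 2 / (4 * s))).
  by rewrite expRD; ring.
by rewrite expr2; field; exact: lt0r_neq0.
Qed.

End GaussN.

(** * Fourier transforms bounded uniformly in the Gaussian regularization *)

Section GaussBounded.
Variables (R : realType) (n : nat) (x : n.-tuple R) (C : R).
Local Notation tup n := (n.-tuple (measurableTypeR R)).

(* This class contains [1] (for x != 0) and is stable under pointwise limits, subconvex
   combinations and multiplication by resolvents. *)
Definition gauss_bounded (psi : n.-tuple R -> R) : Prop :=
  [/\ measurable_fun [set: tup n] psi, forall w, 0 <= psi w <= 1 &
   forall s, 0 < s -> `| (\int[leb R n]_w (expR (- (s * tdot w w)) * cos (tdot x w) *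
     psi w))%R | <= C].

Lemma measurable_cos_tdot : measurable_fun [set: tup n] (fun w => cos (tdot x w)).
Proof. exact: (measurableT_comp (@measurable_cos R) (measurable_tdotr x)). Qed.

Lemma integrable_gb s (psi : n.-tuple R -> R) : 0 < s -> measurable_fun [set: tup n] psi ->
  (forall w, 0 <= psi w <= 1) ->
  (leb R n).-integrable setT (EFin \o (fun w => expR (- (s * tdot w w)) * cos (tdot x w) * psi w)).
Proof.
move=> s0 mpsi psi01.
have := @integrable_gaussN_mul R n s (fun w => cos (tdot x w) * psi w) s0 _ _.
rewrite (_ : (fun w => _) = EFin \o (fun w => expR (- (s * tdot w w)) * cos (tdot x w) * psi w));
  last first.
  by apply/funext => w /=; rewrite mulrA.
apply; first by apply: measurable_funM => //; exact: measurable_cos_tdot.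
move=> w; rewrite normrM mulr_ile1// ?cos_norm_le1//.
by have /andP[a b] := psi01 w; rewrite ger0_norm.
Qed.

(** For fixed [s] the Gaussian dominates all the integrands, because members of the class have
    values in [[0, 1]]; the bound [C] then passes to the limit. *)
Lemma gauss_bounded_lim (psi_ : nat -> n.-tuple R -> R) (psi : n.-tuple R -> R) :
  (forall k, gauss_bounded (psi_ k)) -> (forall w, psi_ k w @[k --> \oo] --> psi w) ->
  gauss_bounded psi.
Proof.
move=> Hk Hcv.
have m : measurable_fun [set: tup n] psi.
  apply: (@measurable_fun_cvg _ _ _ setT psi_) => //; first by move=> k; case: (Hk k).
have p01 w : 0 <= psi w <= 1.
  apply/andP; split.
    apply: (cvgr_to_ge (Hcv w)); apply: nearW => k; by have [_ /(_ w)/andP[]] := Hk k.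
  apply: (cvgr_to_le (Hcv w)); apply: nearW => k; by have [_ /(_ w)/andP[]] := Hk k.
split => // s s0.
have ik k : (leb R n).-integrable setT (EFin \o (fun w =>
  expR (- (s * tdot w w)) * cos (tdot x w) * psi_ k w)).
  by have [mk k01 _] := Hk k; exact: integrable_gb.
have i := integrable_gb s0 m p01.
have c1 : {ae leb R n, forall w, setT w -> (EFin \o (fun w =>
  expR (- (s * tdot w w)) * cos (tdot x w) * psi_ k w)) w @[k --> \oo] --> (EFin \o (fun w =>
  expR (- (s * tdot w w)) * cos (tdot x w) * psi w)) w}.
  apply: aeW => w _ /=; apply: cvg_EFin; first exact: nearW.
  by apply: cvgMl_tmp; exact: Hcv.
have b1 : {ae leb R n, forall w k, setT w -> (`|(EFin \o (fun w =>
  expR (- (s * tdot w w)) * cos (tdot x w) * psi_ k w)%R) w| <= (expR (- (s * tdot w w)%R))%:E)%E}.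
  apply: aeW => w k _ /=; rewrite lee_fin !normrM (ger0_norm (expR_ge0 _)) -mulrA ler_piMr
    ?expR_ge0//.
  by have [_ /(_ w)/andP[a b] _] := Hk k; rewrite mulr_ile1// ?cos_norm_le1// ger0_norm.
have [_ _ h] := dominated_convergence measurableT (fun k =>
  measurable_int _ (ik k)) (measurable_int _ i) c1 (integrable_gaussN n s0) b1.
have {}h : (\int[leb R n]_w (expR (- (s * tdot w w)) * cos (tdot x w) *
  psi_ k w))%R @[k --> \oo] -->
   (\int[leb R n]_w (expR (- (s * tdot w w)) * cos (tdot x w) * psi w))%R.
  by apply: fine_cvg; rewrite fineK//; exact: integrable_fin_num.
apply: (cvgr_to_le (cvg_norm h)); apply: nearW => k.
by have [_ _] := Hk k; apply.
Qed.

Hypothesis C0 : 0 <= C.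

Lemma gauss_bounded_sum (m : nat) (c : nat -> R) (psi_ : nat -> n.-tuple R -> R) :
  (forall k, (k < m)%N -> gauss_bounded (psi_ k)) -> (forall k, 0 <= c k) ->
  \sum_(k < m) c k <= 1 -> gauss_bounded (fun w => \sum_(k < m) c k * psi_ k w).
Proof.
move=> H c0 c1; split.
- apply: measurable_sum => k; apply: measurable_funM => //.
  by have [] := H k (ltn_ord k).
- move=> w; apply/andP; split.
    by apply: sumr_ge0 => k _; rewrite mulr_ge0//; have [_ /(_ w)/andP[]] := H k (ltn_ord k).
  apply: le_trans c1; apply: ler_sum => k _; rewrite ler_piMr//.
  by have [_ /(_ w)/andP[]] := H k (ltn_ord k).
- move=> s s0.
  have ik (k : 'I_m) : (leb R n).-integrable setT (EFin \o (fun w =>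
    expR (- (s * tdot w w)) * cos (tdot x w) * psi_ k w)).
    by have [mk k01 _] := H k (ltn_ord k); exact: integrable_gb.
  have -> : (\int[leb R n]_w (expR (- (s * tdot w w)) * cos (tdot x w) * (\sum_(k < m) c k *
    psi_ k w)))%R =
     \sum_(k < m) c k * (\int[leb R n]_w (expR (- (s * tdot w w)) * cos (tdot x w) * psi_ k w))%R.
    transitivity (fine (\int[leb R n]_w (\sum_(k < m) (c k)%:E * (expR (- (s * tdot w w)) *
      cos (tdot x w) * psi_ k w)%:E))%E).
      congr fine; apply: eq_integral => w _; rewrite mulr_sumr -sumEFin; apply: eq_bigr => k _.
      by rewrite -EFinM; congr (_%:E); ring.
    have iZ (k : 'I_m) : (leb R n).-integrable setT (fun w =>
      (c k)%:E * (expR (- (s * tdot w w)) * cos (tdot x w) * psi_ k w)%:E)%E.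
      exact: (integrableZl measurableT (c k) (ik k)).
    rewrite integral_sum// -sum_fine; last by move=> k _; exact: integrable_fin_num.
    apply: eq_bigr => k _; rewrite integralZl//; last exact: (ik k).
    by rewrite fineM//; exact: (integrable_fin_num _ (ik k)).
  apply: (le_trans (ler_norm_sum _ _ _)).
  apply: (@le_trans _ _ (\sum_(k < m) c k * C)).
    apply: ler_sum => k _; rewrite normrM ger0_norm// ler_wpM2l//.
    by have [_ _] := H k (ltn_ord k); apply.
  by rewrite -mulr_suml ler_piMl.
Qed.

(** The factor only changes [s] into [s + r], and the bound is uniform in [s]. *)
Lemma gauss_bounded_expR (r : R) psi : 0 <= r -> gauss_bounded psi ->
  gauss_bounded (fun w => expR (- (r * tdot w w)) * psi w).
Proof.
move=> r0 [m p01 H]; split.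
- by apply: measurable_funM => //; exact: measurable_gaussN.
- move=> w; have /andP[a b] := p01 w; rewrite mulr_ge0 ?expR_ge0//=.
  rewrite mulr_ile1 ?expR_ge0// -expR0 ler_expR oppr_le0 mulr_ge0// tdot_ge0//.
- move=> s s0; have := H (s + r) (ltr_wpDr r0 s0); congr (`|_| <= _).
  apply: eq_Rintegral => w _; rewrite mulrDl opprD expRD; ring.
Qed.

(** Geometric series [1 / (2 - E) = sum_k 2^(-k-1) E^k] with [E = exp(- h |w|^2)]: a convex
    combination of factors covered by [gauss_bounded_expR]. *)
Lemma gauss_bounded_resolvent (h : R) psi : 0 <= h -> gauss_bounded psi ->
  gauss_bounded (fun w => (2 - expR (- (h * tdot w w)))^-1 * psi w).
Proof.
move=> h0 Hp.
pose c k : R := 2^-1 ^+ k.+1.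
pose psi_ m w := \sum_(k < m) c k * (expR (- ((k%:R * h) * tdot w w)) * psi w).
apply: (@gauss_bounded_lim psi_).
  move=> m; apply: (@gauss_bounded_sum m c (fun k w => expR (- ((k%:R * h) * tdot w w)) * psi w)).
  - by move=> k _; apply: (@gauss_bounded_expR (k%:R * h) psi) => //; rewrite mulr_ge0.
  - by move=> k; rewrite exprn_ge0// invr_ge0.
  - suff -> : \sum_(k < m) c k = 1 - 2^-1 ^+ m by rewrite gerBl exprn_ge0// invr_ge0.
    elim: m => [|m IH]; first by rewrite big_ord0 expr0 subrr.
    by rewrite big_ord_recr/= IH /c exprS; field.
move=> w; set E := expR (- (h * tdot w w)).
have E01 : 0 <= E <= 1.
  by rewrite expR_ge0/= -expR0 ler_expR oppr_le0 mulr_ge0// tdot_ge0.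
(* Closed form of the partial sums; the error is geometric because [E / 2 <= 1 / 2]. *)
have -> : (fun k => psi_ k w) = fun k => (2 - E)^-1 * psi w - (2 - E)^-1 * psi w * (E / 2) ^+ k.
  apply/funext => m; rewrite /psi_; elim: m => [|m IH].
    by rewrite big_ord0 expr0 mulr1 subrr.
  rewrite big_ord_recr/= IH /c (_ : expR _ = E ^+ m); last first.
    by rewrite /E -expRM_natl; congr expR; ring.
  have E2 : 2 - E != 0 by have /andP[_ E1] := E01; rewrite gt_eqF//; lra.
  by rewrite !exprS exprMn exprVn; field; rewrite E2 expf_neq0.
rewrite -[X in _ --> X]subr0; apply: cvgB; first exact: cvg_cst.
rewrite -(mulr0 ((2 - E)^-1 * psi w)); apply: cvgMl_tmp.
apply: cvg_expr; rewrite ger0_norm; lra.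
Qed.

End GaussBounded.

(** The integral equals [(pi / s)^(n/2) exp(- |x|^2 / (4 s))]. For [|x|^2 >= q] the exponential
    beats the power as [s] tends to [0], which bounds it in terms of [q] and [n] alone. *)
Lemma gauss_bounded1 (R : realType) (n : nat) (x : n.-tuple R) (q : R) : (0 < n)%N ->
  0 < q <= tdot x x -> gauss_bounded x ((Num.sqrt (4 * pi / q) * n%:R) ^+ n) (fun=> 1).
Proof.
move=> n0 /andP[q0 qx]; split => //; first by move=> w; rewrite ler01 lexx.
move=> s s0; have -> : (\int[leb R n]_w (expR (- (s * tdot w w)) * cos (tdot x w) * 1))%R =
   Num.sqrt (pi / s) ^+ n * expR (- (tdot x x / (4 * s))).
  have := gauss_fourier 0 x s0; rewrite cos0 mulr1 => <-; apply: eq_Rintegral => w _.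
  by rewrite mulr1 addr0.
rewrite ger0_norm ?mulr_ge0 ?expR_ge0 ?exprn_ge0 ?sqrtr_ge0//.
(* In this variable the claim is [u^(n/2) exp(-u) <= n^n], which follows from
   [sqrt u <= n exp(u / n)]. *)
set u := q / (4 * s); have u0 : 0 < u by rewrite divr_gt0// mulr_gt0.
have -> : pi / s = 4 * pi / q * u by rewrite /u; field; rewrite !lt0r_neq0.
have pq0 : 0 <= 4 * pi / q :> R by rewrite divr_ge0 ?mulr_ge0 ?pi_ge0// ltW.
rewrite sqrtrM//; set A := Num.sqrt (4 * pi / q); rewrite !exprMn -mulrA.
apply: ler_wpM2l; first by rewrite exprn_ge0 ?sqrtr_ge0.
have nR0 : 0 < n%:R :> R by rewrite ltr0n.
have n1 : 1 <= n%:R :> R by rewrite ler1n.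
have su : Num.sqrt u <= n%:R * expR (u / n%:R).
  have h1 : n%:R + u <= n%:R * expR (u / n%:R).
    have := expR_ge1Dx (u / n%:R); rewrite -(ler_pM2l nR0); apply: le_trans.
    by rewrite mulrDr mulr1 mulrC divfK// gt_eqF.
  apply: le_trans h1; have h2 := sqr_sqrtr (ltW u0).
  have := sqr_ge0 (Num.sqrt u - 1); rewrite sqrrB h2; have := sqrtr_ge0 u; lra.
apply: (@le_trans _ _ ((n%:R * expR (u / n%:R)) ^+ n * expR (- u))).
  apply: ler_pM; rewrite ?exprn_ge0 ?sqrtr_ge0 ?expR_ge0//.
    by apply: lerXn2r; rewrite ?nnegrE ?sqrtr_ge0 ?mulr_ge0 ?expR_ge0.
  by rewrite ler_expR lerN2 ler_wpM2r// invr_ge0 mulr_ge0// ltW.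
rewrite exprMn -expRM_natl mulrCA mulfV ?gt_eqF// mulr1 -mulrA -expRD subrr expR0 mulr1//.
Qed.

(** * The Gruenwald-Letnikov scheme *)

Section Scheme.
Variable R : realType.

(* The coefficient of [z ^ n] in [(1 - z) ^ (- a)]. *)
Definition negbin (n : nat) (a : R) : R := \prod_(i < n) ((a + i%:R) / i.+1%:R).

Lemma negbin0 a : negbin 0 a = 1. Proof. by rewrite /negbin big_ord0. Qed.

Lemma negbinS n a : n.+1%:R * negbin n.+1 a = (a + n%:R) * negbin n a.
Proof.
have n0 : n.+1%:R != 0 :> R by rewrite pnatr_eq0.
rewrite /negbin big_ord_recr/=; set P := \prod_(i < n) _.
by field.
Qed.

Lemma negbin1 n : negbin n 1 = 1.
Proof.
elim: n => [|n IH]; first exact: negbin0.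
have n0 : n.+1%:R != 0 :> R by rewrite pnatr_eq0.
apply: (mulfI n0); rewrite negbinS IH !mulr1 addrC natr1//.
Qed.

Lemma negbin_ge0 n a : 0 <= a -> 0 <= negbin n a.
Proof. by move=> a0; apply: prodr_ge0 => i _; rewrite divr_ge0// addr_ge0. Qed.

(** Coefficients of [(1 - z)^(-a) (1 - z)^(-b)]. Multiplying by [n + 1 = (n + 1 - k) + k] under the
    sum allows [negbinS] on either factor, as in the product rule for derivatives. *)
Lemma negbin_vandermonde n a b :
  \sum_(k < n.+1) negbin (n - k) a * negbin k b = negbin n (a + b).
Proof.
elim: n => [|n IH]; first by rewrite big_ord1 !negbin0 mulr1.
have n0 : n.+1%:R != 0 :> R by rewrite pnatr_eq0.
apply: (mulfI n0); rewrite negbinS -IH.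
transitivity (\sum_(k < n.+2) (n.+1 - k)%:R * negbin (n.+1 - k) a * negbin k b +
  \sum_(k < n.+2) negbin (n.+1 - k) a * (k%:R * negbin k b)).
  rewrite mulr_sumr -big_split/=; apply: eq_bigr => k _.
  have -> : n.+1%:R = (n.+1 - k)%:R + k%:R :> R by rewrite -natrD subnK// -ltnS.
  ring.
rewrite big_ord_recr/= subnn !mul0r addr0.
rewrite [X in _ + X]big_ord_recl/= mul0r mulr0 add0r -big_split/= mulr_sumr.
apply: eq_bigr => k _; have kn : (k <= n)%N by rewrite -ltnS.
rewrite subSn// negbinS /bump/= add1n subSS negbinS.
have -> : n%:R = (n - k)%:R + k%:R :> R by rewrite -natrD subnK.
ring.
Qed.

Variable al : R.
Hypotheses (al0 : 0 < al) (al1 : al < 1).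

(** Only the factor [- al] is negative, since [al < 1]. Hence past values enter the recursion for
    [relax] with nonnegative weights, on which both the comparison below and membership in
    [gauss_bounded] rest. *)
Lemma negbinN_le0 n : negbin n.+1 (- al) <= 0.
Proof.
rewrite /negbin big_ord_recl/= addr0 divr1 mulNr oppr_le0 mulr_ge0//.
  exact: ltW.
apply: prodr_ge0 => i _; rewrite /bump/= add1n divr_ge0//.
by rewrite addrC subr_ge0 (le_trans (ltW al1))// ler1n.
Qed.

(** Course-of-values recursion in structural form: [hist m n] is a table of the values computed so
    far, meaningful at indices below [n]. *)
Fixpoint hist (m : R) (n : nat) : nat -> R :=
  if n is n'.+1 then fun k => if (k < n')%N then hist m n' k else
    (1 + m)^-1 * (negbin n' (1 - al) - \sum_(i < n') negbin (n' - i) (- al) * hist m n' i)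
  else fun=> 0.

(* The coefficients of [((1 - z) ^ al + m)^-1 * (1 - z) ^ (al - 1)]: the solution of the
   Gruenwald-Letnikov discretization of the Caputo relaxation equation. *)
Definition relax (m : R) (n : nat) : R := hist m n.+1 n.

Lemma hist_relax m n k : (k < n)%N -> hist m n k = relax m k.
Proof.
elim: n => // n IH; rewrite ltnS leq_eqVlt => /predU1P[->//|kn].
by rewrite /= kn IH.
Qed.

(** Coefficient of [z^n] in the generating function multiplied by [(1 - z)^al + m], solved for the
    newest value. *)
Lemma relaxE m n : relax m n =
  (1 + m)^-1 * (negbin n (1 - al) - \sum_(k < n) negbin (n - k) (- al) * relax m k).
Proof.
rewrite {1}/relax /= ltnn; congr (_ * (_ - _)); apply: eq_bigr => k _.
by rewrite hist_relax.
Qed.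

(** The weights in [relaxE], including that of the source term, sum to one; this comes from [(1 -
    z)^al (1 - z)^(-1) = (1 - z)^(-(1 - al))]. *)
Lemma negbin_sum n : negbin n (1 - al) - \sum_(k < n) negbin (n - k) (- al) = 1.
Proof.
have := negbin_vandermonde n (- al) 1; rewrite big_ord_recr/= subnn negbin0 negbin1.
under eq_bigr do rewrite negbin1 mulr1.
by rewrite mulr1 (addrC (- al)) => <-; rewrite [X in X - _]addrC addrK.
Qed.

Lemma negbin_vandermonde_al n b : negbin n (b - al) - negbin n b =
  \sum_(k < n) negbin (n - k) (- al) * negbin k b.
Proof.
have := negbin_vandermonde n (- al) b; rewrite big_ord_recr/= subnn negbin0 mul1r.
by rewrite (addrC (- al)) => <-; rewrite addrK.
Qed.

(** Partial sum of the expansion in powers of [m] of the generating function of [relax]: the [k]-th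
    term is [(- m)^k (1 - z)^(-1 - k al)]. *)
Definition relax_trunc (m : R) (K n : nat) : R :=
  \sum_(k < K) (- m) ^+ k * negbin n (1 + k%:R * al).

(** The partial sums satisfy the recursion of [relax] up to a single defect of order [m^K]:
    consecutive terms cancel by Vandermonde. *)
Lemma relax_truncE m K n : (1 + m) * relax_trunc m K n =
  negbin n (1 - al) - \sum_(k < n) negbin (n - k) (- al) * relax_trunc m K k
  - (- m) ^+ K * negbin n (1 + K%:R * al - al).
Proof.
elim: K => [|K IH].
  rewrite /relax_trunc big_ord0 mulr0 expr0 mul1r mul0r addr0.
  rewrite big1; last by move=> k _; rewrite big_ord0 mulr0.
  by rewrite subr0 subrr.
have tS k : relax_trunc m K.+1 k = relax_trunc m K k + (- m) ^+ K * negbin k (1 + K%:R * al).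
  by rewrite /relax_trunc big_ord_recr.
rewrite tS mulrDr IH.
have -> : \sum_(k < n) negbin (n - k) (- al) * relax_trunc m K.+1 k =
  \sum_(k < n) negbin (n - k) (- al) * relax_trunc m K k +
  (- m) ^+ K * (negbin n (1 + K%:R * al - al) - negbin n (1 + K%:R * al)).
  rewrite negbin_vandermonde_al mulr_sumr -big_split/=; apply: eq_bigr => k _.
  by rewrite tS mulrDr mulrCA.
have -> : 1 + K.+1%:R * al - al = 1 + K%:R * al by rewrite -[K.+1%:R]natr1; ring.
rewrite exprS; set A := \sum_(k < n) _; set B := negbin n _; set D := negbin n _.
set E := negbin n _; set X := (- m) ^+ K.
ring.
Qed.

(** Comparison principle: the error obeys a recursion with nonnegative weights and source
    [(- m)^K Q], and the right-hand side is a supersolution of it. *)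
Lemma relax_trunc_le m K n : 0 <= m ->
  `|relax m n - relax_trunc m K n| <= m ^+ K * negbin n (1 + K%:R * al).
Proof.
move=> m0; elim/ltn_ind: n => n IH.
have m1 : 0 < 1 + m by lra.
have Kal : 0 <= K%:R * al by rewrite mulr_ge0// ltW.
set Q := negbin n (1 + K%:R * al - al).
have Q0 : 0 <= Q by apply: negbin_ge0; move: (K%:R * al) Kal => t t0; have := al1; lra.
have E0 : 0 <= m ^+ K * negbin n (1 + K%:R * al).
  by rewrite mulr_ge0 ?exprn_ge0// negbin_ge0// addr_ge0.
have ee : (1 + m) * (relax m n - relax_trunc m K n) =
  \sum_(k < n) (- negbin (n - k) (- al)) * (relax m k - relax_trunc m K k) + (- m) ^+ K * Q.
  rewrite mulrBr relax_truncE relaxE mulrA divff ?gt_eqF// mul1r.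
  have -> : \sum_(k < n) (- negbin (n - k) (- al)) * (relax m k - relax_trunc m K k) =
    \sum_(k < n) negbin (n - k) (- al) * relax_trunc m K k - \sum_(k < n) negbin (n - k) (- al) *
      relax m k.
    by rewrite -sumrB; apply: eq_bigr => k _; rewrite mulNr mulrBr opprB.
  rewrite -/Q; set A := \sum_(k < n) _; set B := \sum_(k < n) _; ring.
have cn (k : 'I_n) : 0 <= - negbin (n - k) (- al).
  rewrite oppr_ge0; have := ltn_ord k; rewrite -subn_gt0.
  by case: (n - k)%N => // d _; exact: negbinN_le0.
(* The claimed bound solves exactly the recursion without the factor [1 + m] on the left, which can
   only help as [m >= 0]. *)
have EE : m ^+ K * negbin n (1 + K%:R * al) =
  \sum_(k < n) (- negbin (n - k) (- al)) * (m ^+ K * negbin k (1 + K%:R * al)) + m ^+ K * Q.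
  have -> : \sum_(k < n) (- negbin (n - k) (- al)) * (m ^+ K * negbin k (1 + K%:R * al)) =
     - (m ^+ K * (Q - negbin n (1 + K%:R * al))).
    rewrite negbin_vandermonde_al mulr_sumr -sumrN; apply: eq_bigr => k _.
    by rewrite mulNr mulrCA.
  set X := negbin n _; ring.
have h : (1 + m) * `|relax m n - relax_trunc m K n| <= m ^+ K * negbin n (1 + K%:R * al).
  rewrite -{1}(gtr0_norm m1) -normrM ee EE.
  apply: (le_trans (ler_normD _ _)).
  rewrite normrM normrX normrN (ger0_norm m0) (ger0_norm Q0) lerD2r.
  apply: (le_trans (ler_norm_sum _ _ _)); apply: ler_sum => k _.
  by rewrite normrM (ger0_norm (cn k)) ler_wpM2l// IH.
apply: le_trans h; rewrite ler_peMl//; lra.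
Qed.

End Scheme.

(** * Asymptotics of the Gamma function *)

Section GammaAsymptotics.
Variable R : realType.
Local Notation lebR := (@lebesgue_measure R).
Local Notation D := (`]0, +oo[%classic : set R).

Let mD : @measurable _ (measurableTypeR R) D. Proof. exact: measurable_itv. Qed.

Definition gint (a x : R) : R := x `^ a * expR (- x).

Lemma gintE (a : R) : Gamma (1 + a) = (\int[lebR]_(x in D) gint a x)%R.
Proof. by rewrite /Gamma; apply: eq_Rintegral => x _; rewrite addrAC subrr add0r. Qed.

Lemma itv0yP (x : R) : D x <-> 0 < x.
Proof. by rewrite /= in_itv/= andbT. Qed.

Lemma gint_ge0 a x : 0 <= gint a x.
Proof. by rewrite mulr_ge0 ?powR_ge0 ?expR_ge0. Qed.

Lemma gint_le a x : 0 <= a -> 0 < x ->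
  gint a x <= (2 * (a + 1)) `^ a * expR (- (2^-1 * x)).
Proof.
(* From [x <= c exp(x / c)] one gets [x^a <= c^a exp(a x / c)], and [a / c <= 1 / 2] leaves half of
   the decay. *)
move=> a0 x0; set c := 2 * (a + 1).
have c0 : 0 < c by rewrite mulr_gt0// ltr_wpDl.
have xc : x <= c * expR (x / c).
  have := expR_ge1Dx (x / c); rewrite -(ler_pM2l c0); apply: le_trans.
  by rewrite mulrDr mulr1 mulrCA divff ?gt_eqF// mulr1 lerDr ltW.
have h : x `^ a <= (c * expR (x / c)) `^ a.
  apply: ge0_ler_powR => //; first by rewrite nnegrE ltW.
  by rewrite nnegrE mulr_ge0 ?expR_ge0 ?(ltW c0).
rewrite /gint; apply: (@le_trans _ _ ((c * expR (x / c)) `^ a * expR (- x))).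
  by rewrite ler_wpM2r ?expR_ge0.
rewrite powRM ?expR_ge0 ?(ltW c0)// -expRM -mulrA -expRD ler_wpM2l ?powR_ge0// ler_expR.
have : x / c * a <= x / 2.
  rewrite -mulrA; apply: ler_wpM2l; first exact: ltW.
  by rewrite mulrC ler_pdivrMr// /c; lra.
rewrite (mulrC _ x); lra.
Qed.

Lemma is_derive_gint (a x : R) : 0 < x ->
  is_derive x 1 (gint a) (a * gint (a - 1) x - gint a x).
Proof.
move=> x0; have h := is_derive1_powR a x0.
have he : is_derive x 1 (fun x : R => expR (- x)) (- expR (- x)).
  have hn : is_derive x 1 (- (id : R -> R)) (- 1) by apply: is_derive_eq.
  by have := @is_derive1_comp R expR (- (id : R -> R)) x _ _ (is_derive_expR _) hn; rewrite mulrN1.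
rewrite (_ : gint a = ((@powR R) ^~ a) * (fun x : R => expR (- x)))//.
apply: is_derive_eq; rewrite /gint /GRing.scale/=.
  rewrite -[X in _ = _ - X]/(x `^ a * expR (- x)); ring.
Qed.

Lemma continuous_gint (a x : R) : 0 < x -> {for x, continuous (gint a)}.
Proof.
move=> x0; apply: differentiable_continuous; apply/derivable1_diffP.
have h := is_derive_gint a x0; exact: ex_derive.
Qed.

Lemma measurable_gint a : measurable_fun D (gint a).
Proof.
apply: measurable_funM; first by apply: measurable_funTS; exact: measurable_powR.
apply: (measurableT_comp (@measurable_expR R)); exact: measurable_funN.
Qed.

Lemma integrable_expR_half : lebR.-integrable D (EFin \o (fun x : R => expR (- (2^-1 * x)))).
Proof.
have i := integrable_exponential_pdf (_ : 0 < 2^-1 :> R).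
have {}i : lebR.-integrable D (EFin \o exponential_pdf (2^-1 : R)).
  by apply: (integrableS measurableT) => //; exact: i.
have := integrableZl mD 2 i.
apply: eq_integrable => // x; rewrite inE => /itv0yP x0 /=.
rewrite exponential_pdfE ?ltW// -EFinM; congr (_%:E).
by rewrite mulrA mulfV// mul1r mulNr.
Qed.

Lemma integrable_gint a : 0 <= a -> lebR.-integrable D (EFin \o gint a).
Proof.
move=> a0; apply: le_integrable (integrableZl mD ((2 * (a + 1)) `^ a) integrable_expR_half) => //.
  by apply/measurable_EFinP; exact: measurable_gint.
move=> x /itv0yP x0 /=; rewrite lee_fin ger0_norm ?gint_ge0//.
by rewrite (le_trans (gint_le a0 x0))// ler_norm.
Qed.

Lemma Gamma1 : Gamma (1 + 0 : R) = 1.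
Proof.
rewrite gintE Rintegral_itv_obnd_cbnd; last exact: integrable_gint.
rewrite Rintegral_mkcond (_ : _ \_ _ = exponential_pdf 1).
  by rewrite /Rintegral integral_exponential_pdf.
apply/funext => x; rewrite /exponential_pdf !patchE /gint; case: ifP => // _.
by rewrite powRr0 !mul1r mulN1r.
Qed.

(** Integration by parts: [f] is the derivative of [gint (a + 1)], which vanishes at both ends. *)
Lemma GammaS (a : R) : 0 <= a -> Gamma (1 + (a + 1)) = (a + 1) * Gamma (1 + a).
Proof.
move=> a0; rewrite !gintE.
have ia := integrable_gint a0; have a1 : 0 <= a + 1 by rewrite addr_ge0.
have ia1 := integrable_gint a1.
pose f x := (a + 1) * gint a x - gint (a + 1) x.
have if1 : lebR.-integrable D (EFin \o (fun x => (a + 1) * gint a x)).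
  exact: (integrableZl mD (a + 1) ia).
have fi : lebR.-integrable D (EFin \o f).
  exact: (integrableB mD if1 ia1).
have df (x : R) : D x -> is_derive x 1 (gint (a + 1)) (f x).
  by move=> /itv0yP x0; have := is_derive_gint (a + 1) x0; rewrite addrK.
have cf x : D x -> {for x, continuous f}.
  move=> /itv0yP x0; apply: cvgB; last exact: continuous_gint.
  by apply: cvgMl_tmp; exact: continuous_gint.
have la : gint (a + 1) n.+1%:R^-1 @[n --> \oo] --> (0 : R).
  apply: (@squeeze_cvgr _ _ _ _ (cst 0) harmonic); [|exact: cvg_cst|exact: cvg_harmonic].
  apply: nearW => n; rewrite gint_ge0/= /gint.
  have n01 : 0 < (n.+1%:R^-1 : R) <= 1 by rewrite invr_gt0 ltr0n/= invf_le1 ?ltr0n// ler1n.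
  have a11 : 1 <= a + 1 by rewrite lerDr.
  have e1 : expR (- n.+1%:R^-1) <= 1 :> R.
    by rewrite -[leRHS](@expR0 R) ler_expR oppr_le0 invr_ge0.
  rewrite -[leRHS]mulr1; apply: ler_pM; rewrite ?powR_ge0 ?expR_ge0//.
  exact: (ge1r_powR n01 a11).
have lb : gint (a + 1) n.+2%:R @[n --> \oo] --> (0 : R).
  pose c : R := (2 * (a + 1 + 1)) `^ (a + 1).
  have hc : 2 * c * n.+1%:R^-1 @[n --> \oo] --> (0 : R).
    by rewrite -(mulr0 (2 * c)); apply: cvgMl_tmp; exact: cvg_harmonic.
  apply: (@squeeze_cvgr _ _ _ _ (cst 0) _ _ _ _ _ hc); last exact: cvg_cst.
  apply: nearW => n; rewrite gint_ge0/=.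
  have n2 : 0 < n.+2%:R :> R by rewrite ltr0n.
  apply: (le_trans (gint_le a1 n2)); rewrite -/c (mulrC 2) -mulrA ler_wpM2l ?powR_ge0//.
  rewrite expRN -[leRHS]invrK lef_pV2 ?posrE ?expR_gt0 ?invr_gt0 ?mulr_gt0 ?invr_gt0//.
  rewrite invfM invrK; have := expR_ge1Dx (2^-1 * n.+2%:R : R); apply: le_trans.
  by rewrite -[n.+2%:R]natr1; lra.
(* The right ends start at [2], so that the interval is nondegenerate already for [n = 0]. *)
have := @integral_derive R D (fun n => n.+1%:R^-1) (fun n => n.+2%:R) f (gint (a + 1)) 0 0
  mD fi df cf _ _ _ la lb.
rewrite subrr => hint.
have h0 : (\int[lebR]_(x in D) f x)%R = 0.
  rewrite /Rintegral hint//.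
  - by move=> n; rewrite (@le_lt_trans _ _ 1) ?invf_le1 ?ltr0n ?ler1n// ltr1n.
  - move=> n x /=; rewrite in_itv/= => /andP[nx _]; apply/itv0yP.
    by rewrite (lt_le_trans _ nx)// invr_gt0 ltr0n.
  - move=> x /itv0yP x0; near=> n; apply/andP; split.
      rewrite -[leRHS]invrK lef_pV2 ?posrE ?invr_gt0 ?ltr0n//.
      apply: (@le_trans _ _ n%:R); last by rewrite ler_nat.
      by near: n; exact: nbhs_infty_ger.
    apply: (@le_trans _ _ n%:R); last by rewrite ler_nat (leq_trans (leqnSn _)).
    by near: n; exact: nbhs_infty_ger.
move: h0; rewrite /f RintegralB// RintegralZl//.
by move/eqP; rewrite subr_eq0 => /eqP.
Unshelve. all: end_near. Qed.

(** Only the part of the integral over [[T, T + 1]] is kept. As [T] is free, this shows growth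
    faster than any exponential in [a]. *)
Lemma Gamma_ge (a T : R) : 0 <= a -> 0 < T -> T `^ a * expR (- (T + 1)) <= Gamma (1 + a).
Proof.
move=> a0 T0; rewrite gintE -lee_fin /Rintegral fineK;
  last exact: integrable_fin_num (integrable_gint a0).
set c := T `^ a * _.
have mT : @measurable _ (measurableTypeR R) `[T, T + 1]%classic by exact: measurable_itv.
have TD : `[T, T + 1]%classic `<=` D.
  by move=> x /=; rewrite in_itv/= => /andP[Tx _]; apply/itv0yP; exact: lt_le_trans Tx.
apply: (@le_trans _ _ (\int[lebR]_(x in `[T, (T + 1)%R]) c%:E)%E).
  rewrite integral_cst//= lebesgue_measure_itv/= lte_fin ltrDl ltr01 -EFinB -EFinM lee_fin.
  by rewrite (addrC T) addrK mulr1.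
have c0 : 0 <= c by rewrite mulr_ge0 ?powR_ge0 ?expR_ge0.
have mg : measurable_fun D (EFin \o gint a) by apply/measurable_EFinP; exact: measurable_gint.
apply: (@le_trans _ _ (\int[lebR]_(x in `[T, (T + 1)%R]) (gint a x)%:E)%E).
  apply: ge0_le_integral => //.
  - exact: measurable_funS TD mg.
  - move=> x /=; rewrite in_itv/= => /andP[Tx xT]; rewrite lee_fin ler_pM ?powR_ge0 ?expR_ge0//.
      by apply: ge0_ler_powR => //; rewrite nnegrE ltW// (lt_le_trans T0).
    by rewrite ler_expR lerN2.
apply: ge0_subset_integral => //.
by move=> x _; rewrite lee_fin gint_ge0.
Qed.

Lemma Gamma_gt0 (a : R) : 0 <= a -> 0 < Gamma (1 + a).
Proof.
move=> a0; apply: lt_le_trans (Gamma_ge a0 ltr01).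
by rewrite mulr_gt0 ?expR_gt0// powR_gt0.
Qed.

Lemma powR_tangent (b x m : R) : 0 < x -> 0 < m ->
  m `^ b * (1 + b * ln (x / m)) <= x `^ b.
Proof.
move=> x0 m0; rewrite ln_div ?posrE//.
rewrite /powR !gt_eqF//.
have -> : b * ln x = b * ln m + b * (ln x - ln m) by ring.
by rewrite [leRHS]expRD ler_wpM2l ?expR_ge0// expR_ge1Dx.
Qed.

Lemma ln_le_subr1 (y : R) : 0 < y -> ln y <= y - 1.
Proof. by move=> y0; have := expR_ge1Dx (ln y); rewrite lnK ?posrE//; lra. Qed.

Lemma gint_add1 (a x : R) : 0 < x -> gint (a + 1) x = x * gint a x.
Proof.
move=> x0; rewrite /gint powRD ?powRr1 ?ltW//; first by ring.
by rewrite (gt_eqF x0) implybT.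
Qed.

(** The pointwise bound [x^a >= m^a (1 + a (1 - m / x))] is integrated against [gint m]. The
    correction terms cancel since [Gamma (1 + m) = m * Gamma (1 + n)]; starting from [n.+1] keeps
    the division by [x] integrable. *)
Lemma Gamma_addr_ge (a : R) n : 0 <= a ->
  n.+1%:R `^ a * Gamma (1 + n.+1%:R) <= Gamma (1 + (n.+1%:R + a)).
Proof.
move=> a0; set m : R := n.+1%:R; have m0 : 0 < m by rewrite ltr0n.
have i0 : lebR.-integrable D (EFin \o gint n%:R) by exact: integrable_gint.
have im : lebR.-integrable D (EFin \o gint m) by exact: integrable_gint (ltW m0).
have ia : lebR.-integrable D (EFin \o gint (m + a)) by apply: integrable_gint;
  rewrite addr_ge0// ltW.
have mE : m = n%:R + 1 by rewrite natr1.
have h : (m `^ a * (1 + a)) * Gamma (1 + m) - (m `^ a * a * m) *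
  Gamma (1 + n%:R) <= Gamma (1 + (m + a)).
  rewrite !gintE -!RintegralZl// -RintegralB//; last 2 first.
    exact: (integrableZl mD (m `^ a * (1 + a)) im).
    exact: (integrableZl mD (m `^ a * a * m) i0).
  apply: le_Rintegral => //.
    apply: (integrableB mD (integrableZl mD (m `^ a * (1 + a)) im) (integrableZl mD (m `^ a * a *
      m) i0)).
  move=> x /itv0yP x0.
  have -> : gint (m + a) x = x `^ a * gint m x.
    rewrite /gint powRD; first by ring.
    by rewrite (gt_eqF x0) implybT.
  rewrite mE gint_add1// -mE.
  have h1 := powR_tangent a x0 m0.
  have h2 : 1 - m / x <= ln (x / m).
    have := ln_le_subr1 (divr_gt0 m0 x0); rewrite -(invf_div x m) lnV ?posrE ?divr_gt0//.
    lra.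
  have h3 : m `^ a * (1 + a * (1 - m / x)) <= x `^ a.
    by apply: le_trans h1; rewrite ler_wpM2l ?powR_ge0// lerD2l ler_wpM2l.
  have -> : m `^ a * (1 + a) * (x * gint n%:R x) - m `^ a * a * m * gint n%:R x =
    m `^ a * (1 + a * (1 - m / x)) * (x * gint n%:R x) by field; rewrite gt_eqF.
  by rewrite ler_wpM2r// mulr_ge0 ?gint_ge0// ltW.
apply: le_trans h.
have -> : Gamma (1 + m) = m * Gamma (1 + n%:R) by rewrite mE GammaS.
by rewrite le_eqVlt; apply/orP; left; apply/eqP; ring.
Qed.

(** The analogous bound for [x^(-a)], integrated against [gint (n + a)]. The base point
    [m = n + a + 1] is the mean of that density, which makes the linear terms cancel. *)
Lemma Gamma_addr_le (a : R) n : 0 <= a ->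
  Gamma (1 + (n%:R + a)) <= (n%:R + a + 1) `^ a * Gamma (1 + n%:R).
Proof.
move=> a0; set m : R := n%:R + a + 1; have m0 : 0 < m by rewrite ltr_wpDl// addr_ge0.
have na0 : 0 <= n%:R + a by rewrite addr_ge0.
have i0 : lebR.-integrable D (EFin \o gint n%:R) by exact: integrable_gint.
have ia : lebR.-integrable D (EFin \o gint (n%:R + a)) by exact: integrable_gint.
have im : lebR.-integrable D (EFin \o gint m) by exact: integrable_gint (ltW m0).
have ma0 : 0 < m `^ a by rewrite powR_gt0.
have h : (1 + a) * Gamma (1 + (n%:R + a)) - (a / m) * Gamma (1 + m) <= m `^ a * Gamma (1 + n%:R).
  rewrite !gintE -!RintegralZl// -RintegralB//; last 2 first.
    exact: (integrableZl mD (1 + a) ia).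
    exact: (integrableZl mD (a / m) im).
  apply: le_Rintegral => //.
    exact: (integrableB mD (integrableZl mD (1 + a) ia) (integrableZl mD (a / m) im)).
    exact: (integrableZl mD (m `^ a) i0).
  move=> x /itv0yP x0.
  rewrite gint_add1//.
  have xa0 : 0 < x `^ a by rewrite powR_gt0.
  have gE : gint (n%:R + a) x = x `^ a * gint n%:R x.
    rewrite /gint powRD; first by ring.
    by rewrite (gt_eqF x0) implybT.
  have h1 := powR_tangent (- a) x0 m0.
  have h2 := ln_le_subr1 (divr_gt0 x0 m0).
  have h3 : m `^ (- a) * (1 + a - a * (x / m)) <= x `^ (- a).
    apply: le_trans h1; rewrite ler_wpM2l ?powR_ge0//.
    have : a * ln (x / m) <= a * (x / m - 1) by rewrite ler_wpM2l.
    lra.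
  have h4 : 1 + a - a * (x / m) <= m `^ a * (x `^ a)^-1.
    by move: h3; rewrite !powRN ler_pdivrMl.
  have -> : (1 + a) * gint (n%:R + a) x - a / m * (x * gint (n%:R + a) x) =
     (1 + a - a * (x / m)) * x `^ a * gint n%:R x by rewrite gE; ring.
  rewrite ler_wpM2r ?gint_ge0//.
  by rewrite -ler_pdivlMr.
apply: le_trans h; rewrite GammaS//.
by rewrite le_eqVlt; apply/orP; left; apply/eqP; rewrite -/m; field; rewrite gt_eqF.
Qed.

Lemma negbin_Gamma (a : R) n : 0 <= a ->
  negbin n (1 + a) * (Gamma (1 + n%:R) * Gamma (1 + a)) = Gamma (1 + (n%:R + a)).
Proof.
move=> a0; elim: n => [|n IH]; first by rewrite negbin0 Gamma1 !mul1r add0r.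
have n0 : n.+1%:R != 0 :> R by rewrite pnatr_eq0.
rewrite -natr1 -(addrAC n%:R) !GammaS//; last by rewrite addr_ge0.
rewrite -IH mulrA mulrA [_ * (n%:R + 1)]mulrC natr1 negbinS; ring.
Qed.

End GammaAsymptotics.

(** * Convergence of the scheme to the Mittag-Leffler function *)

Section RelaxLimit.
Variable R : realType.

(** Interchange of the limits in [n] and [K]. The error bounds give [|S K - S L| <= b K + b L], so
    [S] is Cauchy and [limn S] is a genuine limit; for [MittagLeffler] this yields convergence of
    the series as well. *)
Lemma cvg_trunc (y : nat -> R) (t e : nat -> nat -> R) (S b : nat -> R) :
  (forall K n, `|y n - t K n| <= e K n) ->
  (forall K, t K n @[n --> \oo] --> S K) -> (forall K, e K n @[n --> \oo] --> b K) ->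
  b K @[K --> \oo] --> 0 ->
  y n @[n --> \oo] --> limn S.
Proof.
move=> yt tS eb b0.
have SS K L : `|S K - S L| <= b K + b L.
  have h1 : `|t K n - t L n| @[n --> \oo] --> `|S K - S L| by apply: cvg_norm; apply: cvgB.
  have h2 : e K n + e L n @[n --> \oo] --> b K + b L by apply: cvgD.
  apply: (ler_cvg_to h1 h2); apply: nearW => n.
  rewrite (_ : t K n - t L n = (y n - t L n) - (y n - t K n)); last by ring.
  by rewrite (le_trans (ler_normB _ _))// addrC lerD.
have bsmall (eps : R) : 0 < eps -> \forall K \near \oo, b K < eps.
  by move=> e0; have /cvgrPdist_lt/(_ eps e0) := b0; apply: filterS => K; rewrite sub0r normrN;
    apply: le_lt_trans; exact: ler_norm.
have cS : cvgn S.
  apply/cauchy_cvgP; apply: cauchy_exP => eps e0.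
  have e20 : 0 < eps / 2 by rewrite divr_gt0.
  have [K0 _ HK] := bsmall _ e20.
  exists (S K0); change (\forall L \near \oo, ball (S K0) eps (S L)).
  near=> L; rewrite -ball_normE /=; apply: (le_lt_trans (SS K0 L)).
  have h1 := HK K0 (leqnn _).
  have h2 : b L < eps / 2 by near: L; exact: bsmall.
  have -> : eps = eps / 2 + eps / 2 by field.
  exact: ltrD.
have Sl K : `|S K - limn S| <= b K.
  have h1 : `|S K - S L| @[L --> \oo] --> `|S K - limn S|.
    by apply: cvg_norm; apply: cvgB; [exact: cvg_cst|exact: cS].
  have h2 : b K + b L @[L --> \oo] --> b K + 0 by apply: cvgD; [exact: cvg_cst|exact: b0].
  rewrite -[leRHS]addr0; apply: (ler_cvg_to h1 h2); exact: nearW.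
apply/cvgrPdist_lt => eps e0.
have e40 : 0 < eps / 4 by rewrite divr_gt0.
have [K _ HK] := bsmall _ e40; have bK := HK K (leqnn _).
near=> n.
have h1 : `|S K - t K n| < eps / 4.
  by near: n; have /cvgrPdist_lt/(_ _ e40) := tS K.
have h2 : `|b K - e K n| < eps / 4.
  by near: n; have /cvgrPdist_lt/(_ _ e40) := eb K.
rewrite (_ : limn S - y n = (S K - t K n) - (S K - limn S) - (y n - t K n)); last by ring.
apply: (le_lt_trans (ler_normB _ _)).
have h3 : `|S K - t K n - (S K - limn S)| <= eps / 4 + b K.
  by apply: (le_trans (ler_normB _ _)); rewrite lerD// ltW.
have h4 := yt K n.
have h5 : e K n < b K + eps / 4.
  have : - (b K - e K n) <= `|b K - e K n| by rewrite -normrN ler_norm.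
  lra.
lra.
Unshelve. all: end_near. Qed.

Lemma cvg_sum_ord (f : nat -> nat -> R) (l : nat -> R) K :
  (forall k, f k n @[n --> \oo] --> l k) ->
  (\sum_(k < K) f k n) @[n --> \oo] --> \sum_(k < K) l k.
Proof.
move=> fl; elim: K => [|K IH].
  by under eq_fun do rewrite big_ord0; rewrite big_ord0; exact: cvg_cst.
under eq_fun do rewrite big_ord_recr.
by rewrite big_ord_recr; apply: cvgD.
Qed.

Lemma cvg_expR_harmonic (c : R) : expR (c * n.+1%:R^-1) @[n --> \oo] --> (1 : R).
Proof.
rewrite -[X in _ --> X](@expR0 R); apply: continuous_cvg; first exact: continuous_expR.
by rewrite -[X in _ --> X](mulr0 c); apply: cvgMl_tmp; exact: cvg_harmonic.
Qed.

(** By [negbin_Gamma] this is a Gamma quotient; the two bounds above squeeze it, the excess factor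
    being [(1 + (a + 1) / m)^a <= exp(a (a + 1) / m)]. *)
Lemma cvg_negbin (a : R) : 0 <= a ->
  n.+1%:R `^ (- a) * negbin n.+1 (1 + a) @[n --> \oo] --> (Gamma (1 + a))^-1.
Proof.
move=> a0; have G0 := Gamma_gt0 a0.
have hu : expR (a * (a + 1) * n.+1%:R^-1) * (Gamma (1 + a))^-1 @[n --> \oo] --> (Gamma (1 + a))^-1.
  by rewrite -[X in _ --> X]mul1r; apply: cvgMr_tmp; exact: cvg_expR_harmonic.
apply: (@squeeze_cvgr _ _ _ _ (cst _) _ _ _ _ (cvg_cst _) hu).
apply: nearW => n; set m : R := n.+1%:R.
have m0 : 0 < m by rewrite ltr0n.
have ma0 : 0 < m `^ a by rewrite powR_gt0.
have Gn0 : 0 < Gamma (1 + m) by apply: Gamma_gt0; exact: ltW.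
have E : m `^ (- a) * negbin n.+1 (1 + a) = Gamma (1 + (m + a)) / (m `^ a * Gamma (1 + m)) *
  (Gamma (1 + a))^-1.
  rewrite -negbin_Gamma// powRN -/m; field.
  by rewrite !gt_eqF.
have Gi0 : 0 < (Gamma (1 + a))^-1 by rewrite invr_gt0.
rewrite E; apply/andP; split.
  by rewrite -[leLHS]mul1r ler_pM2r// ler_pdivlMr ?mulr_gt0// mul1r Gamma_addr_ge.
rewrite ler_pM2r// ler_pdivrMr ?mulr_gt0//.
apply: (le_trans (Gamma_addr_le _ a0)); rewrite -/m mulrA ler_pM2r//.
rewrite -ler_pdivrMr//.
have -> : m + a + 1 = m * (1 + (a + 1) / m) by field; rewrite gt_eqF.
have r0 : 0 <= (a + 1) / m by rewrite divr_ge0 ?addr_ge0// ltW.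
rewrite powRM ?(ltW m0)//; last by rewrite addr_ge0.
rewrite mulrC mulrA mulVf ?gt_eqF// mul1r.
have -> : a * (a + 1) * m^-1 = (a + 1) / m * a by ring.
rewrite expRM; apply: ge0_ler_powR; rewrite ?nnegrE ?addr_ge0 ?expR_ge0//.
exact: expR_ge1Dx.
Qed.

Variable al : R.
Hypotheses (al0 : 0 < al) (al1 : al < 1).

(* The step [m] of the scheme in logarithmic form, so that [1 + m = 2 - expR (- lam h)] *)
Definition step (lam : R) (n : nat) : R := 1 - expR (- (n.+1%:R `^ (- al) * lam)).

Lemma step_ge0 lam n : 0 <= lam -> 0 <= step lam n.
Proof.
by move=> l0; rewrite subr_ge0 -[leRHS](@expR0 R) ler_expR oppr_le0 mulr_ge0 ?powR_ge0.
Qed.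

Lemma cvg_powRN (b : R) : 0 < b -> n.+1%:R `^ (- b) @[n --> \oo] --> (0 : R).
Proof.
move=> b0; apply/cvgrPdist_lt => eps e0; near=> n.
have m0 : 0 < n.+1%:R :> R by rewrite ltr0n.
rewrite sub0r normrN ger0_norm ?powR_ge0// powRN -[ltRHS]invrK ltf_pV2 ?posrE ?powR_gt0 ?invr_gt0//.
have -> : eps^-1 = (eps^-1 `^ b^-1) `^ b.
  by rewrite -powRrM mulVf ?gt_eqF// powRr1// invr_ge0 ltW.
apply: gt0_ltr_powR => //; rewrite ?nnegrE ?powR_ge0//.
apply: (@le_lt_trans _ _ n%:R); last by rewrite ltr_nat.
by near: n; exact: nbhs_infty_ger.
Unshelve. all: end_near. Qed.

(** With [t = n^(-al) lam], it is the squeeze [t exp(-t) <= 1 - exp(-t) <= t]: the logarithmic step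
    agrees with the usual one to first order. *)
Lemma cvg_step (lam : R) : 0 <= lam -> n.+1%:R `^ al * step lam n @[n --> \oo] --> lam.
Proof.
move=> l0.
have hl : lam * expR (- (n.+1%:R `^ (- al) * lam)) @[n --> \oo] --> lam.
  rewrite -[X in _ --> X]mulr1; apply: cvgMl_tmp.
  rewrite -[X in _ --> X](@expR0 R); apply: continuous_cvg; first exact: continuous_expR.
  rewrite -[X in _ --> X]oppr0 -[X in _ --> - X](mul0r lam); apply: cvgN; apply: cvgMr_tmp;
    exact: cvg_powRN.
apply: (@squeeze_cvgr _ _ _ _ _ (cst _) _ _ _ hl (cvg_cst _)); apply: nearW => n.
have m0 : 0 < n.+1%:R :> R by rewrite ltr0n.
have p0 : 0 < (n.+1%:R : R) `^ al by rewrite powR_gt0.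
rewrite /step powRN; set t := (n.+1%:R `^ al)^-1 * lam.
have lE : lam = n.+1%:R `^ al * t by rewrite /t mulrA mulfV ?mul1r// gt_eqF.
have h1 := expR_ge1Dx (- t); have h2 := expR_ge1Dx t.
apply/andP; split.
  rewrite {1}lE -mulrA ler_pM2l//.
  have e0 := expR_gt0 (- t).
  have : (1 + t) * expR (- t) <= expR t * expR (- t) by rewrite ler_pM2r.
  rewrite -expRD subrr expR0; lra.
by rewrite [leRHS]lE ler_pM2l//; lra.
Qed.

Lemma cvg_step_negbin (lam : R) k : 0 <= lam ->
  step lam n ^+ k * negbin n.+1 (1 + k%:R * al) @[n --> \oo] --> lam ^+ k / Gamma (1 + k%:R * al).
Proof.
move=> l0.
have ka0 : 0 <= k%:R * al by rewrite mulr_ge0// ltW.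
have -> : (fun n => step lam n ^+ k * negbin n.+1 (1 + k%:R * al)) =
   (fun n => (n.+1%:R `^ al * step lam n) ^+ k * (n.+1%:R `^ (- (k%:R * al)) *
     negbin n.+1 (1 + k%:R * al))).
  apply/funext => n; have p0 : 0 < (n.+1%:R : R) `^ al by rewrite powR_gt0// ltr0n.
  rewrite exprMn powRN (mulrC k%:R) powRrM powR_mulrn ?powR_ge0//; field.
  by rewrite expf_neq0// gt_eqF.
apply: cvgM; last exact: cvg_negbin.
apply: (@cvg_comp _ _ _ (fun n => n.+1%:R `^ al * step lam n) (fun x : R =>
  x ^+ k) _ _ _ (cvg_step l0)).
exact: exprn_continuous.
Qed.

Lemma cvg_ML_term (lam : R) : 0 <= lam -> lam ^+ K / Gamma (1 + K%:R * al) @[K --> \oo] --> 0.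
Proof.
(* With [T^al = c], [Gamma_ge] bounds the Gamma value below by a multiple of [c^K], and [c > lam]
   leaves a geometric sequence. *)
move=> l0; pose c := 2 * lam + 1; pose T := c `^ al^-1.
have c0 : 0 < c by rewrite ltr_wpDl// mulr_ge0.
have T0 : 0 < T by rewrite powR_gt0.
have Ta : T `^ al = c by rewrite /T -powRrM mulVf ?gt_eqF// powRr1// ltW.
have hu : expR (T + 1) * (lam / c) ^+ K @[K --> \oo] --> (0:R).
  rewrite -[X in _ --> X](mulr0 (expR (T + 1))); apply: cvgMl_tmp; apply: cvg_expr.
  rewrite ger0_norm ?divr_ge0 ?(ltW c0)// ltr_pdivrMr// mul1r /c; lra.
apply: (@squeeze_cvgr _ _ _ _ (cst _) _ _ _ _ (cvg_cst _) hu); apply: nearW => K.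
have ka0 : 0 <= K%:R * al by rewrite mulr_ge0// ltW.
have G0 := Gamma_gt0 ka0.
rewrite divr_ge0 ?exprn_ge0 ?(ltW G0)//= ler_pdivrMr//.
have := Gamma_ge ka0 T0; rewrite (mulrC K%:R) powRrM Ta powR_mulrn ?(ltW c0)// => h.
apply: (@le_trans _ _ (expR (T + 1) * (lam / c) ^+ K * (c ^+ K * expR (- (T + 1))))).
  rewrite expRN exprMn exprVn; set E := expR _.
  rewrite le_eqVlt; apply/orP; left; apply/eqP; field.
  by rewrite expf_neq0 ?gt_eqF// expR_gt0.
by rewrite ler_wpM2l// mulr_ge0 ?expR_ge0// exprn_ge0// divr_ge0// ltW.
Qed.

(** [n.+1] steps of length [1 / (n + 1)] reach time [1], where the relaxation equation has the
    solution [E_al(- lam)]. The expansion in powers of the step converges term by term to the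
    series. *)
Lemma cvg_relax (lam : R) : 0 <= lam ->
  relax al (step lam n) n.+1 @[n --> \oo] --> MittagLeffler al (- lam).
Proof.
move=> l0; rewrite /MittagLeffler.
apply: (@cvg_trunc _ (fun K n => relax_trunc al (step lam n) K n.+1)
  (fun K n => step lam n ^+ K * negbin n.+1 (1 + K%:R * al)) _
  (fun K => lam ^+ K / Gamma (1 + K%:R * al))).
- by move=> K n; apply: relax_trunc_le => //; exact: step_ge0.
- move=> K; rewrite /relax_trunc big_mkord.
  apply: (@cvg_sum_ord (fun k n => (- step lam n) ^+ k * negbin n.+1 (1 + k%:R * al))
    (fun k => (- lam) ^+ k / Gamma (1 + k%:R * al))) => k.
  rewrite -[- lam]mulN1r exprMn -mulrA.
  rewrite (_ : (fun n => _) = (fun n => (-1) ^+ k * (step lam n ^+ k * negbin n.+1 (1 + k%:R *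
    al)))).
    by apply: cvgMl_tmp; exact: cvg_step_negbin.
  by apply/funext => n; rewrite mulrA -exprMn mulN1r.
- by move=> K; exact: cvg_step_negbin.
- exact: cvg_ML_term.
Qed.

End RelaxLimit.

(** * Boundedness of the profile off the origin *)

Section ProfileBound.
Variables (R : realType) (n : nat).
Local Notation tup n := (n.-tuple (measurableTypeR R)).
Local Notation lebn := (leb R n).

(** Strong induction along [relaxE], read as a resolvent times a subconvex combination of earlier
    iterates and the constant [1]. *)
Lemma gauss_bounded_relax (x : n.-tuple R) (C al h : R) j : 0 <= C -> 0 < al -> al < 1 -> 0 <= h ->
  gauss_bounded x C (fun=> 1) ->
  gauss_bounded x C (fun w => relax al (1 - expR (- (h * tdot w w))) j).
Proof.
move=> C0 al0 al1 h0 G1; elim/ltn_ind: j => j IH.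
(* Index [j] stands for the source term, with the function [1]; below [j] are the earlier
   iterates. *)
pose c k := if (k < j)%N then - negbin (j - k) (- al) else negbin j (1 - al).
pose psi_ k (w : n.-tuple R) := if (k < j)%N then relax al (1 - expR (- (h * tdot w w))) k else 1.
have -> : (fun w => relax al (1 - expR (- (h * tdot w w))) j) =
  (fun w => (2 - expR (- (h * tdot w w)))^-1 * \sum_(k < j.+1) c k * psi_ k w).
  apply/funext => w; rewrite relaxE; congr (_ * _).
    by congr (_^-1); ring.
  rewrite big_ord_recr/= /c /psi_ ltnn mulr1 addrC; congr (_ + _).
  by rewrite -sumrN; apply: eq_bigr => k _; rewrite ltn_ord mulNr.
apply: gauss_bounded_resolvent => //; apply: gauss_bounded_sum => //.
- by move=> k _; rewrite /psi_; case: (ltnP k j) => kj; [exact: IH|exact: G1].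
- move=> k; rewrite /c; case: ifPn => kj.
    rewrite oppr_ge0; move: kj; rewrite -subn_gt0; case: (j - k)%N => // d _.
    exact: negbinN_le0.
  by apply: negbin_ge0; lra.
- rewrite big_ord_recr/= /c ltnn -[leRHS](negbin_sum al j) addrC lerD2l -sumrN.
  by apply: ler_sum => k _; rewrite ltn_ord.
Qed.

Lemma gauss_bounded_ML (x : n.-tuple R) (C al : R) : 0 <= C -> 0 < al -> al < 1 ->
  gauss_bounded x C (fun=> 1) ->
  gauss_bounded x C (fun w => MittagLeffler al (- tdot w w)).
Proof.
move=> C0 al0 al1 G1.
apply: (@gauss_bounded_lim _ _ _ _ (fun k w => relax al (step al (tdot w w) k) k.+1)).
- by move=> k; apply: gauss_bounded_relax => //; exact: powR_ge0.
- by move=> w; apply: cvg_relax => //; exact: tdot_ge0.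
Qed.

Variables (F : n.-tuple R -> R) (mF : measurable_fun [set: tup n] F) (F0 : forall y, 0 <= F y).
Hypothesis iF : lebn.-integrable setT (EFin \o F).

Lemma measurable_tdot_tsub (x : n.-tuple R) :
  measurable_fun setT (fun z : tup n * tup n => tdot (tsub x z.1) z.2).
Proof.
have m1 : measurable_fun setT (fun z : tup n * tup n => (tsub x z.1, z.2) : tup n * tup n).
  apply/measurable_fun_pairP; split.
    exact: (measurableT_comp (measurable_tsubl x) measurable_fst).
  exact: measurable_snd.
exact: (measurableT_comp (@measurable_tdot R n) m1).
Qed.

Lemma tdot_tsub (x y w : n.-tuple R) : tdot (tsub x y) w = tdot x w - tdot y w.
Proof.
rewrite /tdot -sumrB; apply: eq_bigr => i _.
by rewrite /tsub tnth_mktuple mulrBl.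
Qed.

Lemma integrable_Fcos (g : R -> R) (x w : n.-tuple R) : measurable_fun setT g -> (forall u,
  `|g u| <= 1) ->
  lebn.-integrable setT (fun y => (F y * g (tdot y w))%:E).
Proof.
move=> mg g1; apply: le_integrable iF => //.
  apply/measurable_EFinP/measurable_funM => //.
  apply: (measurableT_comp mg).
  apply: measurable_sum => i; apply: measurable_funM => //; exact: measurable_tnth.
by move=> y _ /=; rewrite lee_fin normrM ler_piMr.
Qed.

Lemma integrable_F_gauss (x : n.-tuple R) s : 0 < s ->
  (lebn \x lebn)%E.-integrable setT
    (fun z : tup n * tup n => (F z.1 * (expR (- (s * tdot z.2 z.2)) *
      cos (tdot (tsub x z.1) z.2)))%:E).
Proof.
move=> s0; have mf : measurable_fun setT (fun z : tup n * tup n =>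
  (F z.1 * (expR (- (s * tdot z.2 z.2)) * cos (tdot (tsub x z.1) z.2)))%:E).
  apply/measurable_EFinP; apply: measurable_funM; first exact: (measurableT_comp mF measurable_fst).
  apply: measurable_funM; first exact: (measurableT_comp (@measurable_gaussN R n s) measurable_snd).
  exact: (measurableT_comp (@measurable_cos R) (measurable_tdot_tsub x)).
apply/integrable12ltyP => //.
apply: (@le_lt_trans _ _ (\int[lebn]_y ((F y)%:E * (Num.sqrt (pi / s) ^+ n)%:E))%E).
  apply: ge0_le_integral => //.
  - by move=> y _; apply: integral_ge0.
  - apply: (@measurable_fun_fubini_tonelli_F _ _ _ _ _ lebn (abse \o
      (fun z : tup n * tup n => (F z.1 * (expR (- (s * tdot z.2 z.2)) *
        cos (tdot (tsub x z.1) z.2)))%:E))) => //=.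
    exact: measurableT_comp.
  - by apply: emeasurable_funM => //; apply/measurable_EFinP.
  - move=> y _; rewrite -(integral_gaussN n s0) -ge0_integralZl_EFin//.
    + apply: ge0_le_integral => //.
      * by apply: measurableT_comp => //; apply: (measurableT_comp mf); exact: pair1_measurable.
      * by apply: measurable_funeM; apply/measurable_EFinP; exact: measurable_gaussN.
      * move=> w _ /=; rewrite lee_fin !normrM (ger0_norm (F0 y)) ler_wpM2l// (ger0_norm
        (expR_ge0 _)).
        by rewrite ler_piMr ?expR_ge0// cos_norm_le1.
    + by apply/measurable_EFinP; exact: measurable_gaussN.
have -> : (\int[lebn]_y ((F y)%:E * (Num.sqrt (pi / s) ^+ n)%:E) = \int[lebn]_y (F y)%:E *
  (Num.sqrt (pi / s) ^+ n)%:E)%E.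
  exact: integralZr.
have /fineK <- := integrable_fin_num measurableT iF.
by rewrite -EFinM ltry.
Qed.

(** Parseval against a Gaussian: it is written as a Fourier integral by [gauss_fourier], the order
    of integration is exchanged, and in the expansion of [cos ((x - y).w)] the sine part integrates
    to zero. *)
Lemma integral_F_gauss (x : n.-tuple R) s (M : n.-tuple R -> R) : 0 < s ->
  (forall w, (\int[lebn]_y (F y * cos (tdot y w)))%R = M w) ->
  (forall w, (\int[lebn]_y (F y * sin (tdot y w)))%R = 0) ->
  (\int[lebn]_y (F y * (Num.sqrt (pi / s) ^+ n * expR (- (tdot (tsub x y) (tsub x y) / (4 *
    s)))))%:E)%E =
  (\int[lebn]_w (expR (- (s * tdot w w)) * cos (tdot x w) * M w)%:E)%E.
Proof.
move=> s0 Fc Fs; have i := integrable_F_gauss x s0.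
transitivity (\int[lebn]_y \int[lebn]_w (F y * (expR (- (s * tdot w w)) *
  cos (tdot (tsub x y) w)))%:E)%E.
  apply: eq_integral => y _.
  have := gauss_fourier 0 (tsub x y) s0; rewrite cos0 mulr1 => <-.
  have ic : lebn.-integrable setT (EFin \o (fun w =>
    expR (- (s * tdot w w)) * cos (tdot (tsub x y) w + 0))).
    apply: (@integrable_gaussN_mul R n s (fun w => cos (tdot (tsub x y) w + 0))) => //.
      apply: (measurableT_comp (@measurable_cos R)).
      by apply: measurable_funD => //; exact: measurable_tdotr.
    by move=> w; exact: cos_norm_le1.
  rewrite EFinM /Rintegral fineK; last exact: (integrable_fin_num _ ic).
  by rewrite -integralZl//; apply: eq_integral => w _; rewrite addr0 EFinM.
rewrite (Fubini i) /=; apply: eq_integral => w _.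
have ic := integrable_Fcos x w (@measurable_cos R) (@cos_norm_le1 R).
have s1 (u : R) : `|sin u| <= 1 by rewrite ler_norml sin_geN1 sin_le1.
have is_ := integrable_Fcos x w (@measurable_sin R) s1.
have -> : (\int[lebn]_y (F y * (expR (- (s * tdot w w)) * cos (tdot (tsub x y) w)))%:E =
  \int[lebn]_y ((expR (- (s * tdot w w)) * cos (tdot x w))%:E * (F y * cos (tdot y w))%:E +
    (expR (- (s * tdot w w)) * sin (tdot x w))%:E * (F y * sin (tdot y w))%:E))%E.
  apply: eq_integral => y _; rewrite -!EFinM -EFinD; congr (_%:E).
  rewrite tdot_tsub cosB; ring.
rewrite integralD//; [|exact: integrableZl|exact: integrableZl].
rewrite !integralZl//.
have -> : (\int[lebn]_y (F y * cos (tdot y w))%:E = (M w)%:E)%E.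
  by rewrite -Fc /Rintegral fineK//; exact: (integrable_fin_num _ ic).
have -> : (\int[lebn]_y (F y * sin (tdot y w))%:E = 0)%E.
  by rewrite -[LHS]fineK ?(integrable_fin_num _ is_)//; congr EFin; exact: Fs.
by rewrite mule0 adde0 EFinM.
Qed.

End ProfileBound.

(** * From Gaussian averages to a pointwise bound *)

Section ProfileLe.
Variables (R : realType) (n : nat).
Local Notation tup n := (n.-tuple (measurableTypeR R)).
Local Notation lebR := (@lebesgue_measure R).
Local Notation lebn := (leb R n).

(** A cube as a product of one-dimensional indicators, in the form that [integral_leb_prod]
    takes. *)
Definition box (r : R) (z : n.-tuple R) : R := \prod_(i < n) \1_(`[- r, r]%classic) (tnth z i).

Lemma boxP (r : R) (z : n.-tuple R) :
  (box r z = 1 /\ (forall i, `|tnth z i| <= r)) \/ box r z = 0.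
Proof.
have [h|] := pselect (forall i, `|tnth z i| <= r).
  left; split => //; rewrite /box big1// => i _.
  by rewrite indicE mem_set//= in_itv/= -ler_norml.
move/existsNP => [i /negP zi]; right; rewrite /box (bigD1 i)//= indicE memNset ?mul0r//=.
by rewrite in_itv/= -ler_norml; apply/negP.
Qed.

Lemma box_ge0 r z : 0 <= box r z.
Proof. by apply: prodr_ge0. Qed.

Lemma measurable_indic_itv (r : R) : measurable_fun setT (\1_(`[- r, r]%classic) : R -> R).
Proof.
apply: (@measurable_indic _ (measurableTypeR R)); exact: measurable_itv.
Qed.

Lemma measurable_box r : measurable_fun [set: tup n] (box r).
Proof. exact: measurable_prod_tnth (measurable_indic_itv r). Qed.

Lemma integral_box r : 0 <= r -> (\int[lebn]_z (box r z)%:E = ((2 * r) ^+ n)%:E)%E.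
Proof.
move=> r0; rewrite (integral_leb_prod n (measurable_indic_itv r))//.
rewrite integral_indic//= setIT lebesgue_measure_itv/= lte_fin.
case: ifPn => [_|].
  by rewrite -EFinB -EFin_expe; congr ((_ ^+ n)%:E); ring.
rewrite -leNgt => h; have -> : r = 0 by lra.
by rewrite mulr0 -EFin_expe.
Qed.

Lemma box_tdot r (z : n.-tuple R) : (forall i, `|tnth z i| <= r) -> tdot z z <= n%:R * r ^+ 2.
Proof.
move=> h; rewrite /tdot; apply: (@le_trans _ _ (\sum_(i < n) r ^+ 2)).
  apply: ler_sum => i _; rewrite -expr2 -(real_normK (num_real (tnth z i))).
  by rewrite lerXn2r ?nnegrE// (le_trans _ (h i)).
by rewrite sumr_const card_ord mulr_natl.
Qed.

Lemma tdot_tsubC (x y : n.-tuple R) : tdot (tsub x y) (tsub x y) = tdot (tsub y x) (tsub y x).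
Proof.
by rewrite /tdot; apply: eq_bigr => i _; rewrite !tnth_mktuple; ring.
Qed.

(** Gaussian averages of [F] around [x] are at most [C]; on a small cube around [x] they see at
    least [F x / 2]. Scaling the Gaussian with the cube makes the side length cancel, so the modulus
    of continuity at [x] leaves no trace in the bound. *)
Lemma profile_le (al : R) (F : n.-tuple R -> R) (x : n.-tuple R) (q : R) :
  0 < al -> al < 1 -> (0 < n)%N ->
  measurable_fun [set: tup n] F -> (forall y, 0 <= F y) ->
  lebn.-integrable setT (EFin \o F) ->
  (forall w, (\int[lebn]_y (F y * cos (tdot y w)))%R = MittagLeffler al (- tdot w w)) ->
  (forall w, (\int[lebn]_y (F y * sin (tdot y w)))%R = 0) ->
  (forall e : R, 0 < e -> exists2 d : R, 0 < d &
       forall y, enorm (tsub y x) < d -> `| F y - F x | < e) ->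
  0 < q <= tdot x x ->
  F x <= 2 * (Num.sqrt (4 * pi / q) * n%:R) ^+ n / ((2 * Num.sqrt pi) ^+ n * expR (- (n%:R / 4))).
Proof.
move=> al0 al1 n0 mF F0 iF Fc Fs cF qx.
set C := (Num.sqrt (4 * pi / q) * n%:R) ^+ n.
have C0 : 0 <= C by rewrite exprn_ge0// mulr_ge0 ?sqrtr_ge0.
have sp0 : 0 < Num.sqrt pi :> R by rewrite sqrtr_gt0 pi_gt0.
have c0 : 0 < (2 * Num.sqrt pi) ^+ n * expR (- (n%:R / 4)) :> R.
  by rewrite mulr_gt0 ?expR_gt0// exprn_gt0// mulr_gt0.
have [Fx0|Fx0] := leP (F x) 0.
  by apply: (le_trans Fx0); rewrite divr_ge0 ?(ltW c0)// mulr_ge0.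
have [d d0 Hd] := cF _ (divr_gt0 Fx0 (ltr0n _ 2)).
have n0R : 0 < n%:R :> R by rewrite ltr0n.
have n1R : 1 <= n%:R :> R by rewrite ler1n.
(* The cube of half-side [r] then lies in the ball of radius [d], as its points have norm at most
   [n r]. *)
have [r r0 rE] : exists2 r : R, 0 < r & n%:R * r = d / 2.
  exists (d / (2 * n%:R)); first by rewrite divr_gt0// mulr_gt0.
  by field; rewrite gt_eqF.
(* On the cube [|z|^2 / (4 s) <= n / 4], and [(pi / s)^(n/2) (2 r)^n = (2 sqrt pi)^n]. *)
pose s := r ^+ 2; have s0 : 0 < s by rewrite exprn_gt0.
pose g (z : n.-tuple R) : R := Num.sqrt (pi / s) ^+ n * expR (- (tdot z z / (4 * s))).
have hup : (\int[lebn]_y (F y * g (tsub x y))%:E <= C%:E)%E.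
  rewrite (integral_F_gauss mF F0 iF x s0 Fc Fs).
  have [mM M01 HM] := gauss_bounded_ML C0 al0 al1 (gauss_bounded1 n0 qx).
  have iM := integrable_gb x s0 mM M01.
  rewrite -[X in (X <= _)%E]fineK; last exact: (integrable_fin_num _ iM).
  by rewrite lee_fin (le_trans (ler_norm _))//; exact: HM.
pose c1 : R := Num.sqrt (pi / s) ^+ n * expR (- (n%:R / 4)).
have c10 : 0 <= c1 by rewrite mulr_ge0 ?expR_ge0// exprn_ge0 ?sqrtr_ge0.
have k0 : 0 <= F x / 2 * c1 by rewrite mulr_ge0// divr_ge0// ltW.
have hlow y : F x / 2 * c1 * box r (tsub x y) <= F y * g (tsub x y).
  have g0 : 0 <= g (tsub x y) by rewrite mulr_ge0 ?expR_ge0// exprn_ge0 ?sqrtr_ge0.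
  have [[-> hb]|->] := boxP r (tsub x y); last by rewrite mulr0 mulr_ge0.
  have ht := box_tdot hb.
  rewrite mulr1; apply: ler_pM => //; first by rewrite divr_ge0// ltW.
    have : `|F y - F x| < F x / 2.
      apply: Hd; rewrite /enorm -tdot_tsubC.
      have nr0 : 0 <= n%:R * r by rewrite mulr_ge0// ltW.
      apply: (@le_lt_trans _ _ (n%:R * r)).
        rewrite -[leRHS]ger0_norm// -sqrtr_sqr; apply: ler_wsqrtr; apply: (le_trans ht).
        by rewrite exprMn; apply: ler_wpM2r; rewrite ?sqr_ge0// [leRHS]expr2 ler_peMl.
      by rewrite rE; lra.
    by rewrite ltr_norml => /andP[h _]; lra.
  rewrite /c1 /g ler_wpM2l ?exprn_ge0 ?sqrtr_ge0// ler_expR lerN2.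
  rewrite ler_pdivrMr ?mulr_gt0// (le_trans ht)// /s.
  by rewrite le_eqVlt; apply/orP; left; apply/eqP; field.
have mg : measurable_fun [set: tup n] g.
  apply: measurable_funM => //; apply: (measurableT_comp (@measurable_expR R)).
  apply: measurable_funN; apply: measurable_funM => //; exact: measurable_tdot2.
have hint : ((F x / 2 * c1 * (2 * r) ^+ n)%:E <= \int[lebn]_y (F y * g (tsub x y))%:E)%E.
  rewrite EFinM -integral_box ?(ltW r0)// -(@ge0_integral_tsubl _ _ x); last 2 first.
  - by apply/measurable_EFinP; exact: measurable_box.
  - by move=> z; rewrite lee_fin box_ge0.
  have mb : measurable_fun [set: tup n] (fun y => box r (tsub x y)).
    exact: (measurableT_comp (measurable_box r) (measurable_tsubl x)).
  rewrite -ge0_integralZl_EFin//; last 2 first.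
  - by move=> z _; rewrite lee_fin box_ge0.
  - by apply/measurable_EFinP.
  apply: ge0_le_integral => //.
  - by move=> z _; rewrite mule_ge0// lee_fin ?box_ge0.
  - by apply: measurable_funeM; apply/measurable_EFinP.
  - apply/measurable_EFinP; apply: measurable_funM => //.
    exact: (measurableT_comp mg (measurable_tsubl x)).
  - by move=> y _; rewrite -EFinM lee_fin.
have := le_trans hint hup; rewrite lee_fin.
have -> : F x / 2 * c1 * (2 * r) ^+ n = F x / 2 * ((2 * Num.sqrt pi) ^+ n * expR (- (n%:R / 4))).
  rewrite /c1 /s sqrtrM ?pi_ge0// -exprVn sqrtr_sqr ger0_norm ?invr_ge0 ?(ltW r0)//.
  rewrite !exprMn exprVn; field; rewrite ?expf_neq0 ?gt_eqF//.
rewrite ler_pdivlMr// => h.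
lra.
Qed.

End ProfileLe.

(** * The Newtonian potential *)

Section NewtonKernel.
Variables (R : realType) (n : nat).
Local Notation tup n := (n.-tuple (measurableTypeR R)).
Local Notation lebn := (leb R n).

Definition newton_kernel (z : n.-tuple R) : R := (enorm z ^+ (n - 2))^-1.
Local Notation nk := newton_kernel.

Lemma enorm_ge0 (z : n.-tuple R) : 0 <= enorm z. Proof. exact: sqrtr_ge0. Qed.

Lemma enorm_sqr (z : n.-tuple R) : enorm z ^+ 2 = tdot z z.
Proof. by rewrite sqr_sqrtr// tdot_ge0. Qed.

Lemma coord_le_enorm (z : n.-tuple R) i : `|tnth z i| <= enorm z.
Proof.
rewrite -sqrtr_sqr; apply: ler_wsqrtr; rewrite /tdot (bigD1 i)//= -expr2 lerDl.
by apply: sumr_ge0 => j _; rewrite -expr2 sqr_ge0.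
Qed.

Lemma nk_ge0 z : 0 <= nk z.
Proof. by rewrite invr_ge0 exprn_ge0// enorm_ge0. Qed.

Lemma measurable_inv : measurable_fun setT (fun x : R => x^-1).
Proof.
have -> : (fun x : R => x^-1) = (fun x => x * (x ^+ 2) `^ (-1)).
  apply/funext => x; have [->|x0] := eqVneq x 0; first by rewrite invr0 mul0r.
  by rewrite powR_inv1 ?sqr_ge0//; field.
apply: measurable_funM => //; apply: (measurableT_comp (@measurable_powR R (-1))).
exact: exprn_measurable.
Qed.

Lemma measurable_nk : measurable_fun [set: tup n] nk.
Proof.
apply: (measurableT_comp measurable_inv); apply: measurable_funX; exact: measurable_enorm.
Qed.

Hypothesis n3 : (3 <= n)%N.

Lemma nk0 (z : n.-tuple R) : enorm z = 0 -> nk z = 0.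
Proof. by move=> z0; rewrite /nk z0 expr0n subn_eq0 leqNgt n3 invr0. Qed.

Lemma box_eq1 r (z : n.-tuple R) : (forall i, `|tnth z i| <= r) -> box r z = 1.
Proof.
move=> h; rewrite /box big1// => i _.
by rewrite indicE mem_set//= in_itv/= -ler_norml.
Qed.

(** Dyadic shells: a point in the cube of half-side [2^(-j)] but not in the next has norm above
    [2^(-j-1)], so the [j]-th term alone dominates the kernel. *)
Lemma nk_box_le (z : n.-tuple R) : ((nk z * box 1 z)%:E <=
  \sum_(0 <= j <oo) (2 ^+ (j.+1 * (n - 2)) * box (2^-1 ^+ j) z)%:E)%E.
Proof.
have s0 j : (0 <= (2 ^+ (j.+1 * (n - 2)) * box (2^-1 ^+ j) z)%:E)%E.
  by rewrite lee_fin mulr_ge0 ?exprn_ge0 ?box_ge0.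
have [[-> hb]|->] := boxP 1 z; last by rewrite mulr0 nneseries_ge0.
rewrite mulr1; have [z0|z0] := eqVneq (enorm z) 0.
  by rewrite nk0// nneseries_ge0.
have zp : 0 < enorm z by rewrite lt0r z0 enorm_ge0.
have exj : exists j, [exists i, 2^-1 ^+ j.+1 < `|tnth z i|].
  have [i zi] : exists i, 0 < `|tnth z i|.
    apply: contrapT => /forallNP h; move/eqP: z0; apply.
    rewrite /enorm /tdot big1 ?sqrtr0// => i _.
    have /negP := h i; rewrite normr_gt0 negbK => /eqP ->; exact: mul0r.
  have h2 : 2^-1 ^+ j @[j --> \oo] --> (0 : R) by apply: cvg_expr; rewrite ger0_norm; lra.
  have /cvgrPdist_lt/(_ _ zi) [j _ hj] := h2.
  exists j; apply/existsP; exists i; have := hj j.+1 (leqnSn _).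
  by rewrite /= sub0r normrN ger0_norm// exprn_ge0.
(* Minimality of [j] puts [z] in the cube of half-side [2^(-j)]; for [j = 0] this is the unit
   cube. *)
case: (ex_minnP exj) => j /existsP[i hi] jmin.
have inbox : forall k, `|tnth z k| <= 2^-1 ^+ j.
  move=> k; case: j jmin {hi} => [|j] jmin; first by rewrite expr0.
  rewrite leNgt; apply/negP => hk.
  have /jmin : [exists i, 2^-1 ^+ j.+1 < `|tnth z i|] by apply/existsP; exists k.
  by rewrite ltnn.
have -> : (\sum_(0 <= j <oo) (2 ^+ (j.+1 * (n - 2)) * box (2^-1 ^+ j) z)%:E)%E =
  (\sum_(0 <= k < j.+1) (2 ^+ (k.+1 * (n - 2)) * box (2^-1 ^+ k) z)%:E +
   \sum_(j.+1 <= k <oo) (2 ^+ (k.+1 * (n - 2)) * box (2^-1 ^+ k) z)%:E)%E.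
  by rewrite (nneseries_split _ j.+1)// add0n.
rewrite big_nat_recr//= -[leLHS]adde0; apply: leeD; last by rewrite nneseries_ge0.
rewrite -[leLHS]add0e; apply: leeD; first by rewrite sume_ge0.
rewrite lee_fin box_eq1// mulr1 /nk exprM -exprVn; apply: lerXn2r;
  rewrite ?nnegrE ?invr_ge0 ?enorm_ge0 ?exprn_ge0//.
rewrite -[leRHS]invrK lef_pV2 ?posrE ?invr_gt0 ?exprn_gt0//.
by rewrite -exprVn (le_trans (ltW hi))// coord_le_enorm.
Qed.

Lemma integral_nk_box : (\int[lebn]_z (nk z * box 1 z)%:E < +oo)%E.
Proof.
apply: (@le_lt_trans _ _ (\int[lebn]_z \sum_(0 <= j <oo) (2 ^+ (j.+1 * (n - 2)) *
  box (2^-1 ^+ j) z)%:E)%E).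
  apply: ge0_le_integral => //.
  - by move=> z _; rewrite lee_fin mulr_ge0 ?nk_ge0 ?box_ge0.
  - by apply/measurable_EFinP; apply: measurable_funM; [exact: measurable_nk|exact: measurable_box].
  - apply: ge0_emeasurable_sum => // [j z _ _|j _].
      by rewrite lee_fin mulr_ge0 ?exprn_ge0 ?box_ge0.
    by apply/measurable_EFinP; apply: measurable_funM => //; exact: measurable_box.
  - by move=> z _; exact: nk_box_le.
rewrite integral_nneseries//; last 2 first.
- by move=> j; apply/measurable_EFinP; apply: measurable_funM => //; exact: measurable_box.
- by move=> j z _; rewrite lee_fin mulr_ge0 ?exprn_ge0 ?box_ge0.
pose c : R := 4 ^+ n.-1.
(* The volume [(2 * 2^(-j))^n] outweighs [2^((j+1)(n-2))] by [4^(-j)], so the series of integrals is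
   geometric. *)
have E j : (\int[lebn]_z (2 ^+ (j.+1 * (n - 2)) * box (2^-1 ^+ j) z)%:E = (c * 4^-1 ^+ j)%:E)%E.
  under eq_integral do rewrite EFinM.
  rewrite ge0_integralZl_EFin//; last 2 first.
  - by move=> z _; rewrite lee_fin box_ge0.
  - by apply/measurable_EFinP; exact: measurable_box.
  rewrite integral_box ?exprn_ge0// -EFinM; congr (_%:E).
  rewrite /c; case: n n3 => [//|[//|m]] _; rewrite subn2/= exprM.
  have a0 : (2 : R) ^+ j != 0 by rewrite expf_neq0.
  have -> : 4^-1 ^+ j = (2 ^+ j)^-1 ^+ 2 :> R.
    rewrite (_ : 4^-1 = 2^-1 ^+ 2 :> R); last by field.
    by rewrite -exprM mulnC exprM exprVn.
  rewrite exprVn [2 ^+ j.+1]exprS -[m.+2]addn2 exprD mulrA -exprMn.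
  rewrite (_ : 2 * 2 ^+ j * (2 * (2 ^+ j)^-1) = 4); last by field.
  by rewrite [4 ^+ m.+1]exprS; field.
apply: (@le_lt_trans _ _ (c * 2)%:E); last exact: ltry.
apply: lime_le; first by apply: is_cvg_nneseries => j _ _; apply: integral_ge0 => z _;
  rewrite lee_fin mulr_ge0 ?exprn_ge0 ?box_ge0.
apply: nearW => m; under eq_bigr do rewrite E.
rewrite sumEFin lee_fin -mulr_sumr ler_wpM2l ?exprn_ge0//.
have -> : \sum_(0 <= i < m) 4^-1 ^+ i = 4 / 3 * (1 - 4^-1 ^+ m) :> R.
  elim: m => [|m IH]; first by rewrite big_geq// expr0 subrr mulr0.
  by rewrite big_nat_recr//= IH exprS; field.
have : 0 <= 4^-1 ^+ m :> R by rewrite exprn_ge0.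
lra.
Qed.

End NewtonKernel.

(** * The local part of the Newtonian potential and its bounds *)

Section NewtonPotential.
Variables (R : realType) (n : nat).
Hypothesis n3 : (3 <= n)%N.
Local Notation tup n := (n.-tuple (measurableTypeR R)).
Local Notation lebn := (leb R n).
Local Notation nk := (@newton_kernel R n).

Definition newton_core (z : n.-tuple R) : R := nk z * box 1 z.
Local Notation kb := newton_core.

Lemma tsubK (x y : n.-tuple R) : tsub x (tsub x y) = y.
Proof. by apply: eq_from_tnth => i; rewrite !tnth_mktuple subKr. Qed.

Lemma enorm_tsubC (x y : n.-tuple R) : enorm (tsub x y) = enorm (tsub y x).
Proof. by rewrite /enorm tdot_tsubC. Qed.

Lemma box_tsubC r (x y : n.-tuple R) : box r (tsub x y) = box r (tsub y x).
Proof.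
have [[-> h]|b0] := boxP r (tsub x y).
  by rewrite box_eq1// => i; rewrite tnth_mktuple distrC; have := h i; rewrite tnth_mktuple.
rewrite b0; have [[h1 h]|->//] := boxP r (tsub y x).
by move: b0; rewrite box_eq1 ?h1// => i; rewrite tnth_mktuple distrC; have := h i;
  rewrite tnth_mktuple.
Qed.

Lemma newton_core_tsubC (x y : n.-tuple R) : kb (tsub x y) = kb (tsub y x).
Proof. by rewrite /kb /nk enorm_tsubC box_tsubC. Qed.

Lemma newton_core_ge0 z : 0 <= kb z.
Proof. by rewrite mulr_ge0 ?nk_ge0 ?box_ge0. Qed.

Lemma measurable_newton_core : measurable_fun [set: tup n] kb.
Proof. by apply: measurable_funM; [exact: measurable_nk|exact: measurable_box]. Qed.

Lemma newton_core_bound : exists2 k1 : R, 0 < k1 &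
  forall x, (\int[lebn]_y (kb (tsub x y))%:E <= k1%:E)%E.
Proof.
have kb0 z : (0 <= (kb z)%:E)%E by rewrite lee_fin newton_core_ge0.
have I0 : (0 <= \int[lebn]_z (kb z)%:E)%E by exact: integral_ge0.
have Ifin : (\int[lebn]_z (kb z)%:E)%E \is a fin_num by rewrite ge0_fin_numE// integral_nk_box.
exists (fine (\int[lebn]_z (kb z)%:E)%E + 1); first by rewrite ltr_wpDl// fine_ge0.
move=> x; rewrite (@ge0_integral_tsubl R n x (fun z => (kb z)%:E))//; last first.
  by apply/measurable_EFinP; exact: measurable_newton_core.
by rewrite EFinD fineK// leeDl.
Qed.

(** Outside the unit cube the norm exceeds [1], so the kernel is at most [1] and contributes no more
    than the mass of [u0]. *)
Lemma nk_le_core (z : n.-tuple R) : nk z <= kb z + 1.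
Proof.
rewrite /kb; have [[-> _]|b0] := boxP 1 z; first by rewrite mulr1 lerDl.
rewrite b0 mulr0 add0r; have [z1|z1] := leP (enorm z) 1.
  by move: b0; rewrite box_eq1 => [|i]; [move/eqP;
    rewrite oner_eq0|exact: le_trans (coord_le_enorm _ _) z1].
by rewrite /nk invf_le1 ?exprn_gt0 ?(lt_trans ltr01)// exprn_ege1// ltW.
Qed.

(** The core has bounded support, so on a ball its potential sees [u0] only in a larger ball; this
    is how local integrability of [u0] suffices. The radius is crude and comes from
    [|y|^2 <= 2 |x|^2 + 2 |x - y|^2]. *)
Lemma near_core (m : R) (x y : n.-tuple R) : 0 < m -> enorm x < m -> kb (tsub x y) != 0 ->
  enorm y < 2 * (m + n%:R).
Proof.
move=> m0 xm; rewrite /kb; have [[-> h]|->] := boxP 1 (tsub x y); last by rewrite mulr0 eqxx.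
move=> _; have := box_tdot h; rewrite expr1n mulr1 => hz.
have h1 : tdot y y <= 2 * tdot x x + 2 * tdot (tsub x y) (tsub x y).
  rewrite /tdot !mulr_sumr -big_split/=; apply: ler_sum => i _.
  rewrite tnth_mktuple; set a := tnth x i; set b := tnth y i.
  by have := sqr_ge0 (2 * a - b); rewrite sqrrB !expr2; lra.
have n0 : 1 <= n%:R :> R by rewrite ler1n (leq_trans _ n3).
have xx : tdot x x < m ^+ 2.
  by rewrite -enorm_sqr ltrXn2r ?nnegrE ?enorm_ge0// ltW.
have : enorm y ^+ 2 < (2 * (m + n%:R)) ^+ 2.
  rewrite enorm_sqr; apply: (le_lt_trans h1).
  apply: (@lt_le_trans _ _ (2 * m ^+ 2 + 2 * n%:R)).
    by apply: ltr_leD; [rewrite ltr_pM2l|rewrite ler_pM2l].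
  have : 0 <= m ^+ 2 by rewrite sqr_ge0.
  have : 0 <= m * n%:R by rewrite mulr_ge0 ?ltW// (lt_le_trans ltr01).
  have : n%:R <= n%:R ^+ 2 :> R by rewrite expr2 ler_peMl// ltW// (lt_le_trans ltr01).
  have -> : (2 * (m + n%:R)) ^+ 2 = 4 * m ^+ 2 + 8 * (m * n%:R) + 4 * n%:R ^+ 2 by ring.
  move: (n%:R : R) n0 => N N1; move: (m * N) (N ^+ 2) (m ^+ 2) => mN N2 m2; lra.
by rewrite ltr_pXn2r// nnegrE ?enorm_ge0// mulr_ge0// addr_ge0// ltW.
Qed.

Variable u0 : n.-tuple R -> R.
Hypotheses (mu0 : measurable_fun [set: tup n] u0) (u00 : forall y, 0 <= u0 y).

Lemma measurable_nku x (k : n.-tuple R -> R) : measurable_fun [set: tup n] k ->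
  measurable_fun [set: tup n] (fun y => k (tsub x y) * u0 y).
Proof.
by move=> mk; apply: measurable_funM => //; exact: (measurableT_comp mk (measurable_tsubl x)).
Qed.

Lemma newton_potE x : newton_pot u0 x = (\int[lebn]_y (nk (tsub x y) * u0 y)%:E)%E.
Proof.
have f0 y : (0 <= (nk (tsub x y) * u0 y)%:E)%E by rewrite lee_fin mulr_ge0 ?nk_ge0.
have mf : measurable_fun [set: tup n] (fun y => (nk (tsub x y) * u0 y)%:E).
  by apply/measurable_EFinP; apply: measurable_nku; exact: measurable_nk.
rewrite -(ge0_integral_tsubl x mf f0) ge0_integral_leb//.
  by congr iint; apply/funext => y; rewrite tsubK mulrC.
exact: (measurableT_comp mf (measurable_tsubl x)).
Qed.

Definition core_pot (v : n.-tuple R -> R) (x : n.-tuple R) : \bar R :=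
  (\int[lebn]_y (kb (tsub x y) * v y)%:E)%E.

Lemma core_pot_ge0 v x : (forall y, 0 <= v y) -> (0 <= core_pot v x)%E.
Proof.
by move=> v0; apply: integral_ge0 => y _; rewrite lee_fin mulr_ge0 ?newton_core_ge0.
Qed.

Lemma newton_pot_le x : (newton_pot u0 x <= core_pot u0 x + \int[lebn]_y (u0 y)%:E)%E.
Proof.
have mk := measurable_nku x measurable_newton_core.
rewrite newton_potE /core_pot -ge0_integralD//; last 4 first.
- by move=> y _; rewrite lee_fin mulr_ge0 ?newton_core_ge0.
- exact/measurable_EFinP.
- by move=> y _; rewrite lee_fin.
- exact/measurable_EFinP.
apply: ge0_le_integral => //.
- by move=> y _; rewrite lee_fin mulr_ge0 ?nk_ge0.
- by apply/measurable_EFinP; apply: measurable_nku; exact: measurable_nk.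
- by apply: emeasurable_funD; exact/measurable_EFinP.
move=> y _; rewrite -EFinD lee_fin -[X in _ + X]mul1r -mulrDl ler_wpM2r//.
exact: nk_le_core.
Qed.

Lemma core_pot_bounded (k1 m M : R) x : 0 < m -> enorm x < m -> 0 <= M ->
  (\int[lebn]_y (kb (tsub x y))%:E <= k1%:E)%E ->
  lebn (ballN (2 * (m + n%:R)) `&` [set y | M < u0 y]) = 0%E ->
  (core_pot u0 x <= (k1 * M)%:E)%E.
Proof.
move=> m0 xm M0 hk1 N0; set N := (X in lebn X) in N0.
have mN : measurable N.
  apply: measurableI; first exact: measurable_ballN.
  rewrite -[X in measurable X]setTI (_ : [set y | _] = u0 @^-1` `]M, +oo[%classic).
    by apply: mu0 => //; exact: measurable_itv.
  by apply/seteqP; split => y /=; rewrite in_itv/= andbT.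
apply: (@le_trans _ _ (\int[lebn]_y ((kb (tsub x y))%:E * M%:E))%E); last first.
  rewrite ge0_integralZr//; last 2 first.
  - by apply/measurable_EFinP; exact: (measurableT_comp measurable_newton_core (measurable_tsubl
    x)).
  - by move=> y _; rewrite lee_fin newton_core_ge0.
  by rewrite EFinM lee_wpmul2r// lee_fin.
apply: ae_ge0_le_integral => //.
- by move=> y _; rewrite lee_fin mulr_ge0 ?newton_core_ge0.
- by apply/measurable_EFinP; apply: measurable_nku; exact: measurable_newton_core.
- by move=> y _; rewrite -EFinM lee_fin mulr_ge0 ?newton_core_ge0.
- apply: emeasurable_funM => //; apply/measurable_EFinP.
  exact: (measurableT_comp measurable_newton_core (measurable_tsubl x)).
exists N; split => // y /= /not_implyP[_]; rewrite -EFinM lee_fin => /negP; rewrite -ltNge => hy.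
have kp : kb (tsub x y) != 0 by apply: contraTneq hy => ->; rewrite !mul0r ltxx.
split; first exact: (near_core m0 xm kp).
move: hy; rewrite ltr_pM2l// lt0r kp newton_core_ge0//.
Qed.

(** Hölder's inequality with respect to the measure [kb (x - y) dy] of mass at most [k1], obtained
    from Young's inequality with a free parameter [a]. *)
Lemma core_pot_pow (k1 r : R) x : 0 < k1 -> 1 < r ->
  (\int[lebn]_y (kb (tsub x y))%:E <= k1%:E)%E ->
  (core_pot u0 x `^ r <= (k1 `^ (r - 1))%:E * core_pot (fun y => (u0 y `^ r)%R) x)%E.
Proof.
move=> k10 r1 hk1; set Psi := core_pot (fun y => u0 y `^ r) x.
have r0 : 0 < r by rewrite (lt_trans ltr01).
have Psi0 : (0 <= Psi)%E by apply: core_pot_ge0 => y; exact: powR_ge0.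
have [->|Psioo] := eqVneq Psi +oo%E.
  by rewrite gt0_muley ?leey// lte_fin powR_gt0.
have Pfin : Psi \is a fin_num by rewrite ge0_fin_numE// ltey.
pose q := r / (r - 1).
have q0 : 0 < q by rewrite divr_gt0// subr_gt0.
have rm0 : r - 1 != 0 by rewrite gt_eqF// subr_gt0.
have pq : r^-1 + q^-1 = 1 by rewrite /q; field; rewrite rm0 gt_eqF.
have young (a : R) y : 0 <= a -> u0 y * a `^ (r - 1) <= u0 y `^ r / r + a `^ r / q.
  move=> a0; have := conjugate_powR (u00 y) (powR_ge0 a (r - 1)) r0 q0 pq.
  by rewrite -powRrM (_ : (r - 1) * q = r)// /q; field.
have mkb := measurableT_comp measurable_newton_core (measurable_tsubl x).
have mur : measurable_fun [set: tup n] (fun y => u0 y `^ r).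
  exact: (measurableT_comp (@measurable_powR R r) mu0).
have key (a : R) : 0 <= a -> (core_pot u0 x * (a `^ (r - 1))%:E <= Psi * (r^-1)%:E + (k1 *
  (a `^ r / q))%:E)%E.
  move=> a0; have aq0 : 0 <= a `^ r / q by rewrite divr_ge0 ?powR_ge0// ltW.
  rewrite /core_pot -ge0_integralZr//; last 3 first.
  - by apply/measurable_EFinP; apply: measurable_nku; exact: measurable_newton_core.
  - by move=> y _; rewrite lee_fin mulr_ge0 ?newton_core_ge0.
  - by rewrite lee_fin powR_ge0.
  apply: (@le_trans _ _ (\int[lebn]_y ((kb (tsub x y) * u0 y `^ r)%:E *
    (r^-1)%:E + (kb (tsub x y))%:E * (a `^ r / q)%:E))%E).
    apply: ge0_le_integral => //.
    - by move=> y _; rewrite -EFinM lee_fin mulr_ge0 ?powR_ge0// mulr_ge0 ?newton_core_ge0.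
    - apply: emeasurable_funM => //; apply/measurable_EFinP; apply: measurable_nku;
      exact: measurable_newton_core.
    - apply: emeasurable_funD; apply: emeasurable_funM => //; apply/measurable_EFinP => //.
      exact: measurable_funM.
    - move=> y _; rewrite -!EFinM -EFinD lee_fin.
      move: (kb (tsub x y)) (newton_core_ge0 (tsub x y)) => K K0.
      by rewrite -!mulrA -mulrDr ler_wpM2l// young.
  rewrite ge0_integralD//; last 4 first.
  - by move=> y _; rewrite -EFinM lee_fin mulr_ge0 ?(mulr_ge0 (newton_core_ge0 _) (powR_ge0 _
    _))// invr_ge0 ltW.
  - by apply: emeasurable_funM => //; apply/measurable_EFinP; exact: measurable_funM.
  - by move=> y _; rewrite -EFinM lee_fin mulr_ge0 ?newton_core_ge0.
  - by apply: emeasurable_funM => //; apply/measurable_EFinP.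
  apply: leeD.
    rewrite ge0_integralZr//; last 3 first.
    - by apply/measurable_EFinP; exact: measurable_funM.
    - by move=> y _; rewrite lee_fin mulr_ge0 ?newton_core_ge0 ?powR_ge0.
    - by rewrite lee_fin invr_ge0 ltW.
  rewrite ge0_integralZr//; last 2 first.
  - exact/measurable_EFinP.
  - by move=> y _; rewrite lee_fin newton_core_ge0.
  by rewrite [leRHS]EFinM lee_wpmul2r// lee_fin.
have P0 := core_pot_ge0 x u00.
have Phfin : core_pot u0 x \is a fin_num.
  rewrite ge0_fin_numE//; have := key 1 ler01; rewrite powR1 mule1 => /le_lt_trans; apply.
  by rewrite -(fineK Pfin) -EFinM -EFinD ltry.
move: key P0; rewrite -(fineK Phfin) -(fineK Pfin); set f := fine (core_pot u0 x);
  set g := fine Psi.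
move=> key; rewrite lee_fin => f0.
(* The optimal parameter, the mean of [u0] when the mass is [k1]: the terms with [a^r] are absorbed
   on the left. *)
pose a := f / k1; have a0 : 0 <= a by rewrite divr_ge0// ltW.
have fE : f = k1 * a by rewrite /a mulrCA divff ?gt_eqF// mulr1.
have := key a a0; rewrite -!EFinM -EFinD lee_fin fE -mulrA mulr_powRB1// => hk.
have hka : k1 * a `^ r <= g.
  have rr : q^-1 = 1 - r^-1 by rewrite -pq; ring.
  move: hk; rewrite rr => hk.
  have : k1 * a `^ r / r <= g / r by move: hk; rewrite mulrBr mulr1 mulrBr (mulrA k1 _ r^-1); lra.
  by rewrite ler_pM2r// invr_gt0.
rewrite poweR_EFin lee_fin powRM ?(ltW k10)//.
rewrite -[in leLHS](mulr_powRB1 (ltW k10) r0) (mulrC k1) -mulrA ler_wpM2l ?powR_ge0//.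
Qed.

(** After Tonelli, [near_core] trades the indicator in [x] for one in [y], and symmetry of the core
    bounds the inner integral by [k1]. *)
Lemma integral_core_pot (k1 m r : R) : 0 < m -> 0 < k1 ->
  (forall x, \int[lebn]_y (kb (tsub x y))%:E <= k1%:E)%E ->
  (\int[lebn]_x ((\1_(ballN m) x)%:E * core_pot (fun y => (u0 y `^ r)%R) x) <=
   k1%:E * \int[lebn]_y ((\1_(ballN (2 * (m + n%:R))) y)%:E * (u0 y `^ r)%:E))%E.
Proof.
move=> m0 k10 hk1.
have mur : measurable_fun [set: tup n] (fun y => u0 y `^ r).
  exact: (measurableT_comp (@measurable_powR R r) mu0).
have mI rho : measurable_fun [set: tup n] (fun x => \1_(ballN rho) x : R).
  by apply: measurable_indic; exact: measurable_ballN.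
have mkb2 : measurable_fun setT (fun z : tup n * tup n => kb (tsub z.1 z.2)).
  exact: (measurableT_comp measurable_newton_core (@measurable_tsub R n)).
pose h (z : tup n * tup n) : \bar R := (\1_(ballN m) z.1 * (kb (tsub z.1 z.2) * u0 z.2 `^ r))%:E.
have h0 z : (0 <= h z)%E by rewrite lee_fin mulr_ge0 ?(mulr_ge0 (newton_core_ge0 _) (powR_ge0 _ _)).
have mh : measurable_fun setT h.
  apply/measurable_EFinP; apply: measurable_funM;
    first exact: (measurableT_comp (mI m) measurable_fst).
  by apply: measurable_funM => //; exact: (measurableT_comp mur measurable_snd).
have -> : (\int[lebn]_x ((\1_(ballN m) x)%:E * core_pot (fun y =>
  (u0 y `^ r)%R) x) = \int[lebn]_x \int[lebn]_y h (x, y))%E.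
  apply: eq_integral => x _; rewrite /core_pot -ge0_integralZl_EFin//.
  - by move=> y _; rewrite lee_fin mulr_ge0 ?newton_core_ge0 ?powR_ge0.
  - apply/measurable_EFinP; apply: measurable_funM => //.
    exact: (measurableT_comp measurable_newton_core (measurable_tsubl x)).
rewrite (fubini_tonelli h mh h0) -ge0_integralZl_EFin//; last 3 first.
- by move=> y _; rewrite -EFinM lee_fin mulr_ge0 ?powR_ge0.
- by apply: emeasurable_funM; exact/measurable_EFinP.
- exact: ltW.
apply: ge0_le_integral => //.
- by move=> y _; apply: integral_ge0.
- exact: (measurable_fun_fubini_tonelli_G h).
- by apply: measurable_funeM; apply: emeasurable_funM; exact/measurable_EFinP.
move=> y _.
set c : R := \1_(ballN (2 * (m + n%:R))) y * u0 y `^ r.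
have c0 : 0 <= c by rewrite mulr_ge0 ?powR_ge0.
rewrite -[X in (_ <= _ * X)%E]/(c%:E) muleC.
apply: (@le_trans _ _ (\int[lebn]_x (c%:E * (kb (tsub y x))%:E))%E).
  apply: ge0_le_integral => //.
  - exact: (measurableT_comp mh (pair2_measurable _)).
  - apply: measurable_funeM; apply/measurable_EFinP.
    exact: (measurableT_comp measurable_newton_core (measurable_tsubl y)).
  - move=> x _; rewrite /h/= -EFinM lee_fin (newton_core_tsubC y x).
    have [->|kp] := eqVneq (kb (tsub x y)) 0; first by rewrite mul0r !mulr0.
    have ii : \1_(ballN m) x <= \1_(ballN (2 * (m + n%:R))) y :> R.
      rewrite !indicE; case: (boolP (x \in _)) => //; rewrite inE => xm.
      by rewrite mem_set//; exact: (near_core m0 xm kp).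
    rewrite /c; move: (kb (tsub x y)) (newton_core_ge0 (tsub x y)) => K K0.
    by rewrite mulrCA -mulrA mulrC -mulrA ler_wpM2r ?mulr_ge0 ?powR_ge0.
rewrite ge0_integralZl_EFin//; last 2 first.
- by move=> x _; rewrite lee_fin newton_core_ge0.
- by apply/measurable_EFinP; exact: (measurableT_comp measurable_newton_core (measurable_tsubl y)).
by rewrite lee_wpmul2l// lee_fin.
Qed.

End NewtonPotential.

(** * Comparison of the solution with the potential *)

Section ExtendedReals.
Variable R : realType.

Lemma cvg0_near_le (f : R -> \bar R) : (forall t, (0 < t)%R -> (0 <= f t)%E) ->
  (forall e : R, 0 < e -> \forall t \near +oo, (f t <= e%:E)%E) ->
  f t @[t --> +oo] --> (0%E : \bar R).
Proof.
move=> f0 fe; apply/fine_cvgP; split.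
  near=> t; have t0 : 0 < t by near: t; exact: nbhs_pinfty_gt.
  rewrite ge0_fin_numE ?f0//; apply: (@le_lt_trans _ _ 1%:E); last exact: ltry.
  by near: t; exact: fe.
apply/cvgrPdist_le => e e0; near=> t.
have t0 : 0 < t by near: t; exact: nbhs_pinfty_gt.
have fte : (f t <= e%:E)%E by near: t; exact: fe.
have tf : f t \is a fin_num by rewrite ge0_fin_numE ?f0// (le_lt_trans fte)// ltry.
rewrite sub0r normrN /= ger0_norm ?fine_ge0 ?f0//.
by rewrite -lee_fin fineK.
Unshelve. all: end_near. Qed.

Lemma le_poweR (r : R) (x y : \bar R) : 0 <= r -> (0 <= x)%E -> (x <= y)%E -> (x `^ r <= y `^ r)%E.
Proof.
move=> r0 x0 xy; apply: (gt0_ler_poweR r0) => //; rewrite in_itv/= leey andbT//.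
exact: le_trans xy.
Qed.

Lemma poweR_add_le (r : R) (a b : \bar R) : 0 < r -> (0 <= a)%E -> (0 <= b)%E ->
  ((a + b) `^ r <= (2 `^ r)%:E * (a `^ r + b `^ r))%E.
Proof.
move=> r0.
have h (x y : \bar R) : (0 <= x)%E -> (x <= y)%E -> ((x + y) `^ r <= (2 `^ r)%:E *
  (x `^ r + y `^ r))%E.
  move=> x0 xy; have y0 := le_trans x0 xy.
  apply: (@le_trans _ _ ((2%:E * y) `^ r)%E).
    apply: le_poweR; rewrite ?(ltW r0) ?adde_ge0//.
    by rewrite mule_natl mule2n leeD2r.
  by rewrite poweRM// poweR_EFin lee_wpmul2l ?lee_fin ?powR_ge0// leeDr// poweR_ge0.
move=> a0 b0; have [ab|/ltW ba] := leP a b; first exact: h.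
by rewrite addeC [(a `^ r + _)%E]addeC; exact: h.
Qed.

End ExtendedReals.

Section Compare.
Variable R : realType.

(** Covers points where the potential is infinite: since [e > 0], the right-hand side is then [+oo].
    Otherwise all functions involved are integrable and the pointwise bound can be integrated. *)
Lemma le_integral_diff d (T : measurableType d) (mu : {measure set T -> \bar R})
    (A B u : T -> R) (k e c : R) : 0 < e -> 0 <= c ->
  measurable_fun setT A -> measurable_fun setT B -> measurable_fun setT u ->
  (forall y, 0 <= A y) -> (forall y, 0 <= B y) -> (forall y, 0 <= u y) ->
  (\int[mu]_y (u y)%:E < +oo)%E ->
  (forall y, `|A y - k * B y| <= e * B y + c * u y) ->
  (`| \int[mu]_y (A y)%:E - k%:E * \int[mu]_y (B y)%:E | <=
   e%:E * \int[mu]_y (B y)%:E + c%:E * \int[mu]_y (u y)%:E)%E.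
Proof.
move=> e0 c0 mA mB mu' A0 B0 u0 iu AB.
have IB0 : (0 <= \int[mu]_y (B y)%:E)%E by apply: integral_ge0 => y _; rewrite lee_fin.
have Iu0 : (0 <= \int[mu]_y (u y)%:E)%E by apply: integral_ge0 => y _; rewrite lee_fin.
have [Boo|Boo] := eqVneq (\int[mu]_y (B y)%:E)%E +oo%E.
  by rewrite [X in (e%:E * X)%E]Boo gt0_muley ?lte_fin// addye ?leey// gt_eqF// (lt_le_trans
    (ltNyr 0))// mule_ge0// lee_fin.
have ge0_int (f : T -> R) : measurable_fun setT f -> (forall y,
  0 <= f y) -> (\int[mu]_y (f y)%:E < +oo)%E ->
    mu.-integrable setT (EFin \o f).
  move=> mf f0 fi; apply/integrableP; split; first exact/measurable_EFinP.
  by under eq_integral do rewrite gee0_abs ?lee_fin//.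
have iB : mu.-integrable setT (EFin \o B) by apply: ge0_int => //; rewrite ltey.
have iU : mu.-integrable setT (EFin \o u) by exact: ge0_int.
have ieB : mu.-integrable setT (EFin \o (fun y => e * B y)) := integrableZl measurableT e iB.
have icU : mu.-integrable setT (EFin \o (fun y => c * u y)) := integrableZl measurableT c iU.
have ikB : mu.-integrable setT (EFin \o (fun y => k * B y)) := integrableZl measurableT k iB.
have iA : mu.-integrable setT (EFin \o A).
  have iS : mu.-integrable setT (EFin \o (fun y => (`|k| * B y + e * B y) + c * u y)).
    apply: (integrableD measurableT (integrableD measurableT (integrableZl measurableT `|k| iB)
      ieB) icU).
  apply: le_integrable iS => //; first exact/measurable_EFinP.
  move=> y _ /=; rewrite lee_fin ger0_norm//; apply: le_trans (ler_norm _).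
  have := AB y; have := ler_norm (A y - k * B y).
  have : k * B y <= `|k| * B y by rewrite ler_wpM2r// ler_norm.
  lra.
rewrite -(integralZl measurableT iB) -(integralZl measurableT iB) -(integralZl measurableT iU).
have -> : (\int[mu]_x (A x)%:E - \int[mu]_x (k%:E * (B x)%:E) = \int[mu]_x ((A x)%:E - (k *
  B x)%:E))%E.
  by rewrite integralB_EFin.
have iD : mu.-integrable setT (fun y => (A y)%:E - (k *
  B y)%:E)%E := integrableB measurableT iA ikB.
apply: (le_trans (le_abse_integral _ measurableT (measurable_int _ iD))).
have <- : (\int[mu]_x ((e * B x)%:E + (c * u x)%:E) = \int[mu]_x (e%:E *
  (B x)%:E) + \int[mu]_x (c%:E * (u x)%:E))%E.
  by rewrite integralD_EFin.
apply: ge0_le_integral => //.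
- exact: measurableT_comp (measurable_int _ iD).
- by have := measurable_int _ (integrableD measurableT ieB icU).
- by move=> y _; rewrite -EFinB -EFinD lee_fin; exact: AB.
Qed.

End Compare.

(** * The origin as a null set, and the pointwise kernel estimate *)

Section Origin.
Variables (R : realType) (n : nat).
Local Notation tup n := (n.-tuple (measurableTypeR R)).
Local Notation lebn := (leb R n).

Lemma measurable_enorm0 : measurable ([set z | enorm z = 0] : set (tup n)).
Proof.
rewrite -[X in measurable X]setTI (_ : [set z | _] = (@enorm R n) @^-1` [set 0])//.
by apply: measurable_enorm => //; exact: measurable_set1.
Qed.

Lemma leb_enorm0 : (0 < n)%N -> lebn [set z | enorm z = 0] = 0%E.
Proof.
move=> n0; apply/eqP; rewrite eq_le measure_ge0 andbT.
have mi : measurable_fun setT (\1_([set 0]) : R -> R).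
  by apply: (@measurable_indic _ (measurableTypeR R)); exact: measurable_set1.
have := @integral_leb_prod R n _ mi (fun x => _).
rewrite integral_indic//= setIT lebesgue_measure_set1.
rewrite -EFin_expe expr0n gtn_eqF//= => h; rewrite -[leRHS]h//.
rewrite -[X in lebn X]setIT -(integral_indic lebn measurableT measurable_enorm0).
apply: ge0_le_integral => //.
- by apply/measurable_EFinP; apply: measurable_indic; exact: measurable_enorm0.
- by apply/measurable_EFinP; exact: measurable_prod_tnth mi.
move=> z _; rewrite lee_fin indicE; have [|_] := boolP (z \in _); last by rewrite prodr_ge0.
rewrite inE => /= z0; rewrite big1// => i _; rewrite indicE mem_set//=.
by apply/eqP; rewrite -normr_le0 -z0 coord_le_enorm.
Qed.

Lemma leb_tsub0 (x : n.-tuple R) : (0 < n)%N -> lebn [set y | enorm (tsub x y) = 0] = 0%E.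
Proof.
move=> n0; rewrite -(leb_enorm0 n0).
have m1 : measurable ([set y | enorm (tsub x y) = 0] : set (tup n)).
  rewrite -[X in measurable X]setTI.
  exact: (measurable_tsubl x measurableT measurable_enorm0).
rewrite -[X in lebn X]setIT -(integral_indic lebn measurableT m1).
rewrite -[X in _ = lebn X]setIT -(integral_indic lebn measurableT measurable_enorm0).
have mi : measurable_fun [set: tup n] (fun z => (\1_([set z | enorm z = 0] : set (tup n)) z :
  R)%:E).
  by apply/measurable_EFinP; apply: measurable_indic; exact: measurable_enorm0.
have i0 (z : n.-tuple R) : (0 <= (\1_([set z | enorm z = 0] : set (tup n)) z : R)%:E)%E by
  rewrite lee_fin.
exact: (ge0_integral_tsubl x mi i0).
Qed.

Lemma enorm_tscale (c : R) (z : n.-tuple R) : 0 <= c -> enorm (tscale c z) = c * enorm z.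
Proof.
move=> c0; rewrite /enorm (_ : tdot _ _ = c ^+ 2 * tdot z z).
  by rewrite sqrtrM ?sqr_ge0// sqrtr_sqr ger0_norm.
rewrite /tdot mulr_sumr; apply: eq_bigr => i _; rewrite tnth_mktuple; ring.
Qed.

(** The split into near and far, for [tau = t^(- alpha / 2)]. [F] is asked to vanish at the origin
    because [newton_kernel] does by convention. *)
Lemma newton_kernel_diff (F : n.-tuple R -> R) (k d e M tau : R) (z : n.-tuple R) : (3 <= n)%N ->
  0 < d -> 0 < e -> 0 <= M -> 0 < tau ->
  (forall z, enorm z = 0 -> F z = 0) -> (forall z, 0 <= F z) ->
  (forall z, 0 < enorm z < d -> `|F z * enorm z ^+ (n - 2) - k| < e) ->
  (forall z, d <= enorm z -> F z <= M) ->
  `|tau ^+ (n - 2) * F (tscale tau z) - k * newton_kernel z| <=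
  e * newton_kernel z + tau ^+ (n - 2) * (M + `|k| / d ^+ (n - 2)).
Proof.
move=> n3 d0 e0 M0 tau0 Fz F0 Fd FM; set m := (n - 2)%N.
have tm0 : 0 < tau ^+ m by rewrite exprn_gt0.
have dm0 : 0 < d ^+ m by rewrite exprn_gt0.
have c0 : 0 <= tau ^+ m * (M + `|k| / d ^+ m).
  by rewrite mulr_ge0 ?(ltW tm0)// addr_ge0// divr_ge0 ?(ltW dm0).
have nE : enorm (tscale tau z) = tau * enorm z by rewrite enorm_tscale// ltW.
have [z0|z0] := eqVneq (enorm z) 0.
  by rewrite Fz ?nE ?z0 ?mulr0// nk0// !mulr0 subrr normr0 add0r.
have zp : 0 < enorm z by rewrite lt0r z0 enorm_ge0.
have zm : 0 < enorm z ^+ m by rewrite exprn_gt0.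
have nk0 : 0 < newton_kernel z by rewrite invr_gt0.
have [zd|zd] := ltP (enorm (tscale tau z)) d.
  apply: (@le_trans _ _ (e * newton_kernel z)); last by rewrite lerDl.
  have zz : 0 < enorm (tscale tau z) < d by rewrite zd nE mulr_gt0.
  have := Fd _ zz; rewrite nE exprMn => h.
  have -> : tau ^+ m * F (tscale tau z) - k * newton_kernel z =
    (F (tscale tau z) * (tau ^+ m * enorm z ^+ m) - k) * newton_kernel z.
    by rewrite /newton_kernel -/m; field; rewrite gt_eqF.
  by rewrite normrM (gtr0_norm nk0) ler_pM2r// ltW.
apply: (@le_trans _ _ (tau ^+ m * (M + `|k| / d ^+ m))); last by rewrite lerDr mulr_ge0// ltW.
apply: (le_trans (ler_normB _ _)); rewrite mulrDr !normrM (gtr0_norm tm0) (ger0_norm (F0 _))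
  (gtr0_norm nk0).
apply: lerD; first by rewrite ler_pM2l// FM.
(* In the far region [tau |z| >= d], so the kernel itself is of the small order [tau^(n-2)]. *)
have h : newton_kernel z <= tau ^+ m / d ^+ m.
  rewrite /newton_kernel -/m ler_pdivlMr// mulrC ler_pdivrMr// -exprMn -nE.
  by apply: lerXn2r; rewrite ?nnegrE ?enorm_ge0 ?(ltW d0).
by rewrite [leRHS]mulrCA ler_wpM2l.
Qed.

End Origin.

(** * Convergence in Lp *)

Section LpLimit.
Variables (R : realType) (n : nat).
Hypothesis n3 : (3 <= n)%N.
Local Notation tup n := (n.-tuple (measurableTypeR R)).
Local Notation lebn := (leb R n).
Variable u0 : n.-tuple R -> R.
Hypotheses (mu0 : measurable_fun [set: tup n] u0) (u00 : forall y, 0 <= u0 y).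
Variable U : R.
Hypothesis u0U : (\int[lebn]_y (u0 y)%:E = U%:E)%E.
Variable m : R.
Hypothesis m0 : 0 < m.
Local Notation rho := (2 * (m + n%:R)).

Lemma measurable_indic_ball r : measurable_fun [set: tup n] (fun x => \1_(ballN r) x : R).
Proof. by apply: measurable_indic; exact: measurable_ballN. Qed.

Lemma iint_indic_meas (A : set (tup n)) : measurable A ->
  iint (fun x : n.-tuple R => (\1_A x : R)%:E) = lebn A.
Proof.
move=> mA; rewrite -ge0_integral_leb//; last first.
  by apply/measurable_EFinP; apply: measurable_indic.
by rewrite integral_indic// setIT.
Qed.

(** For [p = +oo] this excludes negative [M] from the infimum in [LpOn], making the norm
    nonnegative. *)
Lemma leb_ball_gt0 : (0 < lebn (ballN m))%E.
Proof.
have n0 : (0 < n)%N by rewrite (leq_trans _ n3).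
have nR : 1 <= n%:R :> R by rewrite ler1n.
have [r r0 rE] : exists2 r : R, 0 < r & n%:R * r = m / 2.
  exists (m / (2 * n%:R)); first by rewrite divr_gt0// mulr_gt0// ltr0n.
  by field; rewrite gt_eqF// ltr0n.
rewrite -[X in lebn X]setIT -(integral_indic lebn measurableT (measurable_ballN (n:=n) m)).
apply: (@lt_le_trans _ _ (\int[lebn]_z (box r z)%:E)%E).
  by rewrite integral_box ?ltW// lte_fin exprn_gt0// mulr_gt0.
apply: ge0_le_integral => //.
- by move=> z _; rewrite lee_fin box_ge0.
- by apply/measurable_EFinP; exact: measurable_box.
- by apply/measurable_EFinP; exact: measurable_indic_ball.
move=> z _; rewrite lee_fin; have [[-> h]|->//] := boxP r z.
have ht := box_tdot h.
rewrite indicE mem_set//= /ballN/=; apply: (@le_lt_trans _ _ (n%:R * r)); last by rewrite rE;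
  have := m0; lra.
have nr0 : 0 <= n%:R * r by rewrite mulr_ge0// ltW.
rewrite -[leRHS]ger0_norm// -sqrtr_sqr; apply: ler_wsqrtr; apply: (le_trans ht).
by rewrite exprMn; apply: ler_wpM2r; rewrite ?sqr_ge0// [leRHS]expr2 ler_peMl// (le_trans ler01).
Qed.

Lemma leb_ball_lty : (lebn (ballN m) < +oo)%E.
Proof.
rewrite -[X in lebn X]setIT -(integral_indic lebn measurableT (measurable_ballN (n:=n) m)).
apply: (@le_lt_trans _ _ (\int[lebn]_z (box m z)%:E)%E); last by rewrite integral_box ?ltry// ltW.
apply: ge0_le_integral => //.
- by apply/measurable_EFinP; exact: measurable_indic_ball.
- by apply/measurable_EFinP; exact: measurable_box.
move=> z _; rewrite lee_fin indicE; case: (boolP (z \in _)); last by rewrite box_ge0.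
rewrite inE /ballN/= => zm; rewrite box_eq1// => i.
by rewrite (le_trans (coord_le_enorm _ _))// ltW.
Qed.

Variable D : R -> n.-tuple R -> \bar R.
Hypothesis HD : forall e : R, 0 < e -> exists2 c : R -> R, c t @[t --> +oo] --> (0 : R) &
  forall t, 0 < t -> 0 <= c t /\
    forall x, (`|D t x| <= e%:E * newton_pot u0 x + (c t)%:E)%E.

Let U0 : 0 <= U.
Proof. by rewrite -lee_fin -u0U; apply: integral_ge0 => y _; rewrite lee_fin. Qed.

Lemma measurable_core_pot (v : n.-tuple R -> R) : measurable_fun [set: tup n] v ->
  (forall y, 0 <= v y) -> measurable_fun [set: tup n] (core_pot v).
Proof.
move=> mv v0.
have mk := @measurable_newton_core R n.
have mf : measurable_fun setT (fun z : tup n * tup n => (newton_core (tsub z.1 z.2) * v z.2)%:E).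
  apply/measurable_EFinP; apply: measurable_funM.
    exact: (measurableT_comp mk (@measurable_tsub R n)).
  exact: (measurableT_comp mv measurable_snd).
rewrite (_ : core_pot v = fun x => iint (fun y => (newton_core (tsub x y) * v y)%:E)).
  exact: (measurable_iint mf).
apply/funext => x; rewrite -ge0_integral_leb//.
- by apply/measurable_EFinP; exact: measurable_nku.
- by move=> y; rewrite lee_fin mulr_ge0 ?newton_core_ge0.
Qed.

Lemma LpOn_cvg0_infty :
  (LpOn +oo%E (ballN rho) (fun x => (u0 x)%:E) < +oo)%E ->
  LpOn +oo%E (ballN m) (D t) @[t --> +oo] --> (0%E : \bar R).
Proof.
rewrite /LpOn => /ereal_inf_lt[M HM Moo].
(* [M] may be negative or [-oo]; enlarging it to a nonnegative real keeps the exceptional set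
   null. *)
pose M' : R := Num.max (fine M) 0.
have M'0 : 0 <= M' by rewrite le_max lexx orbT.
have N0 : lebn (ballN rho `&` [set y | M' < u0 y]) = 0%E.
  have mS (V : \bar R) : measurable (ballN rho `&` [set y | (V < `|(u0 y)%:E|)%E] : set (tup n)).
    apply: measurableI; first exact: measurable_ballN.
    rewrite -[X in measurable X]setTI; apply: emeasurable_fun_o_infty => //.
    by apply: measurableT_comp => //; exact/measurable_EFinP.
  move: HM => /=; rewrite (iint_indic_meas (mS M)) => hM.
  apply/eqP; rewrite eq_le measure_ge0 andbT -hM.
  have mS' : measurable (ballN rho `&` [set y | M' < u0 y] : set (tup n)).
    have := mS M'%:E; congr (measurable (_ `&` _)).
    by apply/seteqP; split => y /=; rewrite lte_fin ger0_norm.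
  apply: le_measure; rewrite ?inE//.
  move=> y /= [yb My]; split => //; case: (M) Moo @M' M'0 My {hM mS'} => [a| |]//= _ _ h.
    by rewrite lte_fin ger0_norm// (le_lt_trans _ h)// le_max lexx.
  by rewrite ltNyr.
have [k1 k10 hk1] := newton_core_bound R n3.
have Phile x : ballN m x -> (newton_pot u0 x <= (k1 * M' + U)%:E)%E.
  move=> xm; apply: (le_trans (newton_pot_le mu0 u00 x)); rewrite u0U EFinD leeD2r//.
  exact: (core_pot_bounded n3 mu0 u00 m0 xm M'0 (hk1 x) N0).
pose K := k1 * M' + U; have K0 : 0 <= K by rewrite addr_ge0// mulr_ge0// ltW.
apply: cvg0_near_le.
  move=> t t0; apply: le_ereal_inf_tmp => V /= hV; rewrite leNgt; apply/negP => V0.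
  move: hV; rewrite (_ : _ `&` _ = ballN m).
    rewrite (iint_indic_meas (measurable_ballN (n:=n) m)) => h.
    by have := leb_ball_gt0; rewrite h ltxx.
  by apply/seteqP; split => [y [] //|y yb]; split => //=; rewrite (lt_le_trans V0).
(* [K] bounds the potential on the ball, so [e1 * K <= e / 2]; [c t] takes the other half, and the
   set where [D t] exceeds [e] is empty. *)
move=> e e0; pose e1 := e / 2 / (K + 1).
have K10 : 0 < K + 1 by rewrite ltr_wpDl.
have e10 : 0 < e1 by rewrite !divr_gt0.
have [c /cvgrPdist_le hc0 hc] := HD e10.
near=> t; have t0 : 0 < t by near: t; exact: nbhs_pinfty_gt.
have [ct0 hct] := hc t t0.
have cte : c t <= e / 2.
  suff : `|0 - c t| <= e / 2 by rewrite sub0r normrN ger0_norm.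
  by near: t; apply: hc0; rewrite divr_gt0.
apply: ereal_inf_lbound => /=; rewrite (_ : _ `&` _ = set0).
  rewrite (_ : (fun x => _) = cst 0%E); last by apply/funext => x; rewrite indic0.
  by rewrite -ge0_integral_leb// integral0.
apply/seteqP; split => // x [xm] /=; apply/negP; rewrite -leNgt.
apply: (le_trans (hct x)).
apply: (@le_trans _ _ (e1%:E * K%:E + (c t)%:E)%E).
  by rewrite leeD2r//; apply: lee_wpmul2l; [rewrite lee_fin ltW|exact: Phile].
rewrite -EFinM -EFinD lee_fin (_ : e = e / 2 + e / 2); last by field.
apply: lerD => //; rewrite /e1 mulrAC ler_pdivrMr// ler_wpM2l ?divr_ge0 ?ltW//.
by rewrite ltrDl.
Unshelve. all: end_near. Qed.

Hypothesis mD : forall t, 0 < t -> measurable_fun [set: tup n] (D t).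

Lemma LpOn_cvg0_fin (r : R) : 1 < r ->
  (LpOn r%:E (ballN rho) (fun x => (u0 x)%:E) < +oo)%E ->
  LpOn r%:E (ballN m) (D t) @[t --> +oo] --> (0%E : \bar R).
Proof.
move=> r1; have r0 : 0 < r by rewrite (lt_trans ltr01).
rewrite /LpOn => hW; have {}hW := lty_poweRy (_ : r^-1 != 0) hW.
have [k1 k10 hk1] := newton_core_bound R n3.
pose W := (\int[lebn]_y ((\1_(ballN rho) y)%:E * (u0 y `^ r)%:E))%E.
have mur : measurable_fun [set: tup n] (fun y => u0 y `^ r).
  exact: (measurableT_comp (@measurable_powR R r) mu0).
have W0 : (0 <= W)%E by apply: integral_ge0 => y _; rewrite -EFinM lee_fin mulr_ge0 ?powR_ge0.
have Wfin : W \is a fin_num.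
  rewrite ge0_fin_numE// /W ge0_integral_leb.
  - rewrite (_ : (fun y => _) = (fun x => (\1_(ballN rho) x)%:E * `|(u0 x)%:E| `^ r)%E).
      by apply: hW; rewrite invr_eq0 gt_eqF.
    by apply/funext => y; rewrite /= ger0_norm.
  - by apply: emeasurable_funM; apply/measurable_EFinP => //; exact: measurable_indic_ball.
  - by move=> y; rewrite -EFinM lee_fin mulr_ge0 ?powR_ge0.
pose w := fine W; have w0 : 0 <= w by rewrite fine_ge0.
have V0 : (0 <= lebn (ballN m))%E by exact: measure_ge0.
have Vfin : lebn (ballN m) \is a fin_num by rewrite ge0_fin_numE// leb_ball_lty.
pose v := fine (lebn (ballN m)); have v0 : 0 <= v by rewrite fine_ge0.
have Dbound (e c t : R) : 0 < t -> 0 <= e -> 0 <= c ->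
   (forall x, (`|D t x| <= e%:E * newton_pot u0 x + c%:E)%E) ->
   (iint (fun x => (\1_(ballN m) x)%:E * `|D t x| `^ r) <=
    (2 `^ r * (e `^ r * (k1 `^ (r - 1) * (k1 * w)) + (e * U + c) `^ r * v))%:E)%E.
  move=> t0 e0 c0 hD.
  pose Psi := core_pot (fun y => u0 y `^ r).
  have Psi0 x : (0 <= Psi x)%E by apply: core_pot_ge0 => y; exact: powR_ge0.
  have C0 : 0 <= e * U + c by rewrite addr_ge0// mulr_ge0.
  have mPsi : measurable_fun [set: tup n] Psi.
    by apply: measurable_core_pot => // y; exact: powR_ge0.
  have pw x : (`|D t x| `^ r <= (2 `^ r)%:E * ((e `^ r * k1 `^ (r - 1))%:E * Psi x + ((e *
    U + c) `^ r)%:E))%E.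
    have P0 := core_pot_ge0 x u00.
    apply: (@le_trans _ _ ((e%:E * core_pot u0 x + (e * U + c)%:E) `^ r)%E).
      apply: le_poweR; rewrite ?(ltW r0)//. apply: (le_trans (hD x)).
      rewrite EFinD EFinM addeA leeD2r// -ge0_muleDr ?lee_fin//.
      by apply: lee_wpmul2l; rewrite ?lee_fin// -u0U; exact: newton_pot_le.
    apply: (le_trans (poweR_add_le r0 _ _)); rewrite ?lee_fin ?mule_ge0 ?lee_fin//.
    apply: lee_wpmul2l; rewrite ?lee_fin ?powR_ge0// poweR_EFin leeD2r// poweRM ?lee_fin//
      poweR_EFin EFinM -muleA.
    apply: lee_wpmul2l; rewrite ?lee_fin ?powR_ge0//; exact: core_pot_pow.
  have mI : measurable_fun [set: tup n] (fun x => (\1_(ballN m) x : R)%:E).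
    by apply/measurable_EFinP; exact: measurable_indic_ball.
  have mDr : measurable_fun [set: tup n] (fun x => (\1_(ballN m) x)%:E * `|D t x| `^ r)%E.
    apply: emeasurable_funM => //; apply: (measurableT_comp (@measurable_poweR R r)).
    by apply: measurableT_comp => //; exact: mD.
  rewrite -ge0_integral_leb//; last by move=> x; rewrite mule_ge0 ?poweR_ge0 ?lee_fin.
  pose P := e `^ r * k1 `^ (r - 1); pose Q := (e * U + c) `^ r.
  have P0 : 0 <= P by rewrite mulr_ge0 ?powR_ge0.
  have Q0 : 0 <= Q by rewrite powR_ge0.
  have p20 : 0 <= 2 `^ r :> R by rewrite powR_ge0.
  apply: (@le_trans _ _ (\int[lebn]_x ((2 `^ r * P)%:E * ((\1_(ballN m) x)%:E *
    Psi x) + (2 `^ r * Q)%:E * (\1_(ballN m) x)%:E))%E).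
    apply: ge0_le_integral => //.
    - by move=> x _; rewrite mule_ge0 ?poweR_ge0 ?lee_fin.
    - by apply: emeasurable_funD; apply: measurable_funeM => //; exact: emeasurable_funM.
    move=> x _; apply: (@le_trans _ _ ((\1_(ballN m) x)%:E * ((2 `^ r)%:E * (P%:E *
      Psi x + Q%:E)))%E).
      by rewrite lee_wpmul2l ?lee_fin.
    rewrite indicE; case: (x \in _); last by rewrite !mul0e !mule0 adde0.
    rewrite !mul1e mule1 muleDr//; last by rewrite ge0_adde_def ?inE ?mule_ge0 ?lee_fin.
    by rewrite muleA !EFinM.
  have PP0 : 0 <= 2 `^ r * P by exact: mulr_ge0.
  have QQ0 : 0 <= 2 `^ r * Q by exact: mulr_ge0.
  have i0 x : (0 <= (\1_(ballN m) x : R)%:E)%E by rewrite lee_fin.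
  rewrite ge0_integralD//; last 4 first.
  - by move=> x _; apply: mule_ge0; [rewrite lee_fin|exact: mule_ge0].
  - by apply: measurable_funeM; exact: emeasurable_funM.
  - by move=> x _; apply: mule_ge0; rewrite ?lee_fin.
  - exact: measurable_funeM.
  rewrite !ge0_integralZl_EFin//; last 2 first.
  - by move=> x _; exact: mule_ge0.
  - exact: emeasurable_funM.
  have -> : (\int[lebn]_x (\1_(ballN m) x)%:E = v%:E)%E.
    by rewrite integral_indic//; [rewrite setIT fineK|exact: measurable_ballN].
  apply: (@le_trans _ _ ((2 `^ r * P)%:E * (k1%:E * W) + (2 `^ r * Q)%:E * v%:E)%E).
    rewrite leeD2r//; apply: lee_wpmul2l; rewrite ?lee_fin//.
    exact: integral_core_pot.
  rewrite -(fineK Wfin) -/w -!EFinM -EFinD lee_fin /P /Q le_eqVlt; apply/orP; left; apply/eqP; ring.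
apply: cvg0_near_le; first by move=> t _; exact: poweR_ge0.
move=> dl dl0.
(* Once [c t <= e], the bound [Dbound] with both parameters [e] becomes [e^r * Q], and [e] is chosen
   with [e^r (Q + 1) = dl^r]. *)
pose Q := 2 `^ r * (k1 `^ (r - 1) * (k1 * w) + (U + 1) `^ r * v).
have Q0 : 0 <= Q.
  rewrite mulr_ge0 ?powR_ge0// addr_ge0// !mulr_ge0 ?powR_ge0// ltW//.
have Q10 : 0 < Q + 1 by rewrite ltr_wpDl.
pose e := dl / (Q + 1) `^ r^-1.
have qr0 : 0 < (Q + 1) `^ r^-1 by rewrite powR_gt0.
have e0 : 0 < e by rewrite divr_gt0.
have er : e `^ r * (Q + 1) = dl `^ r.
  rewrite /e powRM ?invr_ge0 ?ltW// -powR_inv1 ?ltW// -powRrM -powRrM.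
  rewrite (_ : r^-1 * (-1 * r) = -1); last by field; rewrite gt_eqF.
  by rewrite powR_inv1 ?ltW// -mulrA mulVf ?mulr1// gt_eqF.
have [c /cvgrPdist_le hc0 hc] := HD e0.
near=> t; have t0 : 0 < t by near: t; exact: nbhs_pinfty_gt.
have [ct0 hct] := hc t t0.
have cte : c t <= e.
  suff : `|0 - c t| <= e by rewrite sub0r normrN ger0_norm.
  by near: t; exact: hc0.
have hE x : (`|D t x| <= e%:E * newton_pot u0 x + e%:E)%E.
  by apply: (le_trans (hct x)); rewrite leeD2l// lee_fin.
have := Dbound e e t t0 (ltW e0) (ltW e0) hE.
set I := iint _ => hI.
have I0 : (0 <= I)%E.
  rewrite /I -ge0_integral_leb.
  - by apply: integral_ge0 => x _; rewrite mule_ge0 ?poweR_ge0 ?lee_fin.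
  - apply: emeasurable_funM; first by apply/measurable_EFinP; exact: measurable_indic_ball.
    apply: (measurableT_comp (@measurable_poweR R r)).
    by apply: measurableT_comp => //; exact: mD.
  - by move=> x; rewrite mule_ge0 ?poweR_ge0 ?lee_fin.
have hI2 : (I <= (dl `^ r)%:E)%E.
  apply: (le_trans hI); rewrite lee_fin -er.
  have -> : e * U + e = e * (U + 1) by ring.
  rewrite powRM ?(ltW e0) ?addr_ge0//.
  have -> : 2 `^ r * (e `^ r * (k1 `^ (r - 1) * (k1 * w)) + e `^ r * (U + 1) `^ r * v) = e `^ r * Q.
    by rewrite /Q; ring.
  by rewrite ler_wpM2l ?powR_ge0// lerDl.
apply: (@le_trans _ _ ((dl `^ r)%:E `^ r^-1)%E).
  by apply: le_poweR => //; rewrite invr_ge0 ltW.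
by rewrite poweR_EFin -powRrM mulfV ?gt_eqF// powRr1// ltW.
Unshelve. all: end_near. Qed.

End LpLimit.

(** * The solution as a convolution with the rescaled profile *)

Lemma powRN_cvg0 (R : realType) (b : R) : 0 < b -> t `^ (- b) @[t --> +oo] --> (0 : R).
Proof.
move=> b0; apply/cvgrPdist_le => e e0; near=> t.
have t0 : 0 < t by near: t; exact: nbhs_pinfty_gt.
rewrite sub0r normrN ger0_norm ?powR_ge0// powRN invf_ple ?posrE ?powR_gt0//.
have et : (e^-1) `^ b^-1 <= t by near: t; exact: nbhs_pinfty_ge.
rewrite (_ : e^-1 = ((e^-1) `^ b^-1) `^ b); first by rewrite ge0_ler_powR ?nnegrE ?powR_ge0// ltW.
by rewrite -powRrM mulVf ?gt_eqF// powRr1// invr_ge0 ltW.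
Unshelve. all: end_near. Qed.

(** This is why [t^alpha] is the right normalization: [t^alpha Z(z, t) = tau^(n-2) F(tau z)] for
    [tau = t^(- alpha / 2)], which has the homogeneity of the Newtonian kernel. *)
Lemma powR_self_similar (R : realType) (al t : R) (n : nat) : (2 <= n)%N -> 0 < t ->
  t `^ al * t `^ (- (al * n%:R / 2)) = (t `^ (- (al / 2))) ^+ (n - 2).
Proof.
move=> n2 t0; rewrite -powRD ?(gt_eqF t0) ?implybT// -powR_mulrn ?powR_ge0// -powRrM.
by congr (_ `^ _); rewrite natrB//; field.
Qed.

Section PuncturedProfile.
Variables (R : realType) (n : nat).
Hypothesis n3 : (3 <= n)%N.
Local Notation tup n := (n.-tuple (measurableTypeR R)).
Local Notation lebn := (leb R n).
Variables (al : R) (F : n.-tuple R -> R).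
Hypotheses (al0 : 0 < al) (al1 : al < 1).
Hypothesis mF : measurable_fun [set: tup n] F.

(* The hypotheses say nothing about the value of F at the origin. *)
Definition punctured (z : n.-tuple R) : R := F z * \1_([set z | enorm z != 0]) z.

Lemma puncturedE z : enorm z != 0 -> punctured z = F z.
Proof. by move=> z0; rewrite /punctured indicE mem_set// mulr1. Qed.

Lemma punctured0 z : enorm z = 0 -> punctured z = 0.
Proof. by move=> z0; rewrite /punctured indicE memNset ?mulr0//= z0 eqxx. Qed.

Lemma measurable_punctured : measurable_fun [set: tup n] punctured.
Proof.
apply: measurable_funM => //; apply: measurable_indic.
rewrite (_ : mkset _ = ~` [set z | enorm z = 0]); first by apply: measurableC;
  exact: measurable_enorm0.
by apply/seteqP; split => z /= /eqP.
Qed.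

Let n0 : (0 < n)%N. Proof. by rewrite (leq_trans _ n3). Qed.

Lemma iint_punctured (f g : n.-tuple R -> \bar R) :
  measurable_fun [set: tup n] f -> measurable_fun [set: tup n] g ->
  (forall z, enorm z != 0 -> f z = g z) -> iint f = iint g.
Proof.
move=> mf mg fg; apply: (ae_eq_iint mf mg (@measurable_enorm0 R n) (@leb_enorm0 R n n0)).
by move=> z /eqP; exact: fg.
Qed.

Hypothesis Fi : (iint (fun x => (`| F x |)%:E) < +oo)%E.
Hypothesis Fcont : forall x0 : n.-tuple R, enorm x0 != 0 ->
  forall e : R, 0 < e -> exists2 d : R, 0 < d &
    forall x, enorm (tsub x x0) < d -> `| F x - F x0 | < e.
Hypothesis Fpos : forall x : n.-tuple R, enorm x != 0 -> 0 < F x.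
Hypothesis Fhat : forall (t : R) (w : n.-tuple R), 0 < t ->
  iint (fun x => (Zkernel al F x t * cos (tdot x w))%:E)
    = (MittagLeffler al (- (enorm w ^+ 2 * t `^ al)))%:E /\
  iint (fun x => (Zkernel al F x t * sin (tdot x w))%:E) = 0%E.

Lemma punctured_ge0 z : 0 <= punctured z.
Proof.
have [z0|z0] := eqVneq (enorm z) 0; first by rewrite punctured0.
by rewrite puncturedE// ltW// Fpos.
Qed.

Lemma integrable_punctured : lebn.-integrable setT (EFin \o punctured).
Proof.
have mp := measurable_punctured.
apply/integrableP; split; first exact/measurable_EFinP.
rewrite ge0_integral_leb//; last by apply/measurable_EFinP; exact: measurableT_comp.
rewrite (@iint_punctured _ (fun x => (`|F x|)%:E))//.
- by apply/measurable_EFinP; exact: measurableT_comp.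
- by apply/measurable_EFinP; exact: measurableT_comp.
- by move=> z z0 /=; rewrite puncturedE.
Qed.

Lemma Zkernel1 x : Zkernel al F x 1 = F x.
Proof.
rewrite /Zkernel !powR1 mul1r; congr F; apply: eq_from_tnth => i.
by rewrite tnth_mktuple mul1r.
Qed.

Lemma integral_punctured (h : R -> R) (w : n.-tuple R) : measurable_fun setT h ->
  (forall x, `|h x| <= 1) ->
  (\int[lebn]_y (punctured y * h (tdot y w)))%R =
  fine (iint (fun x => (Zkernel al F x 1 * h (tdot x w))%:E)).
Proof.
move=> mh h1; have mp := measurable_punctured.
have mhw : measurable_fun [set: tup n] (fun y => h (tdot y w)).
  rewrite (_ : (fun y => _) = h \o tdot w); last first.
    by apply/funext => y /=; congr h; apply: eq_bigr => i _; rewrite mulrC.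
  exact: (measurableT_comp mh (measurable_tdotr w)).
have mph : measurable_fun [set: tup n] (fun y => punctured y * h (tdot y w)).
  exact: measurable_funM.
rewrite /Rintegral integral_leb.
  congr fine; apply: iint_punctured.
  - exact/measurable_EFinP.
  - by apply/measurable_EFinP; under eq_fun do rewrite Zkernel1; exact: measurable_funM.
  - by move=> z z0; rewrite puncturedE// Zkernel1.
apply: (le_integrable measurableT _ _ integrable_punctured); first exact/measurable_EFinP.
by move=> y _ /=; rewrite lee_fin normrM ler_piMr.
Qed.

Lemma punctured_bounded (d : R) : 0 < d -> exists2 M : R, 0 <= M &
  forall z, d <= enorm z -> punctured z <= M.
Proof.
move=> d0; set M : R := 2 * (Num.sqrt (4 * pi / d ^+ 2) * n%:R) ^+ n
  / ((2 * Num.sqrt pi) ^+ n * expR (- (n%:R / 4))).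
exists M; first by rewrite !(divr_ge0, mulr_ge0, exprn_ge0, expR_ge0, sqrtr_ge0, ler0n).
move=> z dz; have z0 : enorm z != 0 by rewrite gt_eqF// (lt_le_trans d0).
apply: (profile_le al0 al1 n0 measurable_punctured punctured_ge0 integrable_punctured).
- move=> w; rewrite (integral_punctured _ (@measurable_cos R))//; last exact: cos_norm_le1.
  by have [-> _] := Fhat w (@ltr01 R); rewrite powR1 mulr1 enorm_sqr.
- move=> w; rewrite (integral_punctured _ (@measurable_sin R))//; last by move=> u;
  rewrite ler_norml sin_geN1 sin_le1.
  by have [_ ->] := Fhat w (@ltr01 R).
- move=> e e0; have [d' d'0 h] := Fcont z0 e0.
  (* Staying within [enorm z] of [z] keeps [y] off the origin, where [punctured] and [F] may
     differ. *)
  exists (Num.min d' (enorm z)); first by rewrite lt_min d'0 lt_neqAle eq_sym z0 enorm_ge0.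
  move=> y; rewrite lt_min => /andP[yd yz]; rewrite (puncturedE z0) puncturedE; first exact: h.
  apply/eqP => y0; move: yz; rewrite (_ : enorm (tsub y z) = enorm z) ?ltxx//.
  have y0i i : tnth y i = 0.
    by apply/eqP; rewrite -normr_le0 -y0 coord_le_enorm.
  by rewrite /enorm /tdot; congr (Num.sqrt _); apply: eq_bigr => i _; rewrite tnth_mktuple y0i;
    ring.
- by rewrite exprn_gt0//= -enorm_sqr lerXn2r// nnegrE ltW// (lt_le_trans d0).
Qed.

Variables (u0 : n.-tuple R -> R) (U kappa : R).
Hypotheses (mu0 : measurable_fun [set: tup n] u0) (u00 : forall y, 0 <= u0 y).
Hypothesis u0U : (\int[lebn]_y (u0 y)%:E = U%:E)%E.
Hypothesis Fkappa : forall e : R, 0 < e -> exists2 d : R, 0 < d &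
  forall xi : n.-tuple R, 0 < enorm xi < d ->
    `| F xi * enorm xi ^+ (n - 2) - kappa | < e.

Lemma measurable_Zkernel_tsub t :
  measurable_fun setT (fun z : tup n * tup n => Zkernel al F (tsub z.1 z.2) t * u0 z.2).
Proof.
apply: measurable_funM; last exact: (measurableT_comp mu0 measurable_snd).
apply: measurable_funM => //; apply: (measurableT_comp mF).
exact: (measurableT_comp (measurable_tscale (n:=n) _) (@measurable_tsub R n)).
Qed.

Lemma measurable_mild_sol t : measurable_fun [set: tup n] (fun x => mild_sol al F u0 x t).
Proof.
have /measurable_EFinP mZ := measurable_Zkernel_tsub t.
exact: (measurable_iint mZ).
Qed.

Lemma measurable_newton_pot : measurable_fun [set: tup n] (newton_pot u0).
Proof.
have mf : measurable_fun setT (fun z : tup n * tup n =>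
  (u0 (tsub z.1 z.2) / enorm z.2 ^+ (n - 2))%:E).
  apply/measurable_EFinP; apply: measurable_funM.
    exact: (measurableT_comp mu0 (@measurable_tsub R n)).
  exact: (measurableT_comp (@measurable_nk R n) measurable_snd).
exact: (measurable_iint mf).
Qed.

(** Replacing [F] by [punctured] alters the integrand only where [|x - y| = 0], a null set. *)
Lemma mild_solE t x : 0 < t ->
  ((t `^ al)%:E * mild_sol al F u0 x t = \int[lebn]_y
    ((t `^ (- (al / 2))) ^+ (n - 2) * punctured (tscale (t `^ (- (al / 2))) (tsub x y)) *
      u0 y)%:E)%E.
Proof.
move=> t0; rewrite -powR_self_similar 1?ltnW//.
set tau := t `^ (- (al / 2)); have tau0 : 0 < tau by rewrite powR_gt0.
pose g y := punctured (tscale tau (tsub x y)) * u0 y.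
have mg : measurable_fun [set: tup n] g.
  apply: measurable_funM => //.
  apply: (measurableT_comp measurable_punctured).
  exact: (measurableT_comp (measurable_tscale (n:=n) tau) (measurable_tsubl x)).
have g0 y : 0 <= g y by rewrite mulr_ge0 ?punctured_ge0.
pose b := t `^ (- (al * n%:R / 2)).
have b0 : 0 <= b by rewrite powR_ge0.
have -> : mild_sol al F u0 x t = iint (fun y => (b * g y)%:E).
  have m1 : measurable ([set y | enorm (tsub x y) = 0] : set (tup n)).
    rewrite -[X in measurable X]setTI.
    exact: (measurable_tsubl x measurableT (@measurable_enorm0 R n)).
  apply: (ae_eq_iint _ _ m1 (leb_tsub0 x n0)).
  - apply/measurable_EFinP; apply: measurable_funM => //; apply: measurable_funM => //.
    apply: (measurableT_comp mF).
    exact: (measurableT_comp (measurable_tscale (n:=n) tau) (measurable_tsubl x)).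
  - by apply/measurable_EFinP; exact: measurable_funM.
  - move=> y /= /eqP y0; rewrite /Zkernel -/tau /g puncturedE ?mulrA//.
    by rewrite enorm_tscale ?ltW// mulf_neq0// gt_eqF.
rewrite -ge0_integral_leb; last 2 first.
- by apply/measurable_EFinP; exact: measurable_funM.
- by move=> y; rewrite lee_fin mulr_ge0.
rewrite -ge0_integralZl_EFin ?powR_ge0//.
- by apply: eq_integral => y _; rewrite -EFinM /g !mulrA.
- by move=> y _; rewrite lee_fin mulr_ge0.
- by apply/measurable_EFinP; exact: measurable_funM.
Qed.

(** The kernel estimate integrated against [u0]; [c t] is [tau^(n-2)] times a constant depending on
    [e], and tends to zero because [n > 2]. *)
Lemma mild_sol_diff (e : R) : 0 < e -> exists2 c : R -> R, c t @[t --> +oo] --> (0 : R) &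
  forall t, 0 < t -> 0 <= c t /\ forall x,
    (`|(t `^ al)%:E * mild_sol al F u0 x t - kappa%:E * newton_pot u0 x| <=
     e%:E * newton_pot u0 x + (c t)%:E)%E.
Proof.
move=> e0; have [d d0 hd] := Fkappa e0; have [M M0 hM] := punctured_bounded d0.
pose K := M + `|kappa| / d ^+ (n - 2).
have K0 : 0 <= K by rewrite addr_ge0// divr_ge0// exprn_ge0// ltW.
have U0 : 0 <= U by rewrite -lee_fin -u0U; apply: integral_ge0 => y _; rewrite lee_fin.
have n20 : (0 < n - 2)%N by rewrite subn_gt0.
exists (fun t => (t `^ (- (al / 2))) ^+ (n - 2) * K * U).
  have h0 : (t `^ (- (al / 2))) ^+ (n - 2) @[t --> +oo] --> (0 : R).
    rewrite (_ : (fun t => _) = fun t => t `^ (- (al / 2 * (n - 2)%:R))).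
      by apply: powRN_cvg0; rewrite !mulr_gt0// ltr0n.
    by apply/funext => t; rewrite -powR_mulrn ?powR_ge0// -powRrM mulNr.
  rewrite (_ : (fun t => _) = fun t => (t `^ (- (al / 2))) ^+ (n - 2) * (K * U)).
    by rewrite -[X in _ --> X](mul0r (K * U)); exact: cvgMr_tmp.
  by apply/funext => t; rewrite mulrA.
move=> t t0; set tau := t `^ (- (al / 2)).
have tau0 : 0 < tau by rewrite powR_gt0.
have c0 : 0 <= tau ^+ (n - 2) * K by rewrite mulr_ge0// exprn_ge0// ltW.
split; first by rewrite mulr_ge0.
move=> x; rewrite mild_solE// newton_potE// -/tau EFinM -u0U.
have mu (k : n.-tuple R -> R) := @measurable_nku R n u0 mu0 x k.
apply: le_integral_diff => //.
- have := mu (fun z => tau ^+ (n - 2) * punctured (tscale tau z)); apply.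
  apply: measurable_funM => //; apply: (measurableT_comp measurable_punctured).
  exact: measurable_tscale.
- by apply: mu; exact: measurable_nk.
- by move=> y; rewrite !(punctured_ge0, mulr_ge0, exprn_ge0)// ltW.
- by move=> y; rewrite mulr_ge0 ?nk_ge0.
- by rewrite u0U ltry.
move=> y; have := @newton_kernel_diff R n punctured kappa d e M tau (tsub x y) n3 d0 e0 M0 tau0
  punctured0 punctured_ge0.
have h1 : forall z : n.-tuple R, 0 < enorm z < d -> `|punctured z * enorm z ^+ (n - 2) - kappa| < e.
  by move=> z hz; rewrite puncturedE ?hd//; case/andP: hz => z0 _; rewrite gt_eqF.
move=> /(_ h1 hM); rewrite -/K.
move: (newton_kernel _) (punctured _) => a b h.
rewrite mulrA -mulrBl normrM (ger0_norm (u00 y)) mulrA -mulrDl.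
exact: ler_wpM2r.
Qed.

End PuncturedProfile.

Unset Implicit Arguments.

Theorem theorem5p5 (R : realType) (N : nat) (alpha : R)
  (F : N.-tuple R -> R) (kappa : R) (p : \bar R)
  (u0 : N.-tuple R -> R) (mu : R) :
  (3 <= N)%N ->
  0 < alpha < 1 ->
  (* the fundamental solution Z(x,t) = t^{-alpha N/2} F(x t^{-alpha/2}):
     profile F measurable, integrable, continuous and positive off 0, and
     the Fourier transform of Z(.,t) is E_alpha(-|w|^2 t^alpha) *)
  measurable_fun [set: N.-tuple R] F ->
  (iint (fun x => (`| F x |)%:E) < +oo)%E ->
  (forall x0 : N.-tuple R, enorm x0 != 0 ->
     forall e : R, 0 < e -> exists2 d : R, 0 < d &
       forall x, enorm (tsub x x0) < d -> `| F x - F x0 | < e) ->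
  (forall x : N.-tuple R, enorm x != 0 -> 0 < F x) ->
  (forall (t : R) (w : N.-tuple R), 0 < t ->
     iint (fun x => (Zkernel alpha F x t * cos (tdot x w))%:E)
       = (MittagLeffler alpha (- (enorm w ^+ 2 * t `^ alpha)))%:E /\
     iint (fun x => (Zkernel alpha F x t * sin (tdot x w))%:E) = 0%E) ->
  (* kappa = lim_{xi -> 0} F(xi) / |xi|^{2-N} *)
  (forall e : R, 0 < e -> exists2 d : R, 0 < d &
     forall xi : N.-tuple R, 0 < enorm xi < d ->
       `| F xi * enorm xi ^+ (N - 2) - kappa | < e) ->
  (* p in (p_c, +oo], p_c = N/(N-2) *)
  ((N%:R / (N%:R - 2))%:E < p)%E ->
  (* u0 in L^1 cap L^p_loc, nonnegative, nontrivial *)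
  measurable_fun [set: N.-tuple R] u0 ->
  (forall x, 0 <= u0 x) ->
  (iint (fun x => (u0 x)%:E) < +oo)%E ->
  (forall r : R, 0 < r -> (LpOn p (ballN r) (fun x => (u0 x)%:E) < +oo)%E) ->
  iint (fun x => (\1_[set y | u0 y != 0] x)%:E) != 0%E ->
  0 < mu ->
  (fun t : R => LpOn p (ballN mu)
     (fun x => ((t `^ alpha)%:E * mild_sol alpha F u0 x t
                - kappa%:E * newton_pot u0 x)%E))
    @ +oo --> 0%E.
Proof.
move=> n3 /andP[al0 al1] mF Fi Fcont Fpos Fhat Fkappa pc mu0 u00 u0i u0p _ m0.
have mu0E : measurable_fun [set: N.-tuple (measurableTypeR R)] (EFin \o u0).
  exact/measurable_EFinP.
have u0I : (\int[leb R N]_y (u0 y)%:E = iint (fun y => (u0 y)%:E))%E.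
  by apply: ge0_integral_leb => // y; rewrite lee_fin.
have [U u0U] : exists U : R, (\int[leb R N]_y (u0 y)%:E = U%:E)%E.
  exists (fine (\int[leb R N]_y (u0 y)%:E)); rewrite fineK// ge0_fin_numE ?u0I//.
  by rewrite -u0I integral_ge0// => y _; rewrite lee_fin.
pose D t x := ((t `^ alpha)%:E * mild_sol alpha F u0 x t - kappa%:E * newton_pot u0 x)%E.
have HD := mild_sol_diff n3 al0 al1 mF Fi Fcont Fpos Fhat mu0 u00 u0U Fkappa.
(* The radius of the ball from [near_core], on which [u0] must be in [L^p]. *)
have rho0 : 0 < 2 * (mu + N%:R) by rewrite mulr_gt0// ltr_wpDr.
have uL := u0p _ rho0.
case: p pc {u0p} uL => [r| |//] pc uL.
- apply: (LpOn_cvg0_fin n3 mu0 u00 u0U m0 HD) => //.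
    move=> t t0; apply: emeasurable_funB; apply: measurable_funeM.
      exact: measurable_mild_sol.
    exact: measurable_newton_pot.
  (* [r > 1] follows from [N / (N - 2) > 1]. *)
  have N2 : 0 < N%:R - 2 :> R by rewrite subr_gt0 ltr_nat.
  move: pc; rewrite lte_fin; apply: lt_trans.
  by rewrite ltr_pdivlMr// mul1r gtrDl oppr_lt0.
- exact: (LpOn_cvg0_infty n3 mu0 u00 u0U m0 HD).
Qed.
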